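(* Let $T>0$, $d\in\mathbb N$, $\beta>0$, $\ell\in\mathbb N$, and let $a\in\mathcal T^\beta([0,T];\mathbb R^d\otimes\mathbb R^d)$, $b\in\mathcal T^\beta([0,T];\mathbb R^d)$, $c\in\mathcal T^\beta([0,T];\mathbb C^d)$, $g,h\in\mathcal T^\beta([0,T];\mathbb C)$ (classes defined in the context), with $\sum_{i,j}a_{ij}(t)\xi_i\xi_j\ge\lambda_0|\xi|^2$ on $[0,T]\times\mathbb R^d$ for some $\lambda_0>0$. Suppose in addition that $$g(0)=0,\qquad h(0)=h'(0)=0,$$ that is, we consider non-singular equations, in which $t^{-1}g$ and $t^{-2}h$ are regular coefficients ($g(t)=O(t)$, $h(t)=O(t^2)$). Let $$\mu:=\frac1{2(\ell+1)}\sup_{\omega\in\mathbb S^{d-1}}\frac{|\operatorname{Re}[\mathfrak c(0,\omega)-\ell\,\mathfrak b(0,\omega)]|}{\alpha(0,\omega)}.$$ Consider, for each $\xi\in\mathbb R^d$, the equation (W) on $(0,T]$ given in the context. (Asymptotics) For any $\hat\phi_0,\hat\phi_1:\mathbb R^d\to\mathbb C$ there is a unique solution $\hat\phi$ of (W) with $(\hat\phi,\partial_t\hat\phi)(T,\cdot)=(\hat\phi_0,\hat\phi_1)$. Furthermore, for all $\xi\in\mathbb R^d$, the limits $\hat\phi(0,\xi):=\lim_{\tau\searrow0}\hat\phi(\tau,\xi)$ and $\partial_t\hat\phi(0,\xi):=\lim_{\tau\searrow0}\partial_t\hat\phi(\tau,\xi)$ exist and are finite. In addition, for any $\xi\in\mathbb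 R^d$, $$\langle\xi\rangle^{\frac1{\ell+1}}|\hat\phi(0,\xi)|+|\partial_t\hat\phi(0,\xi)|\lesssim\langle\xi\rangle^\mu\big[\langle\xi\rangle^{1-\frac\ell{2(\ell+1)}}|\hat\phi(T,\xi)|+\langle\xi\rangle^{-\frac\ell{2(\ell+1)}}|\partial_t\hat\phi(T,\xi)|\big].$$ (Scattering) Given $\hat\phi_0,\hat\phi_1:\mathbb R^d\to\mathbb C$, there is a unique solution $\hat\phi$ of (W) such that $\hat\phi(0,\xi):=\lim_{\tau\searrow0}\hat\phi(\tau,\xi)=\hat\phi_0(\xi)$ and $\partial_t\hat\phi(0,\xi):=\lim_{\tau\searrow0}\partial_t\hat\phi(\tau,\xi)=\hat\phi_1(\xi)$ for all $\xi\in\mathbb R^d$. In addition, for any $\xi\in\mathbb R^d$, $$\langle\xi\rangle^{1-\frac\ell{2(\ell+1)}}|\hat\phi(T,\xi)|+\langle\xi\rangle^{-\frac\ell{2(\ell+1)}}|\partial_t\hat\phi(T,\xi)|\lesssim\langle\xi\rangle^\mu\big[\langle\xi\rangle^{\frac1{\ell+1}}|\hat\phi(0,\xi)|+|\partial_t\hat\phi(0,\xi)|\big].$$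
   Context: $\mathbb N=\{1,2,\dots\}$, $\imath=\sqrt{-1}$, $\langle\xi\rangle=(1+|\xi|^2)^{1/2}$. $A\lesssim B$ means $A\le CB$ with $C$ independent of $\xi$ and of the solution. For a normed vector space $X$ and $\beta>0$, $\mathcal T^\beta([0,T];X)$ is the space of all $f:[0,T]\to X$ of the form $f(t)=f_0+f_*(t)$, where $f_0\in X$ and $f_*:[0,T]\to X$ is smooth on $(0,T]$ and satisfies, for every integer $k\ge0$, $|(t\partial_t)^kf_*|_X\le C_kt^\beta$ for some $C_k>0$. For $(t,\omega)\in[0,T]\times\mathbb S^{d-1}$: $\mathfrak a(t,\omega)=\sum_{i,j}a_{ij}(t)\omega_i\omega_j$, $\mathfrak b(t,\omega)=\sum_ib_i(t)\omega_i$, $\mathfrak c(t,\omega)=\sum_ic_i(t)\omega_i$, $\alpha(t,\omega)=\sqrt{\mathfrak a(t,\omega)+\mathfrak b^2(t,\omega)}$. The equation (W) is the spatial Fourier transform of $$\partial_t^2\phi-t^{2\ell}\sum_{i,j}a_{ij}(t)\partial^2_{x_ix_j}\phi+2t^\ell\sum_ib_i(t)\partial^2_{tx_i}\phi+t^{\ell-1}\sum_ic_i(t)\partial_{x_i}\phi+t^{-1}g(t)\,\partial_t\phi+t^{-2}h(t)\,\phi=0$$ on $(0,T]_t\times\mathbb R^d_x$, namely $$\text{(W)}\quad\partial_t^2\hat\phi+t^{2\ell}|\xi|^2\mathfrak a\,\hat\phi+2\imath t^\ell|\xi|\mathfrak b\,\partial_t\hat\phi+\imath t^{\ell-1}|\xi|\mathfrak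 c\,\hat\phi+t^{-1}g\,\partial_t\hat\phi+t^{-2}h\,\hat\phi=0,$$ with $\mathfrak a,\mathfrak b,\mathfrak c$ evaluated at $(t,\xi/|\xi|)$ (terms with a factor $|\xi|$ are $0$ at $\xi=0$); for each $\xi$ it is an ODE in $t\in(0,T]$. *)

(* Defs.v *)
From Stdlib Require Import Reals Lra FunctionalExtensionality.
From mathcomp Require Import ssreflect ssrfun ssrbool eqtype ssrnat fintype bigop.
From Coquelicot Require Import Coquelicot.

Set Implicit Arguments.
Unset Strict Implicit.
Unset Printing Implicit Defensive.

Open Scope R_scope.

Notation rsum d F := (\big[Rplus/0]_(i < d) F i) (only parsing).

Section VecNorm.

Lemma rsum_S (d : nat) (F : 'I_d.+1 -> R) :
  rsum d.+1 F = F ord0 + rsum d (fun i => F (lift ord0 i)).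
Proof. by rewrite big_ord_recl. Qed.

Lemma rsum_ge0 (d : nat) (F : 'I_d -> R) : (forall i, 0 <= F i) -> 0 <= rsum d F.
Proof.
elim: d F => [|d IH] F F0; first by rewrite big_ord0; lra.
rewrite rsum_S; have := F0 ord0; have := IH _ (fun i => F0 (lift ord0 i)).
lra.
Qed.

Lemma rsum_le (d : nat) (F G : 'I_d -> R) :
  (forall i, F i <= G i) -> rsum d F <= rsum d G.
Proof.
elim: d F G => [|d IH] F G FG; first by rewrite !big_ord0; lra.
rewrite !rsum_S; have := FG ord0; have := IH _ _ (fun i => FG (lift ord0 i)).
lra.
Qed.

Lemma rsum_ge_term (d : nat) (F : 'I_d -> R) (i : 'I_d) :
  (forall j, 0 <= F j) -> F i <= rsum d F.
Proof.
elim: d F i => [|d IH] F i F0; first by case: i.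
rewrite rsum_S; case: (unliftP ord0 i) => [j ->|->].
- have := F0 ord0; have := IH (fun k => F (lift ord0 k)) j (fun k => F0 (lift ord0 k)); lra.
- have := rsum_ge0 (fun k => F0 (lift ord0 k)); rewrite /=; lra.
Qed.

Lemma rsum_scal (d : nat) (k : R) (F : 'I_d -> R) :
  rsum d (fun i => k * F i) = k * rsum d F.
Proof.
elim: d F => [|d IH] F; first by rewrite !big_ord0; lra.
by rewrite !rsum_S IH; lra.
Qed.

Lemma rsum_const (d : nat) (k : R) : rsum d (fun=> k) = INR d * k.
Proof.
elim: d => [|d IH]; first by rewrite big_ord0 /=; lra.
by rewrite rsum_S IH S_INR; lra.
Qed.

Lemma minkowski2 (a b c d : R) : 0 <= a -> 0 <= b -> 0 <= c -> 0 <= d ->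
  sqrt ((a + c) ^ 2 + (b + d) ^ 2) <= sqrt (a ^ 2 + b ^ 2) + sqrt (c ^ 2 + d ^ 2).
Proof.
move=> a0 b0 c0 d0.
have P0 : 0 <= a ^ 2 + b ^ 2 by nra.
have Q0 : 0 <= c ^ 2 + d ^ 2 by nra.
have sP := sqrt_pos (a ^ 2 + b ^ 2); have sQ := sqrt_pos (c ^ 2 + d ^ 2).
have eP := sqrt_sqrt _ P0; have eQ := sqrt_sqrt _ Q0.
have cs : a * c + b * d <= sqrt (a ^ 2 + b ^ 2) * sqrt (c ^ 2 + d ^ 2).
  rewrite -sqrt_mult //.
  rewrite -(sqrt_pow2 (a * c + b * d)); last by nra.
  apply: sqrt_le_1_alt.
  have := pow2_ge_0 (a * d - b * c); nra.
rewrite -(sqrt_pow2 (sqrt _ + sqrt _)); last lra.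
by apply: sqrt_le_1_alt; nra.
Qed.

Lemma minkowski (d : nat) (u v w : 'I_d -> R) :
  (forall i, 0 <= u i) -> (forall i, 0 <= v i) -> (forall i, 0 <= w i <= u i + v i) ->
  sqrt (rsum d (fun i => w i ^ 2)) <=
  sqrt (rsum d (fun i => u i ^ 2)) + sqrt (rsum d (fun i => v i ^ 2)).
Proof.
elim: d u v w => [|d IH] u v w u0 v0 wuv.
  by rewrite !big_ord0 sqrt_0; lra.
rewrite !rsum_S.
have {}IH := IH _ _ _ (fun i => u0 (lift ord0 i)) (fun i => v0 (lift ord0 i))
                      (fun i => wuv (lift ord0 i)).
have S0 (x : 'I_d.+1 -> R) : 0 <= rsum d (fun i => x (lift ord0 i) ^ 2).
  by apply: rsum_ge0 => i; exact: pow2_ge_0.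
have e (x : 'I_d.+1 -> R) : rsum d (fun i => x (lift ord0 i) ^ 2) =
    sqrt (rsum d (fun i => x (lift ord0 i) ^ 2)) ^ 2 by rewrite pow2_sqrt.
rewrite (e u) (e v) (e w).
have sw := sqrt_pos (rsum d (fun i => w (lift ord0 i) ^ 2)).
have su := sqrt_pos (rsum d (fun i => u (lift ord0 i) ^ 2)).
have sv := sqrt_pos (rsum d (fun i => v (lift ord0 i) ^ 2)).
have [w0 w1] := wuv ord0.
apply: Rle_trans (minkowski2 (u0 ord0) su (v0 ord0) sv).
by apply: sqrt_le_1_alt; nra.
Qed.

Lemma sqrt_rsum_le (d : nat) (u : 'I_d -> R) : (forall i, 0 <= u i) ->
  sqrt (rsum d (fun i => u i ^ 2)) <= rsum d u.
Proof.
elim: d u => [|d IH] u u0; first by rewrite !big_ord0 sqrt_0; lra.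
rewrite !rsum_S; have {}IH := IH _ (fun i => u0 (lift ord0 i)).
have S0 : 0 <= rsum d (fun i => u (lift ord0 i) ^ 2).
  by apply: rsum_ge0 => i; exact: pow2_ge_0.
have s0 := sqrt_pos (rsum d (fun i => u (lift ord0 i) ^ 2)).
have e := sqrt_sqrt _ S0; have u00 := u0 ord0.
rewrite -(sqrt_pow2 (u ord0 + _)); last lra.
by apply: sqrt_le_1_alt; nra.
Qed.

Variables (d : nat) (X : NormedModule R_AbsRing).

Definition vec_plus (x y : 'I_d -> X) : 'I_d -> X := fun i => plus (x i) (y i).
Definition vec_opp (x : 'I_d -> X) : 'I_d -> X := fun i => opp (x i).
Definition vec_zero : 'I_d -> X := fun=> zero.
Definition vec_scal (k : R) (x : 'I_d -> X) : 'I_d -> X := fun i => scal k (x i).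
Definition vec_norm (x : 'I_d -> X) : R :=
  sqrt (\big[Rplus/0]_(i < d) norm (x i) ^ 2).

Lemma vec_plus_comm x y : vec_plus x y = vec_plus y x.
Proof. by apply: functional_extensionality => i; exact: plus_comm. Qed.
Lemma vec_plus_assoc x y z : vec_plus x (vec_plus y z) = vec_plus (vec_plus x y) z.
Proof. by apply: functional_extensionality => i; exact: plus_assoc. Qed.
Lemma vec_plus_zero_r x : vec_plus x vec_zero = x.
Proof. by apply: functional_extensionality => i; exact: plus_zero_r. Qed.
Lemma vec_plus_opp_r x : vec_plus x (vec_opp x) = vec_zero.
Proof. by apply: functional_extensionality => i; exact: plus_opp_r. Qed.

Definition vec_AbelianMonoid : AbelianMonoid :=
  AbelianMonoid.Pack ('I_d -> X)
    (AbelianMonoid.Mixin _ vec_plus vec_zero vec_plus_comm vec_plus_assoc vec_plus_zero_r) ('I_d -> X).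

Definition vec_AbelianGroup : AbelianGroup :=
  AbelianGroup.Pack ('I_d -> X)
    (AbelianGroup.Class _ _ (AbelianGroup.Mixin vec_AbelianMonoid vec_opp vec_plus_opp_r))
    ('I_d -> X).

Lemma vec_scal_assoc (k l : R_AbsRing) (x : vec_AbelianGroup) :
  vec_scal k (vec_scal l x) = vec_scal (mult k l) x.
Proof. by apply: functional_extensionality => i; exact: scal_assoc. Qed.
Lemma vec_scal_one (x : vec_AbelianGroup) : vec_scal (@one R_AbsRing) x = x.
Proof. by apply: functional_extensionality => i; exact: scal_one. Qed.
Lemma vec_scal_distr_l (k : R_AbsRing) (x y : vec_AbelianGroup) :
  vec_scal k (plus x y) = @plus vec_AbelianGroup (vec_scal k x) (vec_scal k y).
Proof. by apply: functional_extensionality => i; exact: scal_distr_l. Qed.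
Lemma vec_scal_distr_r (k l : R_AbsRing) (x : vec_AbelianGroup) :
  vec_scal (plus k l) x = @plus vec_AbelianGroup (vec_scal k x) (vec_scal l x).
Proof. by apply: functional_extensionality => i; exact: scal_distr_r. Qed.

Definition vec_ModuleSpace : ModuleSpace R_AbsRing :=
  ModuleSpace.Pack R_AbsRing ('I_d -> X)
    (ModuleSpace.Class _ _ _
       (ModuleSpace.Mixin R_AbsRing vec_AbelianGroup vec_scal
          vec_scal_assoc vec_scal_one vec_scal_distr_l vec_scal_distr_r))
    ('I_d -> X).

Definition vec_NormedModuleAux : NormedModuleAux R_AbsRing :=
  NormedModuleAux.Pack R_AbsRing ('I_d -> X)
    (NormedModuleAux.Class _ _ (ModuleSpace.class _ vec_ModuleSpace)
       (UniformSpace.class (fct_UniformSpace 'I_d X)))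
    ('I_d -> X).

Lemma vec_norm_ge_coord (x : 'I_d -> X) (i : 'I_d) : norm (x i) <= vec_norm x.
Proof.
rewrite -(sqrt_pow2 (norm (x i))); last exact: norm_ge_0.
apply: sqrt_le_1_alt.
by apply: (rsum_ge_term (F := fun j => norm (x j) ^ 2)) => j; exact: pow2_ge_0.
Qed.

Lemma vec_norm_triangle (x y : vec_NormedModuleAux) :
  vec_norm (plus x y) <= vec_norm x + vec_norm y.
Proof.
apply: (minkowski (w := fun i => norm (plus (x i) (y i)))) => i; try exact: norm_ge_0.
by split; [exact: norm_ge_0 | exact: norm_triangle].
Qed.

Lemma vec_norm_scal (k : R_AbsRing) (x : vec_NormedModuleAux) :
  vec_norm (scal k x) <= abs k * vec_norm x.
Proof.
have k0 : 0 <= abs k := abs_ge_0 k.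
rewrite -(sqrt_pow2 (abs k)) // /vec_norm -sqrt_mult_alt; last exact: pow2_ge_0.
apply: sqrt_le_1_alt.
rewrite -(rsum_scal _ (fun i => norm (x i) ^ 2)); apply: rsum_le => i.
have h := @norm_scal _ X k (x i); have n0 := @norm_ge_0 _ X (scal k (x i)).
by rewrite -Rpow_mult_distr; apply: pow_incr; split.
Qed.

Lemma vec_norm_compat1 (x y : vec_NormedModuleAux) (eps : R) :
  vec_norm (minus y x) < eps -> ball x eps y.
Proof.
move=> h; change (forall i, ball (x i) eps (y i)) => i; apply: norm_compat1.
exact: Rle_lt_trans (vec_norm_ge_coord (minus y x) i) h.
Qed.

Lemma vec_norm_compat2 (x y : vec_NormedModuleAux) (eps : posreal) :
  ball x eps y -> vec_norm (minus y x) < (INR d + 1) * @norm_factor _ X * eps.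
Proof.
change (ball x eps y) with (forall i, ball (x i) eps (y i)) => h; have nf := @norm_factor_gt_0 _ X; have e0 := cond_pos eps.
have p : 0 < @norm_factor _ X * eps by exact: Rmult_lt_0_compat.
apply: (@Rle_lt_trans _ (INR d * (@norm_factor _ X * eps))); last lra.
apply: Rle_trans (sqrt_rsum_le (fun i => @norm_ge_0 _ X _)) _.
rewrite -rsum_const; apply: rsum_le => i; apply: Rlt_le.
exact: norm_compat2 (h i).
Qed.

Lemma vec_norm_eq_zero (x : vec_NormedModuleAux) : vec_norm x = 0 -> x = zero.
Proof.
move=> x0; apply: functional_extensionality => i; apply: norm_eq_zero.
by apply: Rle_antisym; [rewrite -x0; exact: vec_norm_ge_coord | exact: norm_ge_0].
Qed.

(* X^d with the Euclidean norm; not canonical, since the uniform structure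
   of function types is already canonically [fct_UniformSpace]. *)
Definition vec_NormedModule : NormedModule R_AbsRing :=
  NormedModule.Pack R_AbsRing ('I_d -> X)
    (NormedModule.Class _ _ _
       (NormedModule.Mixin R_AbsRing vec_NormedModuleAux vec_norm _
          vec_norm_triangle vec_norm_scal vec_norm_compat1 vec_norm_compat2
          vec_norm_eq_zero))
    ('I_d -> X).

End VecNorm.

Definition Rd (d : nat) : NormedModule R_AbsRing := vec_NormedModule d R_NormedModule.
Definition Cd (d : nat) : NormedModule R_AbsRing := vec_NormedModule d C_R_NormedModule.
Definition Rdd (d : nat) : NormedModule R_AbsRing := vec_NormedModule d (Rd d).

(* Derivative relative to the set D; one-sided at an endpoint of an interval D. *)
Definition is_derive_within (V : NormedModule R_AbsRing) (D : R -> Prop)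
    (f : R -> V) (t : R) (l : V) : Prop :=
  filterdiff f (within D (locally t)) (fun s => scal s l).

Definition Icc (T t : R) : Prop := 0 <= t <= T.
Definition Ioc (T t : R) : Prop := 0 < t <= T.

Definition smooth_on (V : NormedModule R_AbsRing) (D : R -> Prop) (f : R -> V) : Prop :=
  exists F : nat -> R -> V,
    (forall t, D t -> F 0%N t = f t) /\
    (forall k t, D t -> is_derive_within D (F k) t (F k.+1 t)).

(* On D, [F k] is the iterate (t d/dt)^k f. *)
Definition euler_iterates (V : NormedModule R_AbsRing) (D : R -> Prop)
    (f : R -> V) (F : nat -> R -> V) : Prop :=
  (forall t, D t -> F 0%N t = f t) /\
  (forall k t, D t ->
     exists l : V, is_derive_within D (F k) t l /\ F k.+1 t = scal t l).

(* [Rpower 0 beta] is 1, not 0, in the standard library. Hence the bounds are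
   stated on (0,T] only, and their consequence at t = 0, namely fs 0 = 0, is
   stated separately. *)
Definition class_T (beta T : R) (X : NormedModule R_AbsRing) (f : R -> X) : Prop :=
  exists (f0 : X) (fs : R -> X),
    (forall t, Icc T t -> f t = plus f0 (fs t)) /\
    fs 0 = zero /\
    smooth_on (Ioc T) fs /\
    exists F : nat -> R -> X,
      euler_iterates (Ioc T) fs F /\
      forall k, exists M : R, 0 < M /\
        forall t, Ioc T t -> norm (F k t) <= M * Rpower t beta.

Definition symb_a (d : nat) (a : R -> Rdd d) (t : R) (w : Rd d) : R :=
  \big[Rplus/0]_(i < d) \big[Rplus/0]_(j < d) (a t i j * w i * w j).

Definition symb_b (d : nat) (b : R -> Rd d) (t : R) (w : Rd d) : R :=
  \big[Rplus/0]_(i < d) (b t i * w i).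

Definition symb_c (d : nat) (c : R -> Cd d) (t : R) (w : Rd d) : C :=
  \big[Cplus/RtoC 0]_(i < d) Cmult (c t i) (RtoC (w i)).

Definition alpha (d : nat) (a : R -> Rdd d) (b : R -> Rd d) (t : R) (w : Rd d) : R :=
  sqrt (symb_a a t w + symb_b b t w ^ 2).

Definition mu (d ell : nat) (a : R -> Rdd d) (b : R -> Rd d) (c : R -> Cd d) : R :=
  / (2 * (INR ell + 1)) *
  real (Lub_Rbar (fun y => exists w : Rd d, norm w = 1 /\
    y = Rabs (Re (symb_c c 0 w - RtoC (INR ell * symb_b b 0 w))%C) / alpha a b 0 w)).

Definition bracket (d : nat) (xi : Rd d) : R := sqrt (1 + norm xi ^ 2).

(* At xi = 0 the junk direction [w] is harmless: it only occurs with a factor |xi|. *)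
Definition eqn_W (d ell : nat) (a : R -> Rdd d) (b : R -> Rd d) (c : R -> Cd d)
    (g h : R -> C) (xi : Rd d) (t : R) (u du ddu : C) : Prop :=
  let r := norm xi in
  let w : Rd d := scal (/ r) xi in
  (ddu
   + RtoC (t ^ (2 * ell) * r ^ 2 * symb_a a t w) * u
   + 2 * Ci * RtoC (t ^ ell * r * symb_b b t w) * du
   + Ci * RtoC (t ^ (ell - 1) * r) * symb_c c t w * u
   + RtoC (/ t) * g t * du
   + RtoC (/ t ^ 2) * h t * u = 0)%C.

(* [phi t xi] solves (W) on (0,T] for every xi, with time derivative [dphi]. *)
Definition solves_W (d ell : nat) (T : R) (a : R -> Rdd d) (b : R -> Rd d)
    (c : R -> Cd d) (g h : R -> C) (phi dphi : R -> Rd d -> C) : Prop :=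
  forall (xi : Rd d) (t : R), Ioc T t ->
    is_derive_within (V := C_R_NormedModule) (Ioc T) (fun s => phi s xi) t (dphi t xi) /\
    exists ddphi : C,
      is_derive_within (V := C_R_NormedModule) (Ioc T) (fun s => dphi s xi) t ddphi /\
      eqn_W ell a b c g h xi t (phi t xi) (dphi t xi) ddphi.

Definition lim_right0 (f : R -> C) (l : C) : Prop :=
  filterlim f (at_right 0) (locally l).

Definition sizeT (d ell : nat) (xi : Rd d) (u du : C) : R :=
  let s := INR ell / (2 * (INR ell + 1)) in
  Rpower (bracket xi) (1 - s) * Cmod u + Rpower (bracket xi) (- s) * Cmod du.

Definition size0 (d ell : nat) (xi : Rd d) (u du : C) : R :=
  Rpower (bracket xi) (/ (INR ell + 1)) * Cmod u + Cmod du.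

(* Main.v *)
Require Import Defs.
From Stdlib Require Import Reals Lra IndefiniteDescription.
From mathcomp Require Import ssreflect ssrfun ssrbool eqtype ssrnat fintype bigop.
From Coquelicot Require Import Coquelicot.

Open Scope R_scope.


(** For each frequency [xi], (W) is a linear second order equation
    [u'' + P u' + Q u = 0] on [(0,T]] with [P] and [Q] continuous and bounded, because
    [g / t] and [h / t ^ 2] are. So the Cauchy problem at [T] is solved by
    [linear_system_solvable], a solution and its derivative are Lipschitz and have limits at
    0 ([csol_limits]), and a solution with zero limits vanishes by Gronwall; hence the linear
    map from the data at [T] to the limits at 0 is invertible, which is the scattering
    statement ([csol_scattering]). All the difficulty lies in the two-sided bound with
    constants independent of [xi] ([frequency_bounds]).

    Put [rho = t ^ ell |xi|] and let [k] be the root of order [ell + 1] of the bracket of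
    [xi]. For [k t <= N] the coefficients have sizes [P = O(k)] and [Q = O(k ^ 2)], so that
    the energy [k ^ 2 |u| ^ 2 + |u'| ^ 2] changes by a bounded factor on this zone, whose
    length is [N / k] ([energy_gronwall], [low_zone_coefs]).

    For [k t >= N] the equation oscillates with frequency [rho]. With
    [alpha ^ 2 = a + b ^ 2], the unknowns [X = u' + i rho b u] and [Y = i rho alpha u]
    satisfy [X' = - i rho b X + i rho alpha Y + (delta / t) Y] and
    [Y' = - i rho b Y + i rho alpha X + (ell / t) Y] up to small terms, where
    [delta = (ell b - c) / alpha] at [t = 0] ([hf_remainders]). The derivative of
    [|X| ^ 2 + |Y| ^ 2] is [ell / t] times itself, plus a term controlled by
    [|Re delta| / t], plus terms in [|X| ^ 2 - |Y| ^ 2] and in [Im (X conj Y)]. These two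
    quantities rotate into each other at speed [rho alpha], so the last terms are removed by
    subtracting from the energy a correction of relative size [1 / (rho t)]
    ([corrected_rate]). The remaining errors have rates [t ^ (beta - 1)], [1] and
    [1 / (|xi| t ^ (ell + 2))], whose integrals over the zone are bounded. By the definition
    of [mu], [|Re delta| <= 2 nu] with [nu = (ell + 1) mu]; thus between [N / k] and [T] the
    energy is multiplied, up to constants, by [k ^ ell] times a factor between
    [k ^ (- 2 nu)] and [k ^ (2 nu)]. Since [k ^ ell] and [k ^ (2 nu)] are the powers
    [ell / (ell + 1)] and [2 mu] of the bracket, taking square roots gives the
    inequalities of the theorem ([sizes_of_energies]). *)

(** * Derivatives relative to a half-open interval *)

Lemma within_Ioc_lim (T t : R) : Ioc T t ->
  is_filter_lim (within (Ioc T) (locally t)) t.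
Proof. by move=> _ P HP; apply: filter_imp HP. Qed.

Lemma locally_interior (T t : R) : 0 < t < T -> locally t (fun s => 0 < s < T).
Proof.
move=> [t0 tT].
by apply: filter_and; [exact: open_gt | exact: open_lt].
Qed.

Lemma is_derive_within_interior (V : NormedModule R_AbsRing) (T : R) (f : R -> V)
    (t : R) (l : V) :
  0 < t < T -> is_derive_within (Ioc T) f t l -> is_derive f t l.
Proof.
move=> tT [lin D]; split=> // x Hx eps.
have -> : x = t by symmetry; exact: is_filter_lim_locally_unique Hx.
have tI : Ioc T t by rewrite /Ioc; lra.
have := D _ (within_Ioc_lim _ _ tI) eps; rewrite /within => De.
apply: filter_imp (filter_and _ _ De (locally_interior _ _ tT)) => y [H yT].
by apply: H; rewrite /Ioc; lra.
Qed.

Lemma is_derive_within_continuous (V : NormedModule R_AbsRing) (T : R) (f : R -> V)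
    (t : R) (l : V) :
  Ioc T t -> is_derive_within (Ioc T) f t l ->
  filterlim f (within (Ioc T) (locally t)) (locally (f t)).
Proof.
move=> tI D; apply: filterdiff_continuous_aux; last exact: within_Ioc_lim.
by exists (fun s => scal s l).
Qed.

Lemma within_Ioc_proper (T t : R) : Ioc T t ->
  ProperFilter (within (Ioc T) (locally t)).
Proof.
move=> [t0 tT]; split; last exact: within_filter.
move=> P [eps HP].
have [e1 e2] : 0 < Rmin (eps / 2) (t / 2) /\ Rmin (eps / 2) (t / 2) < eps.
  have ep := cond_pos eps.
  split; [apply: Rmin_glb_lt; lra | apply: Rle_lt_trans (Rmin_l _ _) _; lra].
have e3 := Rmin_r (eps / 2) (t / 2).
exists (t - Rmin (eps / 2) (t / 2)); apply: HP; last by split; lra.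
rewrite /ball /= /AbsRing_ball /abs /minus /plus /opp /= Rabs_left; lra.
Qed.

Lemma is_derive_is_derive_within (V : NormedModule R_AbsRing) (T : R) (f : R -> V)
    (t : R) (l : V) :
  Ioc T t -> is_derive f t l -> is_derive_within (Ioc T) f t l.
Proof.
move=> tI D; have PF := within_Ioc_proper _ _ tI.
apply: (filterdiff_locally (F := within (Ioc T) (locally t))) D.
exact: within_Ioc_lim tI.
Qed.

(** Beyond [T] the function is continued by its value at [T]; the continuation
    is two-sided continuous at [T] and has honest derivatives below [T]. *)
Definition clamp {V : Type} (T : R) (f : R -> V) (t : R) : V := f (Rmin t T).

Lemma clampE {V : Type} (T : R) (f : R -> V) (t : R) : t <= T -> clamp T f t = f t.
Proof. by move=> h; rewrite /clamp Rmin_left. Qed.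

Lemma is_derive_clamp (V : NormedModule R_AbsRing) (T : R) (f : R -> V) (t : R) (l : V) :
  0 < t < T -> is_derive_within (Ioc T) f t l -> is_derive (clamp T f) t l.
Proof.
move=> tT D; apply: (is_derive_ext_loc f); last exact: is_derive_within_interior D.
by apply: filter_imp (locally_interior _ _ tT) => s sT; rewrite clampE //; lra.
Qed.

Lemma continuous_clamp (V : UniformSpace) (T : R) (f : R -> V) (t : R) :
  0 < T -> 0 < t ->
  (forall s, Ioc T s -> filterlim f (within (Ioc T) (locally s)) (locally (f s))) ->
  continuous (clamp T f) t.
Proof.
move=> T0 t0 H; rewrite /continuous /clamp.
have mI : Ioc T (Rmin t T) by split; [exact: Rmin_glb_lt | exact: Rmin_r].
apply: (filterlim_comp _ _ _ (fun s => Rmin s T) f _ _ _ _ (H _ mI)).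
move=> P [eps HP].
have : locally t (fun s => 0 < s) by exact: open_gt.
move=> Hs; have : locally t (ball t eps) by exact: locally_ball.
move=> Hb; apply: filter_imp (filter_and _ _ Hs Hb) => s [s0 bs].
apply: HP; last by split; [exact: Rmin_glb_lt | exact: Rmin_r].
move: bs; rewrite /ball /= /AbsRing_ball /abs /minus /plus /opp /=.
move=> /Rabs_def2 [b1 b2]; have := cond_pos eps.
by rewrite /Rmin; case: Rle_dec => h1; case: Rle_dec => h2 e0; apply: Rabs_def1; lra.
Qed.

(** * Gronwall estimates *)

Lemma continuous_pt_of (f : R -> R) (t : R) : continuous f t -> continuity_pt f t.
Proof. by move=> h; apply/continuity_pt_filterlim. Qed.

Lemma derive_nonpos_le (f df : R -> R) (s t : R) : s <= t ->
  (forall x, s < x < t -> is_derive f x (df x)) ->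
  (forall x, s <= x <= t -> continuous f x) ->
  (forall x, s < x < t -> df x <= 0) -> f t <= f s.
Proof.
move=> st D Cf N; case: st => [st|->]; last lra.
have [//|h] := Rle_lt_dec (f t) (f s).
have [x [xst e]] : exists x, s < x < t /\ f t - f s = df x * (t - s).
  have pr x : s < x < t -> derivable_pt f x.
    by move=> xst; exists (df x); apply/is_derive_Reals; exact: D.
  have prid x : s < x < t -> derivable_pt id x by move=> _; exact: derivable_pt_id.
  have [||x [xst e]] := MVT f id s t pr prid st.
  - by move=> x xst; apply: continuous_pt_of; exact: Cf.
  - by move=> x _; apply: derivable_continuous_pt; exact: derivable_pt_id.
  exists x; split=> //; move: e; rewrite (derive_pt_eq_0 id x 1); last exact: derivable_pt_lim_id.
  rewrite (derive_pt_eq_0 f x (df x)); last by apply/is_derive_Reals; exact: D.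
  by rewrite /id; lra.
have := N _ xst; nra.
Qed.

Lemma gronwall_le (f Phi df dPhi : R -> R) (s t : R) : s <= t ->
  (forall x, s < x < t -> is_derive f x (df x)) ->
  (forall x, s < x < t -> is_derive Phi x (dPhi x)) ->
  (forall x, s <= x <= t -> continuous f x) ->
  (forall x, s <= x <= t -> continuous Phi x) ->
  (forall x, s < x < t -> df x <= dPhi x * f x) ->
  f t <= f s * exp (Phi t - Phi s).
Proof.
move=> st Df DP Cf CP le.
have key : f t * exp (- Phi t) <= f s * exp (- Phi s).
  apply: (derive_nonpos_le (fun x => f x * exp (- Phi x))
    (fun x => (df x - dPhi x * f x) * exp (- Phi x))) => //.
  - move=> x xst; have h1 := Df _ xst; have h2 := DP _ xst.
    auto_derive; first by split; [exists (df x) | split; [exists (dPhi x) | ]].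
    by rewrite (is_derive_unique _ _ _ h1) (is_derive_unique _ _ _ h2); ring.
  - move=> x xst; apply: (continuous_mult f (fun x => exp (- Phi x))); first exact: Cf.
    apply: (continuous_comp (fun x => - Phi x) exp).
      by apply: (continuous_opp Phi); exact: CP.
    by apply: ex_derive_continuous; exists (exp (- Phi x)); exact: is_derive_exp.
  - by move=> x xst; have := le _ xst; have := exp_pos (- Phi x); nra.
have e1 : exp (- Phi t) * exp (Phi t) = 1.
  by rewrite -exp_plus Rplus_opp_l exp_0.
have -> : f t = f t * exp (- Phi t) * exp (Phi t) by rewrite Rmult_assoc e1 Rmult_1_r.
have -> : f s * exp (Phi t - Phi s) = f s * exp (- Phi s) * exp (Phi t).
  by rewrite Rmult_assoc -exp_plus; congr (_ * exp _); ring.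
by apply: Rmult_le_compat_r => //; apply: Rlt_le; exact: exp_pos.
Qed.

Lemma gronwall_ge (f Phi df dPhi : R -> R) (s t : R) : s <= t ->
  (forall x, s < x < t -> is_derive f x (df x)) ->
  (forall x, s < x < t -> is_derive Phi x (dPhi x)) ->
  (forall x, s <= x <= t -> continuous f x) ->
  (forall x, s <= x <= t -> continuous Phi x) ->
  (forall x, s < x < t -> dPhi x * f x <= df x) ->
  f s * exp (Phi t - Phi s) <= f t.
Proof.
move=> st Df DP Cf CP le.
have := gronwall_le (fun x => - f x) Phi (fun x => - df x) dPhi s t st.
have h1 x : s < x < t -> is_derive (fun x => - f x) x (- df x).
  by move=> xst; apply: (is_derive_opp f); exact: Df.
have h2 x : s <= x <= t -> continuous (fun x => - f x) x.
  by move=> xst; apply: (continuous_opp f); exact: Cf.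
move=> /(_ h1 DP h2 CP) H.
have := H (fun x xst => ltac:(have := le x xst; lra)); lra.
Qed.

(** * Linear systems with bounded continuous coefficients *)

Lemma rsum_plus (n : nat) (F G : 'I_n -> R) :
  rsum n (fun i => F i + G i) = rsum n F + rsum n G.
Proof.
elim: n F G => [|n IH] F G; first by rewrite !big_ord0; lra.
by rewrite !rsum_S IH; lra.
Qed.

Lemma rsum_ext (n : nat) (F G : 'I_n -> R) : (forall i, F i = G i) -> rsum n F = rsum n G.
Proof. by move=> FG; apply: eq_bigr. Qed.

Lemma rsum_minus (n : nat) (F G : 'I_n -> R) :
  rsum n (fun i => F i - G i) = rsum n F - rsum n G.
Proof.
elim: n F G => [|n IH] F G; first by rewrite !big_ord0; lra.
by rewrite !rsum_S IH; lra.
Qed.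

Lemma Rabs_rsum (n : nat) (F : 'I_n -> R) : Rabs (rsum n F) <= rsum n (fun i => Rabs (F i)).
Proof.
elim: n F => [|n IH] F; first by rewrite !big_ord0 Rabs_R0; lra.
rewrite !rsum_S; apply: Rle_trans (Rabs_triang _ _) _.
by apply: Rplus_le_compat_l; exact: IH.
Qed.

Lemma Rabs_rsum_le (n : nat) (F : 'I_n -> R) (m : R) :
  (forall i, Rabs (F i) <= m) -> Rabs (rsum n F) <= INR n * m.
Proof.
move=> h; apply: Rle_trans (Rabs_rsum _ _) _.
by rewrite -rsum_const; apply: rsum_le.
Qed.

Lemma continuous_rsum (n : nat) (F : 'I_n -> R -> R) (t : R) :
  (forall i, continuous (F i) t) -> continuous (fun s => rsum n (fun i => F i s)) t.
Proof.
elim: n F => [|n IH] F h.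
  apply: (continuous_ext (fun=> 0)); first by move=> s; rewrite big_ord0.
  exact: continuous_const.
apply: (continuous_ext (fun s => F ord0 s + rsum n (fun i => F (lift ord0 i) s))).
  by move=> s; rewrite rsum_S.
by apply: (continuous_plus (F ord0)); [exact: h | exact: IH].
Qed.

Lemma Series_tail (a : nat -> R) (m : R) (N : nat) :
  (forall k, Rabs (a k) <= m * (/ 2) ^ k) ->
  ex_series a /\ Rabs (Series a - sum_n a N) <= m * (/ 2) ^ N.
Proof.
move=> h.
have h2 : Rabs (/ 2) < 1 by rewrite Rabs_right; lra.
have G j : is_series (fun k => m * (/ 2) ^ (j + k)) (m * (/ 2) ^ j * 2).
  apply: (is_series_ext (fun k => scal (m * (/ 2) ^ j) ((/ 2) ^ k))).
    by move=> k; rewrite /scal /= /mult /= pow_add; ring.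
  have -> : m * (/ 2) ^ j * 2 = scal (m * (/ 2) ^ j) (/ (1 - / 2)).
    by rewrite /scal /= /mult /=; field.
  by apply: is_series_scal; exact: is_series_geom.
have ea : ex_series a.
  apply: (ex_series_le a (fun k => m * (/ 2) ^ k)); first exact: h.
  by exists (m * (/ 2) ^ 0 * 2); exact: G 0%N.
split=> //.
rewrite (Series_incr_n a (S N)) //; last exact: PeanoNat.Nat.lt_0_succ.
rewrite /= -sum_n_Reals.
set x := sum_n a N; set y := Series _.
have -> : x + y - x = y by ring.
have le k : 0 <= Rabs (a (S N + k)%coq_nat) <= m * (/ 2) ^ (S N + k).
  by split; [exact: Rabs_pos | exact: h].
apply: Rle_trans (Series_Rabs _ _) _.
  apply: (@ex_series_le R_AbsRing R_CompleteNormedModule _ (fun k => m * (/ 2) ^ (S N + k))).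
    by move=> k; rewrite /norm /= /abs /= Rabs_Rabsolu; exact: h.
  by exists (m * (/ 2) ^ (S N) * 2); exact: G (S N).
apply: Rle_trans (Series_le _ _ le _) _; first by exists (m * (/ 2) ^ (S N) * 2); exact: G (S N).
by rewrite (is_series_unique _ _ (G (S N))) /=; apply: Req_le; field.
Qed.

Lemma exp_le_exp (x y : R) : x <= y -> exp x <= exp y.
Proof. by case=> [/exp_increasing|->]; lra. Qed.

Fixpoint picard_term (n : nat) (A : 'I_n -> 'I_n -> R -> R) (T : R) (y0 : 'I_n -> R)
    (k : nat) (i : 'I_n) (t : R) : R :=
  match k with
  | O => y0 i
  | S k' => RInt (fun s => rsum n (fun j => A i j s * picard_term n A T y0 k' j s)) T t
  end.

(** The bound on [dw] is the derivative of a multiple of [2 sinh (L (t - T))], which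
    dominates [w] on both sides of [T] and is itself dominated by the [cosh]; this weight
    avoids the non-smooth function [|t - T|]. *)
Lemma Rabs_le_sinh (T L c : R) (w dw : R -> R) (t : R) :
  0 < T -> 0 < L -> w T = 0 -> 0 < t < 2 * T ->
  (forall s, 0 < s < 2 * T -> is_derive w s (dw s)) ->
  (forall s, 0 < s < 2 * T ->
     Rabs (dw s) <= c * (exp (L * (s - T)) + exp (- (L * (s - T))))) ->
  Rabs (w t) <= c / L * (exp (L * (t - T)) + exp (- (L * (t - T)))).
Proof.
move=> T0 L0 wT tT Dw bd.
pose S s := c / L * (exp (L * (s - T)) - exp (- (L * (s - T)))).
pose dS s := c * (exp (L * (s - T)) + exp (- (L * (s - T)))).
have DS s : is_derive S s (dS s).
  rewrite /S /dS; auto_derive=> //.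
  have -> x y : c / L * (L * 1 * x - - (L * 1) * y) = c * (x + y) by field; lra.
  by [].
have ST : S T = 0 by rewrite /S Rminus_diag Rmult_0_r Ropp_0; ring.
have c0 : 0 <= c.
  have := bd T ltac:(lra); rewrite Rminus_diag Rmult_0_r Ropp_0 exp_0.
  have := Rabs_pos (dw T); lra.
have eS : Rabs (S t) <= c / L * (exp (L * (t - T)) + exp (- (L * (t - T)))).
  have p1 := exp_pos (L * (t - T)); have p2 := exp_pos (- (L * (t - T))).
  have cl : 0 <= c / L by apply: Rdiv_le_0_compat.
  rewrite /S Rabs_mult (Rabs_right (c / L)); last exact: Rle_ge.
  by apply: Rmult_le_compat_l => //; apply: Rabs_le; lra.
apply: Rle_trans eS.
have mono (sg : R) (s1 s2 : R) : sg = 1 \/ sg = -1 -> 0 < s1 -> s1 <= s2 -> s2 < 2 * T ->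
    sg * w s2 - S s2 <= sg * w s1 - S s1.
  move=> sgE h1 h2 h3.
  apply: (derive_nonpos_le (fun s => sg * w s - S s) (fun s => sg * dw s - dS s)) => //.
  - move=> x xs; apply: (is_derive_minus (fun s => sg * w s)); last exact: DS.
    by apply: is_derive_scal; apply: Dw; lra.
  - move=> x xs; apply: ex_derive_continuous.
    exists (sg * dw x - dS x).
    apply: (is_derive_minus (fun s => sg * w s)); last exact: DS.
    by apply: is_derive_scal; apply: Dw; lra.
  - move=> x xs; have := bd x ltac:(lra); rewrite -/(dS x) => /Rabs_le_between.
    by case: sgE => ->; lra.
have o1 : 1 = 1 \/ 1 = -1 by left.
have o2 : -1 = 1 \/ -1 = -1 by right.
have [tle|tle] := Rle_dec T t.
- have := mono 1 T t o1; have := mono (-1) T t o2; rewrite wT ST.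
  move=> /(_ T0 tle ltac:(lra)) h1 /(_ T0 tle ltac:(lra)) h2.
  by apply: Rle_trans (Rle_abs _); apply: Rabs_le; lra.
- have := mono 1 t T o1; have := mono (-1) t T o2; rewrite wT ST.
  move=> /(_ ltac:(lra) ltac:(lra) ltac:(lra)) h1 /(_ ltac:(lra) ltac:(lra) ltac:(lra)) h2.
  by rewrite -(Rabs_Ropp (S t)); apply: Rle_trans (Rle_abs _); apply: Rabs_le; lra.
Qed.

(** With the weight [2 cosh (L (t - T))], [L] twice the size of the coefficients, each
    Picard iteration halves the increment; so the series converges geometrically on the
    whole interval. *)
Lemma picard_term_spec (n : nat) (A : 'I_n -> 'I_n -> R -> R) (T : R) (y0 : 'I_n -> R)
    (l m : R) :
  0 < T -> 0 < l ->
  (forall i j t, 0 < t < 2 * T -> continuous (A i j) t) ->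
  (forall i j t, 0 < t < 2 * T -> Rabs (A i j t) <= l) ->
  (forall i, Rabs (y0 i) <= m) ->
  let L := 2 * ((INR n + 1) * l) in
  forall k i t, 0 < t < 2 * T ->
  Rabs (picard_term n A T y0 k i t)
    <= m * (/ 2) ^ k * (exp (L * (t - T)) + exp (- (L * (t - T)))) /\
  continuous (picard_term n A T y0 k i) t /\
  is_derive (picard_term n A T y0 (S k) i) t
     (rsum n (fun j => A i j t * picard_term n A T y0 k j t)).
Proof.
move=> T0 l0 cA bA by0 L.
have n0 := pos_INR n.
have L0 : 0 < L by rewrite /L; nra.
have step k : (forall i t, 0 < t < 2 * T -> continuous (picard_term n A T y0 k i) t) ->
    forall i t, 0 < t < 2 * T ->
    is_derive (picard_term n A T y0 (S k) i) t
     (rsum n (fun j => A i j t * picard_term n A T y0 k j t)).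
  move=> ck i t tT.
  have cF s : 0 < s < 2 * T -> continuous
      (fun s => rsum n (fun j => A i j s * picard_term n A T y0 k j s)) s.
    move=> sT; apply: (continuous_rsum n (fun j s => A i j s * picard_term n A T y0 k j s)).
    by move=> j; apply: (continuous_mult (A i j)); [exact: cA | exact: ck].
  set F := fun s => rsum n (fun j => A i j s * picard_term n A T y0 k j s) in cF *.
  have loc : locally t (fun s => is_RInt F T s (RInt F T s)).
    apply: filter_imp (locally_interior _ _ tT) => s sT.
    apply: (RInt_correct (V := R_CompleteNormedModule)).
    apply: (ex_RInt_continuous (V := R_CompleteNormedModule)) => x xs; apply: cF.
    have := Rmin_glb_lt T s 0 T0 (proj1 sT).
    have := Rmax_lub_lt T s (2 * T) ltac:(lra) (proj2 sT).
    lra.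
  exact: is_derive_RInt loc (cF t tT).
elim=> [|k IH] i t tT.
  have cz j s : 0 < s < 2 * T -> continuous (picard_term n A T y0 0 j) s.
    by move=> _; exact: continuous_const.
  split; last by split; [exact: cz | exact: (step O cz)].
  rewrite /= Rmult_1_r; have h := by0 i; have := Rabs_pos (y0 i) => p.
  have [q|q] := Rle_dec 0 (L * (t - T)).
    have := exp_pos (- (L * (t - T))); have := exp_ineq1_le (L * (t - T)); nra.
  have := exp_pos (L * (t - T)); have := exp_ineq1_le (- (L * (t - T))); nra.
have ck j s : 0 < s < 2 * T -> continuous (picard_term n A T y0 k j) s.
  by move=> sT; have [_ []] := IH j s sT.
have D := step _ ck.
have ck1 j s : 0 < s < 2 * T -> continuous (picard_term n A T y0 (S k) j) s.
  by move=> sT; apply: ex_derive_continuous; eexists; exact: D.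
split; last by split; [exact: ck1 | exact: step].
apply: Rle_trans (Rabs_le_sinh T L ((INR n + 1) * l * (m * (/ 2) ^ k)) _
  (fun s => rsum n (fun j => A i j s * picard_term n A T y0 k j s)) t T0 L0 _ tT _ _) _.
- by rewrite /= RInt_point.
- by move=> s sT; exact: D.
- move=> s sT; set W := exp (L * (s - T)) + exp (- (L * (s - T))).
  have W0 : 0 < W by rewrite /W; have := exp_pos (L * (s - T)); have := exp_pos (- (L * (s - T))); lra.
  apply: Rle_trans (Rabs_rsum_le _ _ (l * (m * (/ 2) ^ k * W)) _) _.
    move=> j; rewrite Rabs_mult; have [h _] := IH j s sT.
    apply: Rmult_le_compat; try exact: Rabs_pos; [exact: bA|]. exact: h.
  have p : 0 <= l * (m * (/ 2) ^ k * W).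
    apply: Rmult_le_pos; first lra.
    by have [h _] := IH i s sT; apply: Rle_trans h; exact: Rabs_pos.
  have -> : (INR n + 1) * l * (m * (/ 2) ^ k) * W =
       (INR n + 1) * (l * (m * (/ 2) ^ k * W)) by ring.
  lra.
- apply: Req_le; rewrite /L /=; field; lra.
Qed.

(** The interval extends beyond [T], so that the solution is differentiable at [T] from
    both sides; convergence of the derivatives of the Picard series is uniform there. *)
Theorem linear_system_solvable (n : nat) (A : 'I_n -> 'I_n -> R -> R) (T : R)
    (y0 : 'I_n -> R) (l : R) :
  0 < T ->
  (forall i j t, 0 < t < 2 * T -> continuous (A i j) t) ->
  (forall i j t, 0 < t < 2 * T -> Rabs (A i j t) <= l) ->
  exists y : 'I_n -> R -> R,
    (forall i, y i T = y0 i) /\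
    forall i t, 0 < t < 2 * T -> is_derive (y i) t (rsum n (fun j => A i j t * y j t)).
Proof.
move=> T0 cA bA.
pose l' := Rabs l + 1.
have l'0 : 0 < l' by rewrite /l'; have := Rabs_pos l; lra.
have bA' i j t : 0 < t < 2 * T -> Rabs (A i j t) <= l'.
  by move=> /(bA i j t); rewrite /l'; have := Rle_abs l; lra.
pose m := rsum n (fun i => Rabs (y0 i)).
have bm i : Rabs (y0 i) <= m.
  by apply: (rsum_ge_term (F := fun i => Rabs (y0 i))) => j; exact: Rabs_pos.
have m0 : 0 <= m by apply: rsum_ge0 => i; exact: Rabs_pos.
have := picard_term_spec n A T y0 l' m T0 l'0 cA bA' bm.
set L := 2 * _; move=> /= spec.
set z := picard_term n A T y0 in spec.
have n0 := pos_INR n.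
have L0 : 0 < L by rewrite /L; nra.
pose M := m * (2 * exp (L * T)).
have bz k i t : 0 < t < 2 * T -> Rabs (z k i t) <= M * (/ 2) ^ k.
  move=> tT; have [h _] := spec k i t tT; apply: Rle_trans h _.
  have -> : M * (/ 2) ^ k = m * (/ 2) ^ k * (2 * exp (L * T)) by rewrite /M; ring.
  apply: Rmult_le_compat_l.
    by apply: Rmult_le_pos => //; apply: pow_le; lra.
  have le1 : exp (L * (t - T)) <= exp (L * T) by apply: exp_le_exp; nra.
  have le2 : exp (- (L * (t - T))) <= exp (L * T) by apply: exp_le_exp; nra.
  lra.
pose y i t := Series (fun k => z k i t).
have tail i t N : 0 < t < 2 * T -> Rabs (y i t - sum_n (fun k => z k i t) N) <= M * (/ 2) ^ N.
  by move=> tT; have [_] := Series_tail (fun k => z k i t) M N (fun k => bz k i t tT).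
have M0 : 0 <= M by apply: Rmult_le_pos => //; have := exp_pos (L * T); lra.
have small (c : R) (eps : R) : 0 < eps -> exists N, forall k, (N <= k)%coq_nat -> c * (/ 2) ^ k < eps.
  move=> e0; have [||N HN] := pow_lt_1_zero (/ 2) _ (eps / (Rabs c + 1)).
  - by rewrite Rabs_right; lra.
  - by apply: Rdiv_lt_0_compat => //; have := Rabs_pos c; lra.
  exists N => k /HN; rewrite Rabs_right; last by apply: Rle_ge; apply: pow_le; lra.
  have c1 : 0 < Rabs c + 1 by have := Rabs_pos c; lra.
  move=> /(Rmult_lt_compat_r (Rabs c + 1) _ _ c1).
  have -> : eps / (Rabs c + 1) * (Rabs c + 1) = eps by field; lra.
  have p : 0 <= (/ 2) ^ k by apply: pow_le; lra.
  by have := Rle_abs c; nra.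
exists y; split.
- move=> i; rewrite /y.
  rewrite Series_incr_1; last by have [] := Series_tail (fun k => z k i T) M O (fun k => bz k i T ltac:(lra)).
  rewrite (Series_ext _ (fun=> 0 * 0)); last by move=> k; rewrite /z /= RInt_point Rmult_0_l.
  by rewrite (Series_scal_l 0 (fun=> 0)) Rmult_0_l Rplus_0_r.
pose T' := mkposreal T T0.
have Bo t : 0 < t < 2 * T <-> Boule T T' t.
  rewrite /Boule /=; split=> [h|/Rabs_def2]; last lra.
  by apply: Rabs_def1; lra.
move=> i t tT; apply/is_derive_Reals.
apply: (CVU_derivable (fun N s => sum_n (fun k => z k i s) (S N))
  (fun N s => rsum n (fun j => A i j s * sum_n (fun k => z k j s) N))
  (y i) (fun s => rsum n (fun j => A i j s * y j s)) T T'); last exact/Bo.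
- move=> eps e0; have [N HN] := small (INR n * l' * M) eps e0.
  exists N => k s /HN lt /Bo sT.
  rewrite -rsum_minus; apply: Rle_lt_trans lt.
  have -> : INR n * l' * M * (/ 2) ^ k = INR n * (l' * (M * (/ 2) ^ k)) by ring.
  apply: Rabs_rsum_le => j.
  rewrite -Rmult_minus_distr_l Rabs_mult.
  by apply: Rmult_le_compat; try exact: Rabs_pos; [exact: bA' | exact: tail].
- move=> s /Bo sT eps e0; have [N HN] := small M eps e0.
  exists N => k /HN lt; rewrite /R_dist -Rabs_Ropp Ropp_minus_distr.
  apply: Rle_lt_trans lt; apply: Rle_trans (tail i s (S k) sT) _.
  apply: Rmult_le_compat_l => //=; have : 0 <= (/ 2) ^ k by apply: pow_le; lra.
  lra.
- move=> N s /Bo sT; apply/is_derive_Reals.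
  elim: N => [|N IH].
  + apply: (is_derive_ext (fun s => y0 i + z 1%N i s)).
      by move=> x; rewrite sum_Sn sum_O.
    have [_ [_ D]] := spec 0%N i s sT.
    rewrite -[X in is_derive _ _ X]Rplus_0_l.
    apply: (is_derive_plus (fun=> y0 i)); first exact: is_derive_const.
    rewrite (rsum_ext n _ (fun j => A i j s * z 0%N j s)) //.
    by move=> j; rewrite sum_O.
  + apply: (is_derive_ext (fun s => sum_n (fun k => z k i s) (S N) + z (S (S N)) i s)).
      by move=> x; rewrite [RHS]sum_Sn.
    have [_ [_ D]] := spec (S N) i s sT.
    rewrite (rsum_ext n _ (fun j => A i j s * sum_n (fun k => z k j s) N + A i j s * z (S N) j s)).
      by rewrite rsum_plus; apply: (is_derive_plus (fun s => sum_n (fun k => z k i s) (S N))).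
    by move=> j; rewrite sum_Sn /plus /=; ring.
Qed.

(** * The Cauchy problem and the scattering problem for one frequency *)

Notation is_derive_C := (is_derive (V := C_R_NormedModule)).
Notation continuous_C := (continuous (U := C_R_NormedModule)).

Lemma norm_Cmod (z : C) : norm (z : C_R_NormedModule) = Cmod z.
Proof.
rewrite /norm /= /prod_norm /Cmod /norm /= /abs /=; congr sqrt.
by rewrite !Rmult_1_r -!Rabs_mult !Rabs_right //; apply: Rle_ge; exact: Rle_0_sqr.
Qed.

Lemma Cmod_sqr (z : C) : Cmod z ^ 2 = fst z ^ 2 + snd z ^ 2.
Proof. by rewrite /Cmod pow2_sqrt //; nra. Qed.

Lemma Rabs_dot_Cmod (z w : C) : Rabs (fst z * fst w + snd z * snd w) <= Cmod z * Cmod w.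
Proof.
have -> : fst z * fst w + snd z * snd w = fst (Cmult z (Cconj w)) by rewrite /=; ring.
apply: Rle_trans (Rmax_l _ (Rabs (snd (Cmult z (Cconj w))))) _.
by rewrite -(Cmod_conj w) -Cmod_mult; exact: Rmax_Cmod.
Qed.

Lemma is_linear_fst_C : is_linear (fun z : C_R_NormedModule => (fst z : R_NormedModule)).
Proof. exact: (is_linear_fst (U := R_NormedModule) (V := R_NormedModule)). Qed.

Lemma is_linear_snd_C : is_linear (fun z : C_R_NormedModule => (snd z : R_NormedModule)).
Proof. exact: (is_linear_snd (U := R_NormedModule) (V := R_NormedModule)). Qed.

Lemma is_derive_within_linear (V W : NormedModule R_AbsRing) (D : R -> Prop)
    (g : V -> W) (f : R -> V) (t : R) (l : V) :
  is_linear g -> is_derive_within D f t l ->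
  is_derive_within D (fun s => g (f s)) t (g l).
Proof.
move=> lin Df; have FF : Filter (within D (locally t)) by apply: within_filter; apply: filter_filter.
have h := filterdiff_comp _ g _ g Df (filterdiff_linear g lin).
refine (filterdiff_ext_lin _ _ _ (h _) _) => y; exact: (linear_scal _ lin).
Qed.

Lemma is_derive_linear (V W : NormedModule R_AbsRing) (g : V -> W) (f : R -> V)
    (t : R) (l : V) :
  is_linear g -> is_derive f t l -> is_derive (fun s => g (f s)) t (g l).
Proof.
move=> lin Df.
have h := filterdiff_comp _ g _ g Df (filterdiff_linear g lin).
refine (filterdiff_ext_lin _ _ _ (h _) _) => y; exact: (linear_scal _ lin).
Qed.

Lemma is_derive_fst (f : R -> C) (t : R) (l : C) :
  is_derive_C f t l -> is_derive (fun s => fst (f s)) t (fst l).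
Proof. by move=> D; exact: is_derive_linear is_linear_fst_C D. Qed.

Lemma is_derive_snd (f : R -> C) (t : R) (l : C) :
  is_derive_C f t l -> is_derive (fun s => snd (f s)) t (snd l).
Proof. by move=> D; exact: is_derive_linear is_linear_snd_C D. Qed.

Lemma is_derive_pair (f g : R -> R) (t l m : R) :
  is_derive f t l -> is_derive g t m -> is_derive_C (fun s => (f s, g s)) t (l, m).
Proof.
move=> Df Dg.
have h1 : is_linear (fun x : R_NormedModule => (x, 0) : C_R_NormedModule).
  split.
  - by move=> x y; rewrite /plus /= /prod_plus /plus /= Rplus_0_r.
  - by move=> k x; rewrite /scal /= /prod_scal /scal /= /mult /= Rmult_0_r.
  - exists 1; split; first lra.
    move=> x; rewrite norm_Cmod /Cmod /= !Rmult_1_r Rmult_0_l Rplus_0_r Rmult_1_l.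
    by rewrite sqrt_Rsqr_abs /norm /= /abs /=; lra.
have h2 : is_linear (fun x : R_NormedModule => (0, x) : C_R_NormedModule).
  split.
  - by move=> x y; rewrite /plus /= /prod_plus /plus /= Rplus_0_r.
  - by move=> k x; rewrite /scal /= /prod_scal /scal /= /mult /= Rmult_0_r.
  - exists 1; split; first lra.
    move=> x; rewrite norm_Cmod /Cmod /= !Rmult_1_r Rmult_0_l Rplus_0_l Rmult_1_l.
    by rewrite sqrt_Rsqr_abs /norm /= /abs /=; lra.
have := is_derive_plus _ _ _ _ _ (is_derive_linear _ _ _ _ _ _ h1 Df) (is_derive_linear _ _ _ _ _ _ h2 Dg).
rewrite /plus /= /prod_plus /plus /= Rplus_0_l Rplus_0_r.
by apply: is_derive_ext => s; rewrite /plus /= /prod_plus /plus /= Rplus_0_l Rplus_0_r.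
Qed.

Lemma continuous_fst_C (f : R -> C) (t : R) :
  continuous_C f t -> continuous (fun s => fst (f s)) t.
Proof.
by move=> h; apply: (continuous_comp f (fun z : C => fst z)) => //; exact: continuous_fst.
Qed.

Lemma continuous_snd_C (f : R -> C) (t : R) :
  continuous_C f t -> continuous (fun s => snd (f s)) t.
Proof.
by move=> h; apply: (continuous_comp f (fun z : C => snd z)) => //; exact: continuous_snd.
Qed.

Lemma filterlim_C (F : (R -> Prop) -> Prop) {FF : Filter F} (f : R -> C) (l : C) :
  filterlim f F (locally (l : C_R_NormedModule)) <->
  filterlim (fun s => fst (f s)) F (locally (fst l)) /\
  filterlim (fun s => snd (f s)) F (locally (snd l)).
Proof.
split=> [h|[h1 h2]].
  split; apply: (filterlim_comp _ _ _ f _ _ _ _ h).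
    by move=> P [eps HP]; exists eps => z [b1 b2]; exact: HP.
  by move=> P [eps HP]; exists eps => z [b1 b2]; exact: HP.
move=> P [eps HP].
have l1 : locally (fst l) (ball (fst l) eps) by exact: locally_ball.
have l2 : locally (snd l) (ball (snd l) eps) by exact: locally_ball.
have k1 : F (fun s => ball (fst l) eps (fst (f s))) := h1 _ l1.
have k2 : F (fun s => ball (snd l) eps (snd (f s))) := h2 _ l2.
have k3 : forall s, ball (fst l) eps (fst (f s)) /\ ball (snd l) eps (snd (f s)) -> P (f s).
  by move=> s [b1 b2]; apply: HP; split.
exact: (filter_imp _ _ k3 (filter_and _ _ k1 k2)).
Qed.

Lemma continuous_C_pair (f : R -> C) (t : R) :
  continuous (fun s => fst (f s)) t -> continuous (fun s => snd (f s)) t -> continuous_C f t.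
Proof. by move=> h1 h2; apply/filterlim_C. Qed.

(** The equation [u'' + P u' + Q u = 0] for the pair [u, v = u']. At [T] only continuity is
    asked: this is what a solution keeps when it is continued by [clamp]. *)
Definition csol (T : R) (P Q u v : R -> C) : Prop :=
  (forall t, 0 < t <= T -> continuous_C u t /\ continuous_C v t) /\
  (forall t, 0 < t < T -> is_derive_C u t (v t) /\
     is_derive_C v t (- (P t * v t + Q t * u t))%C).

Definition energy (k : R) (u v : C) : R := k ^ 2 * Cmod u ^ 2 + Cmod v ^ 2.

Lemma energy_ge0 (k : R) (u v : C) : 0 <= energy k u v.
Proof. by rewrite /energy; have := pow2_ge_0 k; have := pow2_ge_0 (Cmod u); have := pow2_ge_0 (Cmod v); nra. Qed.

Lemma energyE (k : R) (u v : C) :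
  energy k u v = k ^ 2 * (fst u ^ 2 + snd u ^ 2) + (fst v ^ 2 + snd v ^ 2).
Proof. by rewrite /energy !Cmod_sqr. Qed.

Lemma is_derive_energy (k : R) (u v : R -> C) (t : R) (du dv : C) :
  is_derive_C u t du -> is_derive_C v t dv ->
  is_derive (fun s => energy k (u s) (v s)) t
    (2 * k ^ 2 * (fst (u t) * fst du + snd (u t) * snd du)
     + 2 * (fst (v t) * fst dv + snd (v t) * snd dv)).
Proof.
move=> Du Dv.
have d1 := is_derive_fst _ _ _ Du; have d2 := is_derive_snd _ _ _ Du.
have d3 := is_derive_fst _ _ _ Dv; have d4 := is_derive_snd _ _ _ Dv.
move: d1 d2 d3 d4; set u1 := fun s => fst (u s); set u2 := fun s => snd (u s).
set v1 := fun s => fst (v s); set v2 := fun s => snd (v s) => d1 d2 d3 d4.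
apply: (is_derive_ext (fun s => k ^ 2 * (u1 s ^ 2 + u2 s ^ 2) + (v1 s ^ 2 + v2 s ^ 2))).
  by move=> s; rewrite energyE.
rewrite -/(u1 t) -/(u2 t) -/(v1 t) -/(v2 t); clearbody u1 u2 v1 v2.
auto_derive; first by do ![split]; eexists; eauto.
by rewrite (is_derive_unique _ _ _ d1) (is_derive_unique _ _ _ d2) (is_derive_unique _ _ _ d3)
  (is_derive_unique _ _ _ d4) /=; ring.
Qed.

Lemma continuous_energy (k : R) (u v : R -> C) (t : R) :
  continuous_C u t -> continuous_C v t -> continuous (fun s => energy k (u s) (v s)) t.
Proof.
move=> cu cv.
have sq (f : R -> R) : continuous f t -> continuous (fun s => f s ^ 2) t.
  move=> cf; apply: (continuous_ext (fun s => f s * f s)); first by move=> s; rewrite /=; ring.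
  exact: (continuous_mult f f).
apply: (continuous_ext (fun s => k ^ 2 * (fst (u s) ^ 2 + snd (u s) ^ 2) + (fst (v s) ^ 2 + snd (v s) ^ 2))).
  by move=> s; rewrite energyE.
apply: (continuous_plus (fun s => k ^ 2 * (fst (u s) ^ 2 + snd (u s) ^ 2))).
  apply: (continuous_mult (fun=> k ^ 2)); first exact: continuous_const.
  by apply: (continuous_plus (fun s => fst (u s) ^ 2)); apply: sq; [exact: continuous_fst_C|exact: continuous_snd_C].
by apply: (continuous_plus (fun s => fst (v s) ^ 2)); apply: sq; [exact: continuous_fst_C|exact: continuous_snd_C].
Qed.

(** The weight [k] is matched to coefficients of sizes [k] and [k ^ 2]: then all
    three contributions to the derivative of the energy are of order [k] times the energy. *)
Lemma energy_gronwall (T k l : R) (P Q u v : R -> C) (s t : R) :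
  0 < k -> 0 <= l -> csol T P Q u v -> 0 < s -> s <= t -> t <= T ->
  (forall x, s < x < t -> Cmod (P x) <= l * k /\ Cmod (Q x) <= l * k ^ 2) ->
  let G := exp ((1 + 3 * l) * k * (t - s)) in
  energy k (u t) (v t) <= energy k (u s) (v s) * G /\
  energy k (u s) (v s) <= energy k (u t) (v t) * G.
Proof.
move=> k0 l0 [Cs Ds] s0 st tT bd G.
pose c := (1 + 3 * l) * k.
pose E x := energy k (u x) (v x).
pose dE x := 2 * k ^ 2 * (fst (u x) * fst (v x) + snd (u x) * snd (v x))
     + 2 * (fst (v x) * fst (- (P x * v x + Q x * u x))%C + snd (v x) * snd (- (P x * v x + Q x * u x))%C).
have dEP x : s < x < t -> is_derive E x (dE x).
  by move=> xst; have [Du Dv] := Ds x ltac:(lra); exact: is_derive_energy.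
have cE x : s <= x <= t -> continuous E x.
  by move=> xst; have [cu cv] := Cs x ltac:(lra); exact: continuous_energy.
have bE x : s < x < t -> Rabs (dE x) <= c * E x.
  move=> xst; have [bP bQ] := bd x xst.
  have h1 := Rabs_dot_Cmod (u x) (v x).
  have h2 := Rabs_dot_Cmod (v x) (- (P x * v x + Q x * u x))%C.
  rewrite Cmod_opp in h2.
  have h3 := Cmod_triangle (P x * v x) (Q x * u x); rewrite !Cmod_mult in h3.
  have p1 := Cmod_ge_0 (u x); have p2 := Cmod_ge_0 (v x).
  rewrite /dE /c /E /energy.
  apply: Rle_trans (Rabs_triang _ _) _; rewrite (Rabs_mult (2 * k ^ 2)) (Rabs_mult 2 (_ + _)).
  have a2 : Rabs 2 = 2 by apply: Rabs_right; lra.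
  have ak : Rabs (2 * k ^ 2) = 2 * k ^ 2 by apply: Rabs_right; apply: Rle_ge; have := pow2_ge_0 k; lra.
  rewrite a2 ak.
  move: h1 h2; set A := Rabs _; set B := Rabs _ => h1 h2.
  have h4 : B <= l * k * Cmod (v x) ^ 2 + l * k ^ 2 * (Cmod (v x) * Cmod (u x)).
    apply: Rle_trans h2 _.
    apply: Rle_trans (Rmult_le_compat_l _ _ _ p2 h3) _.
    have := Rmult_le_compat_r _ _ _ p2 bP; have := Rmult_le_compat_r _ _ _ p1 bQ; nra.
  have h5 : k * (Cmod (v x) * Cmod (u x)) * 2 <= energy k (u x) (v x).
    by rewrite /energy; have := pow2_ge_0 (k * Cmod (u x) - Cmod (v x)); nra.
  have h6 : Cmod (v x) ^ 2 <= energy k (u x) (v x).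
    by rewrite /energy; have := pow2_ge_0 (k * Cmod (u x)); nra.
  rewrite -/(energy k (u x) (v x)).
  have e0 := energy_ge0 k (u x) (v x).
  have lk : 0 <= l * k by nra.
  have q1 := Rmult_le_compat_l _ _ _ lk h6.
  have q2 := Rmult_le_compat_l _ _ _ lk h5.
  have q3 := Rmult_le_compat_l _ _ _ (Rlt_le _ _ k0) h5.
  have q4 : k ^ 2 * A <= k ^ 2 * (Cmod (u x) * Cmod (v x)).
    by apply: Rmult_le_compat_l => //; exact: pow2_ge_0.
  lra.
pose Ph (sg : R) x := sg * (c * x).
have dPh sg x : is_derive (Ph sg) x (sg * c) by rewrite /Ph; auto_derive=> //; ring.
have cPh sg x : continuous (Ph sg) x by apply: ex_derive_continuous; exists (sg * c).
have := gronwall_le E (Ph 1) dE (fun=> 1 * c) s t st dEP (fun x _ => dPh 1 x) cE (fun x _ => cPh 1 x).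
move=> /(_ _) H1.
have := gronwall_ge E (Ph (-1)) dE (fun=> -1 * c) s t st dEP (fun x _ => dPh _ x) cE (fun x _ => cPh _ x).
move=> /(_ _) H2.
split.
- apply: Rle_trans (H1 _) _.
    by move=> x xst; have := bE x xst => /Rabs_le_between; lra.
  by apply: Req_le; rewrite /E /G /Ph /c; congr (_ * exp _); ring.
- have h : E s * exp (Ph (-1) t - Ph (-1) s) <= E t.
    by apply: H2 => x xst; have := bE x xst => /Rabs_le_between; lra.
  have e : exp (Ph (-1) t - Ph (-1) s) * G = 1.
    rewrite /G /Ph -exp_plus.
    have -> : -1 * (c * t) - -1 * (c * s) + (1 + 3 * l) * k * (t - s) = 0 by rewrite /c; ring.
    exact: exp_0.
  have -> : energy k (u s) (v s) = E s * exp (Ph (-1) t - Ph (-1) s) * G.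
    by rewrite Rmult_assoc e Rmult_1_r.
  by apply: Rmult_le_compat_r => //; apply: Rlt_le; exact: exp_pos.
Qed.

Lemma is_linear_Cmult (c : C) :
  is_linear (fun z : C_R_NormedModule => (c * z)%C : C_R_NormedModule).
Proof.
split.
- by move=> x y; exact: Cmult_plus_distr_l.
- move=> k [x y]; case: c => p q; rewrite /scal /= /prod_scal /scal /= /mult /= /Cmult /=.
  by congr pair; ring.
- exists (Cmod c + 1); have := Cmod_ge_0 c => c0; split; first lra.
  by move=> z; rewrite !norm_Cmod Cmod_mult; have := Cmod_ge_0 z; nra.
Qed.

Lemma is_derive_Clin (c1 c2 : C) (f g : R -> C) (t : R) (l m : C) :
  is_derive_C f t l -> is_derive_C g t m ->
  is_derive_C (fun s => (c1 * f s + c2 * g s)%C) t (c1 * l + c2 * m)%C.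
Proof.
move=> Df Dg.
have h1 := is_derive_linear _ _ _ _ _ _ (is_linear_Cmult c1) Df.
have h2 := is_derive_linear _ _ _ _ _ _ (is_linear_Cmult c2) Dg.
exact: (is_derive_plus _ _ _ _ _ h1 h2).
Qed.

Lemma filterlim_Clin (F : (R -> Prop) -> Prop) {FF : Filter F} (c1 c2 : C) (f g : R -> C)
    (l m : C) :
  filterlim f F (locally (l : C_R_NormedModule)) ->
  filterlim g F (locally (m : C_R_NormedModule)) ->
  filterlim (fun s => (c1 * f s + c2 * g s)%C) F
    (locally ((c1 * l + c2 * m)%C : C_R_NormedModule)).
Proof.
move=> hf hg.
have lin c (h : R -> C) (p : C) : filterlim h F (locally (p : C_R_NormedModule)) ->
    filterlim (fun s => (c * h s)%C) F (locally ((c * p)%C : C_R_NormedModule)).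
  move=> hh; apply: (filterlim_comp _ _ _ h (fun z : C => (c * z)%C) _ _ _ hh).
  have cont := linear_cont (U := C_R_NormedModule) (V := C_R_NormedModule) _ p (is_linear_Cmult c).
  exact: cont.
exact: (filterlim_comp_2 _ _ _ (lin c1 f l hf) (lin c2 g m hg)
  (filterlim_plus (V := C_R_NormedModule) (c1 * l)%C (c2 * m)%C)).
Qed.

Lemma csol_lin (T : R) (P Q u v u' v' : R -> C) (c1 c2 : C) :
  csol T P Q u v -> csol T P Q u' v' ->
  csol T P Q (fun s => (c1 * u s + c2 * u' s)%C) (fun s => (c1 * v s + c2 * v' s)%C).
Proof.
move=> [C1 D1] [C2 D2]; split=> t tT.
  have [a1 a2] := C1 t tT; have [b1 b2] := C2 t tT.
  by split; apply: filterlim_Clin.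
have [a1 a2] := D1 t tT; have [b1 b2] := D2 t tT; split; first exact: is_derive_Clin.
have -> : (- (P t * (c1 * v t + c2 * v' t) + Q t * (c1 * u t + c2 * u' t)))%C =
  (c1 * (- (P t * v t + Q t * u t)) + c2 * (- (P t * v' t + Q t * u' t)))%C by ring.
exact: is_derive_Clin.
Qed.

Definition coef_bound (T l : R) (P Q : R -> C) : Prop :=
  forall t, 0 < t < T -> Cmod (P t) <= l /\ Cmod (Q t) <= l.

Lemma energy_eq0 (k : R) (u v : C) : 0 < k -> energy k u v = 0 -> u = RtoC 0 /\ v = RtoC 0.
Proof.
move=> k0 e.
have p1 := Cmod_ge_0 u; have p2 := Cmod_ge_0 v.
have e' : (k * Cmod u) ^ 2 + Cmod v ^ 2 = 0 by rewrite -e /energy; ring.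
have q1 := pow2_ge_0 (k * Cmod u); have q2 := pow2_ge_0 (Cmod v).
have z1 : Cmod v = 0 by nra.
have z2 : k * Cmod u = 0 by nra.
split; apply: Cmod_eq_0 => //.
by move/Rmult_integral: z2 => []; lra.
Qed.

Lemma energy1_gronwall (T l : R) (P Q u v : R -> C) (s t : R) :
  0 <= l -> coef_bound T l P Q -> csol T P Q u v -> 0 < s -> s <= t -> t <= T ->
  energy 1 (u t) (v t) <= energy 1 (u s) (v s) * exp ((1 + 3 * l) * T) /\
  energy 1 (u s) (v s) <= energy 1 (u t) (v t) * exp ((1 + 3 * l) * T).
Proof.
move=> l0 bd S s0 st tT.
have [|h1 h2] := energy_gronwall T 1 l P Q u v s t Rlt_0_1 l0 S s0 st tT.
  by move=> x xst; rewrite pow1 Rmult_1_r; apply: bd; lra.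
have le : exp ((1 + 3 * l) * 1 * (t - s)) <= exp ((1 + 3 * l) * T).
  by apply: exp_le_exp; nra.
split.
  by apply: Rle_trans h1 _; apply: Rmult_le_compat_l => //; exact: energy_ge0.
by apply: Rle_trans h2 _; apply: Rmult_le_compat_l => //; exact: energy_ge0.
Qed.

Lemma csol_unique_end (T l : R) (P Q u v u' v' : R -> C) :
  0 < T -> 0 <= l -> coef_bound T l P Q -> csol T P Q u v -> csol T P Q u' v' ->
  u T = u' T -> v T = v' T -> forall t, 0 < t <= T -> u t = u' t /\ v t = v' t.
Proof.
move=> T0 l0 bd S S' eu ev t tT.
have S2 := csol_lin T P Q u v u' v' (RtoC 1) (RtoC (-1)) S S'.
have [_ h] := energy1_gronwall _ _ _ _ _ _ t T l0 bd S2 ltac:(lra) ltac:(lra) ltac:(lra).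
have e0 : energy 1 (1 * u T + (-1) * u' T)%C (1 * v T + (-1) * v' T)%C = 0.
  have zz (z : C) : (1 * z + (-1) * z)%C = RtoC 0 by ring.
  by rewrite eu ev !zz /energy Cmod_0; ring.
rewrite e0 Rmult_0_l in h.
have [] := energy_eq0 1 _ _ Rlt_0_1 (Rle_antisym _ _ h (energy_ge0 _ _ _)).
have cancel (x y : C) : (1 * x + (-1) * y)%C = RtoC 0 -> x = y.
  move=> xy; have e : x = ((1 * x + (-1) * y) + y)%C by ring.
  by rewrite e xy Cplus_0_l.
by move=> /cancel -> /cancel ->.
Qed.

Lemma bounded_derive_limit (T m : R) (f df : R -> R) : 0 < T ->
  (forall x, 0 < x < T -> is_derive f x (df x)) ->
  (forall x, 0 < x < T -> Rabs (df x) <= m) ->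
  exists l, filterlim f (at_right 0) (locally l).
Proof.
move=> T0 D bd.
have lip x y : 0 < x -> x <= y -> y < T -> Rabs (f y - f x) <= m * (y - x).
  move=> x0 xy yT.
  have aux (sg : R) : sg = 1 \/ sg = -1 -> sg * f y - m * y <= sg * f x - m * x.
    move=> sgE.
    apply: (derive_nonpos_le (fun s => sg * f s - m * s) (fun s => sg * df s - m)) => //.
    - move=> z zxy; have Dz := D z ltac:(lra).
      by auto_derive; [exists (df z) | rewrite (is_derive_unique _ _ _ Dz); ring].
    - move=> z zxy; have Dz := D z ltac:(lra).
      by apply: ex_derive_continuous; auto_derive; exists (df z).
    - move=> z zxy; have := bd z ltac:(lra); move=> /Rabs_le_between.
      by case: sgE => ->; lra.
  have := aux 1 (or_introl erefl); have := aux (-1) (or_intror erefl).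
  by move=> h1 h2; apply: Rabs_le; lra.
have m0 : 0 <= m.
  by apply: Rle_trans (bd (T / 2) _); [exact: Rabs_pos | lra].
apply/(filterlim_locally_cauchy (U := R_CompleteSpace)) => eps.
have ep := cond_pos eps.
pose de := Rmin T (eps / (m + 1)).
have d0 : 0 < de by apply: Rmin_glb_lt => //; apply: Rdiv_lt_0_compat; lra.
exists (fun x => 0 < x < de); split.
  exists (mkposreal _ d0) => x; rewrite /ball /= /AbsRing_ball /abs /minus /plus /opp /=.
  by move=> /Rabs_def2; lra.
have small x y : 0 < x -> x <= y -> y < de -> Rabs (f y - f x) < eps.
  move=> x0 xy yd.
  have y1 : y < T by apply: Rlt_le_trans yd _; exact: Rmin_l.
  have y2 : y < eps / (m + 1) by apply: Rlt_le_trans yd _; exact: Rmin_r.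
  apply: Rle_lt_trans (lip x y x0 xy y1) _.
  have := Rmult_lt_compat_r (m + 1) _ _ ltac:(lra) y2.
  have -> : eps / (m + 1) * (m + 1) = eps by field; lra.
  nra.
move=> x y [x0 xd] [y0 yd].
rewrite /ball /= /AbsRing_ball /abs /minus /plus /opp /=.
have [xy|yx] := Rle_dec x y; first exact: small.
by rewrite -Rabs_Ropp; have := small y x y0 ltac:(lra) xd; congr (Rabs _ < _); ring.
Qed.

Lemma Rabs_fst_Cmod (z : C) : Rabs (fst z) <= Cmod z.
Proof. by apply: Rle_trans (Rmax_Cmod z); exact: Rmax_l. Qed.

Lemma Rabs_snd_Cmod (z : C) : Rabs (snd z) <= Cmod z.
Proof. by apply: Rle_trans (Rmax_Cmod z); exact: Rmax_r. Qed.

Lemma energy_bounds (k : R) (u v : C) :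
  0 < k -> k * Cmod u <= sqrt (energy k u v) /\ Cmod v <= sqrt (energy k u v).
Proof.
move=> k0; have p1 := Cmod_ge_0 u; have p2 := Cmod_ge_0 v.
have q : 0 <= k * Cmod u by nra.
split.
  by rewrite -{1}(sqrt_pow2 (k * Cmod u)) //; apply: sqrt_le_1_alt; rewrite /energy; nra.
by rewrite -{1}(sqrt_pow2 (Cmod v)) //; apply: sqrt_le_1_alt; rewrite /energy; nra.
Qed.

(** The solution stays bounded with its first two derivatives, so [u] and [v] are
    Lipschitz and have limits at 0. *)
Lemma csol_limits (T l : R) (P Q u v : R -> C) :
  0 < T -> 0 <= l -> coef_bound T l P Q -> csol T P Q u v ->
  exists p q : C, lim_right0 u p /\ lim_right0 v q.
Proof.
move=> T0 l0 bd S; have [_ D] := S.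
pose m := sqrt (energy 1 (u T) (v T) * exp ((1 + 3 * l) * T)).
have b x : 0 < x < T -> Cmod (u x) <= m /\ Cmod (v x) <= m.
  move=> xT.
  have [_ h] := energy1_gronwall _ _ _ _ _ _ x T l0 bd S ltac:(lra) ltac:(lra) ltac:(lra).
  have [h1 h2] := energy_bounds 1 (u x) (v x) Rlt_0_1.
  have h3 := sqrt_le_1_alt _ _ h.
  by rewrite Rmult_1_l in h1; split; [apply: Rle_trans h1 h3 | apply: Rle_trans h2 h3].
have bdv x : 0 < x < T -> Cmod (- (P x * v x + Q x * u x))%C <= 2 * (l * m).
  move=> xT; have [b1 b2] := b x xT; have [b3 b4] := bd x xT.
  rewrite Cmod_opp; apply: Rle_trans (Cmod_triangle _ _) _; rewrite !Cmod_mult.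
  have e1 : Cmod (P x) * Cmod (v x) <= l * m by apply: Rmult_le_compat => //; exact: Cmod_ge_0.
  have e2 : Cmod (Q x) * Cmod (u x) <= l * m by apply: Rmult_le_compat => //; exact: Cmod_ge_0.
  lra.
have [p1 hp1] := bounded_derive_limit T m _ _ T0
  (fun x xT => is_derive_fst _ _ _ (proj1 (D x xT)))
  (fun x xT => Rle_trans _ _ _ (Rabs_fst_Cmod _) (proj2 (b x xT))).
have [p2 hp2] := bounded_derive_limit T m _ _ T0
  (fun x xT => is_derive_snd _ _ _ (proj1 (D x xT)))
  (fun x xT => Rle_trans _ _ _ (Rabs_snd_Cmod _) (proj2 (b x xT))).
have [q1 hq1] := bounded_derive_limit T (2 * (l * m)) _ _ T0
  (fun x xT => is_derive_fst _ _ _ (proj2 (D x xT)))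
  (fun x xT => Rle_trans _ _ _ (Rabs_fst_Cmod _) (bdv x xT)).
have [q2 hq2] := bounded_derive_limit T (2 * (l * m)) _ _ T0
  (fun x xT => is_derive_snd _ _ _ (proj2 (D x xT)))
  (fun x xT => Rle_trans _ _ _ (Rabs_snd_Cmod _) (bdv x xT)).
exists (p1, p2), (q1, q2); split.
  by apply/(filterlim_C (at_right 0) u (p1, p2)).
by apply/(filterlim_C (at_right 0) v (q1, q2)).
Qed.

Lemma lim_right0_lin (c1 c2 : C) (f g : R -> C) (l m : C) :
  lim_right0 f l -> lim_right0 g m ->
  lim_right0 (fun s => (c1 * f s + c2 * g s)%C) (c1 * l + c2 * m)%C.
Proof. exact: filterlim_Clin. Qed.

Lemma lim_right0_energy (k : R) (u v : R -> C) (p q : C) :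
  lim_right0 u p -> lim_right0 v q ->
  filterlim (fun s => energy k (u s) (v s)) (at_right 0) (locally (energy k p q)).
Proof.
have mul (f g : R -> R) (x y : R) : filterlim f (at_right 0) (locally x) ->
    filterlim g (at_right 0) (locally y) ->
    filterlim (fun s => f s * g s) (at_right 0) (locally (x * y)).
  move=> hf hg; exact: (filterlim_comp_2 _ _ _ hf hg (filterlim_mult (K := R_AbsRing) x y)).
have cm (f : R -> C) (x : C) : lim_right0 f x ->
    filterlim (fun s => Cmod (f s) ^ 2) (at_right 0) (locally (Cmod x ^ 2)).
  move=> hf.
  have h : filterlim (fun s => Cmod (f s)) (at_right 0) (locally (Cmod x)).
    apply: (filterlim_ext (fun s => norm (f s : C_R_NormedModule))).
      by move=> s; exact: norm_Cmod.
    rewrite -norm_Cmod; apply: (filterlim_comp _ _ _ f _ _ _ _ hf).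
    exact: (filterlim_norm (V := C_R_NormedModule)).
  rewrite /= Rmult_1_r.
  by apply: (filterlim_ext (fun s => Cmod (f s) * Cmod (f s))); [move=> s; ring | exact: mul].
move=> hu hv.
have h1 := mul (fun=> k ^ 2) _ _ _ (filterlim_const (F := at_right 0) (k ^ 2)) (cm _ _ hu).
have h2 := filterlim_plus (V := R_NormedModule) (k ^ 2 * Cmod p ^ 2) (Cmod q ^ 2).
have h3 := cm _ _ hv.
exact: (filterlim_comp_2 _ _ _ (h1 _) h3 h2).
Qed.

Lemma at_right0_interval (t : R) : 0 < t -> at_right 0 (fun s => 0 < s < t).
Proof.
move=> t0; exists (mkposreal t t0) => s.
by rewrite /ball /= /AbsRing_ball /abs /minus /plus /opp /= => /Rabs_def2; lra.
Qed.

(** With bounded coefficients the constant in Gronwall's inequality does not degenerate as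
    the initial time tends to 0, so that zero limits propagate. *)
Lemma csol_limits_zero (T l : R) (P Q u v : R -> C) :
  0 < T -> 0 <= l -> coef_bound T l P Q -> csol T P Q u v ->
  lim_right0 u (RtoC 0) -> lim_right0 v (RtoC 0) ->
  forall t, 0 < t <= T -> u t = RtoC 0 /\ v t = RtoC 0.
Proof.
move=> T0 l0 bd S hu hv t tT; apply: (energy_eq0 1) Rlt_0_1 _.
apply: Rle_antisym; last exact: energy_ge0.
have lim := lim_right0_energy 1 u v _ _ hu hv.
pose G := exp ((1 + 3 * l) * T).
have limG : filterlim (fun s => energy 1 (u s) (v s) * G) (at_right 0)
    (locally (energy 1 (RtoC 0) (RtoC 0) * G)).
  exact: (filterlim_comp_2 _ _ _ lim (filterlim_const G) (filterlim_mult (K := R_AbsRing) _ _)).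
have z : energy 1 (RtoC 0) (RtoC 0) * G = 0 by rewrite /energy Cmod_0; ring.
rewrite z in limG.
have le : at_right 0 (fun s => energy 1 (u t) (v t) <= energy 1 (u s) (v s) * G).
  have near := at_right0_interval t ltac:(lra).
  apply: (filter_imp _ _ _ near) => s st.
  by have [] := energy1_gronwall _ _ _ _ _ _ s t l0 bd S ltac:(lra) ltac:(lra) ltac:(lra).
have limC := filterlim_const (F := at_right 0) (energy 1 (u t) (v t)).
exact: (filterlim_le (F := at_right 0) _ _ (Finite (energy 1 (u t) (v t))) (Finite 0) le (limC _) limG).
Qed.

(** The real 4x4 matrix of [(u, v) |-> (v, - (P v + Q u))] in the coordinates
    [(Re u, Im u, Re v, Im v)]. *)
Definition wave_matrix (P Q : C) (i j : nat) : R :=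
  match i, j with
  | 0%N, 2%N => 1
  | 1%N, 3%N => 1
  | 2%N, 0%N => - fst Q
  | 2%N, 1%N => snd Q
  | 2%N, 2%N => - fst P
  | 2%N, 3%N => snd P
  | 3%N, 0%N => - snd Q
  | 3%N, 1%N => - fst Q
  | 3%N, 2%N => - snd P
  | 3%N, 3%N => - fst P
  | _, _ => 0
  end.

(** Unlike continuations by [clamp], the solutions constructed below satisfy the equation
    at [T] too, which provides the one-sided derivatives required of solutions of (W). *)
Definition csol_full (T : R) (P Q u v : R -> C) : Prop :=
  forall t, 0 < t <= T -> is_derive_C u t (v t) /\
     is_derive_C v t (- (P t * v t + Q t * u t))%C.

Lemma csol_full_csol (T : R) (P Q u v : R -> C) : csol_full T P Q u v -> csol T P Q u v.
Proof.
move=> S; split=> t tT; last by apply: S; lra.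
have [D1 D2] := S t tT.
by split; apply: (ex_derive_continuous (V := C_R_NormedModule)); eexists; eauto.
Qed.

Lemma csol_full_lin (T : R) (P Q u v u' v' : R -> C) (c1 c2 : C) :
  csol_full T P Q u v -> csol_full T P Q u' v' ->
  csol_full T P Q (fun s => (c1 * u s + c2 * u' s)%C) (fun s => (c1 * v s + c2 * v' s)%C).
Proof.
move=> S S' t tT; have [a1 a2] := S t tT; have [b1 b2] := S' t tT.
split; first exact: is_derive_Clin.
have -> : (- (P t * (c1 * v t + c2 * v' t) + Q t * (c1 * u t + c2 * u' t)))%C =
  (c1 * (- (P t * v t + Q t * u t)) + c2 * (- (P t * v' t + Q t * u' t)))%C by ring.
exact: is_derive_Clin.
Qed.

Lemma csol_exists (T l : R) (P Q : R -> C) (a0 a1 : C) :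
  0 < T ->
  (forall t, 0 < t -> continuous_C P t /\ continuous_C Q t) ->
  (forall t, 0 < t -> Cmod (P t) <= l /\ Cmod (Q t) <= l) ->
  exists u v : R -> C, csol_full T P Q u v /\ u T = a0 /\ v T = a1.
Proof.
move=> T0 cPQ bPQ.
pose A (i j : 'I_4) t := wave_matrix (P t) (Q t) i j.
pose y0 (i : 'I_4) : R := match nat_of_ord i with
  | 0%N => fst a0 | 1%N => snd a0 | 2%N => fst a1 | _ => snd a1 end.
have cA (i j : 'I_4) t : 0 < t < 2 * T -> continuous (A i j) t.
  move=> tT; have [cP cQ] := cPQ t ltac:(lra).
  have p1 := continuous_fst_C _ _ cP; have p2 := continuous_snd_C _ _ cP.
  have q1 := continuous_fst_C _ _ cQ; have q2 := continuous_snd_C _ _ cQ.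
  have o (f : R -> R) : continuous f t -> continuous (fun s => - f s) t.
    exact: (continuous_opp (V := R_NormedModule)).
  rewrite /A /wave_matrix; case: i => -[|[|[|[|i]]]] Hi //=; case: j => -[|[|[|[|j]]]] Hj //=;
    try exact: continuous_const; try exact: o; done.
have bA (i j : 'I_4) t : 0 < t < 2 * T -> Rabs (A i j t) <= l + 1.
  move=> tT; have [bP bQ] := bPQ t ltac:(lra).
  have p1 := Rabs_fst_Cmod (P t); have p2 := Rabs_snd_Cmod (P t).
  have q1 := Rabs_fst_Cmod (Q t); have q2 := Rabs_snd_Cmod (Q t).
  have c0 := Cmod_ge_0 (P t).
  rewrite /A /wave_matrix; case: i => -[|[|[|[|i]]]] Hi //=; case: j => -[|[|[|[|j]]]] Hj //=;
    rewrite ?Rabs_Ropp ?Rabs_R0 ?Rabs_R1; lra.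
have [y [yT Dy]] := linear_system_solvable 4 A T y0 (l + 1) T0 cA bA.
pose i0 : 'I_4 := ord0; pose i1 : 'I_4 := lift ord0 ord0.
pose i2 : 'I_4 := lift ord0 (lift ord0 ord0).
pose i3 : 'I_4 := lift ord0 (lift ord0 (lift ord0 ord0)).
pose u t : C := (y i0 t, y i1 t); pose v t : C := (y i2 t, y i3 t).
have D t : 0 < t < 2 * T ->
    is_derive_C u t (v t) /\ is_derive_C v t (- (P t * v t + Q t * u t))%C.
  move=> tT; split.
  - apply: is_derive_pair.
    + evar_last; first exact: (Dy i0 t tT).
      rewrite !rsum_S big_ord0 /A /=.
      by rewrite -/i0 -/i1 -/i2 -/i3; ring.
    + evar_last; first exact: (Dy i1 t tT).
      rewrite !rsum_S big_ord0 /A /=.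
      by rewrite -/i0 -/i1 -/i2 -/i3; ring.
  - have -> : (- (P t * v t + Q t * u t))%C =
      (fst (- (P t * v t + Q t * u t))%C, snd (- (P t * v t + Q t * u t))%C) by case: (- _)%C.
    apply: is_derive_pair.
    + evar_last; first exact: (Dy i2 t tT).
      rewrite !rsum_S big_ord0 /A /=.
      by rewrite -/i0 -/i1 -/i2 -/i3; ring.
    + evar_last; first exact: (Dy i3 t tT).
      rewrite !rsum_S big_ord0 /A /=.
      by rewrite -/i0 -/i1 -/i2 -/i3; ring.
exists u, v; split; last first.
  by rewrite /u /v !yT; split; [case: a0 @y0 yT | case: a1 @y0 yT].
by move=> t tT; apply: D; lra.
Qed.

(** The two solutions with data (1,0) and (0,1) at [T] have linearly independent limits,
    since a combination with zero limits vanishes identically. *)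
Lemma csol_scattering (T l : R) (P Q : R -> C) (p q : C) :
  0 < T -> 0 <= l ->
  (forall t, 0 < t -> continuous_C P t /\ continuous_C Q t) ->
  (forall t, 0 < t -> Cmod (P t) <= l /\ Cmod (Q t) <= l) ->
  exists u v : R -> C, csol_full T P Q u v /\ lim_right0 u p /\ lim_right0 v q.
Proof.
move=> T0 l0 cPQ bPQ.
have bd : coef_bound T l P Q by move=> t tT; apply: bPQ; lra.
have [u1 [v1 [F1 [e1 f1]]]] := csol_exists T l P Q (RtoC 1) (RtoC 0) T0 cPQ bPQ.
have [u2 [v2 [F2 [e2 f2]]]] := csol_exists T l P Q (RtoC 0) (RtoC 1) T0 cPQ bPQ.
have S1 := csol_full_csol _ _ _ _ _ F1; have S2 := csol_full_csol _ _ _ _ _ F2.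
have [p1 [q1 [hp1 hq1]]] := csol_limits T l P Q u1 v1 T0 l0 bd S1.
have [p2 [q2 [hp2 hq2]]] := csol_limits T l P Q u2 v2 T0 l0 bd S2.
have indep (x y : C) : (x * p1 + y * p2)%C = RtoC 0 -> (x * q1 + y * q2)%C = RtoC 0 ->
    x = RtoC 0 /\ y = RtoC 0.
  move=> hx hy.
  have S := csol_lin T P Q u1 v1 u2 v2 x y S1 S2.
  have lu := lim_right0_lin x y u1 u2 p1 p2 hp1 hp2.
  have lv := lim_right0_lin x y v1 v2 q1 q2 hq1 hq2.
  rewrite hx in lu; rewrite hy in lv.
  have [] := csol_limits_zero T l P Q _ _ T0 l0 bd S lu lv T ltac:(lra).
  rewrite e1 e2 f1 f2 => hu hv; split.
    by rewrite -hu; ring.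
  by rewrite -hv; ring.
pose det := (p1 * q2 - p2 * q1)%C.
have det0 : det <> RtoC 0.
  move=> z.
  have [||a1 a2] := indep q2 (- q1)%C.
  - have -> : (q2 * p1 + - q1 * p2)%C = det by rewrite /det; ring.
    exact: z.
  - by ring.
  have [||b1 b2] := indep p2 (- p1)%C.
  - by ring.
  - have -> : (p2 * q1 + - p1 * q2)%C = (- det)%C by rewrite /det; ring.
    by rewrite z; ring.
  have q10 : q1 = RtoC 0 by have -> : q1 = (- - q1)%C by [ring]; rewrite a2; ring.
  have p10 : p1 = RtoC 0 by have -> : p1 = (- - p1)%C by [ring]; rewrite b2; ring.
  have [||c1 _] := indep (RtoC 1) (RtoC 0); first by rewrite p10; ring.
    by rewrite q10; ring.
  by move/RtoC_inj: c1; lra.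
pose x := ((p * q2 - p2 * q) / det)%C; pose y := ((p1 * q - p * q1) / det)%C.
exists (fun s => (x * u1 s + y * u2 s)%C), (fun s => (x * v1 s + y * v2 s)%C).
split; first exact: csol_full_lin.
have ep : (x * p1 + y * p2)%C = p by rewrite /x /y /det; field.
have eq : (x * q1 + y * q2)%C = q by rewrite /x /y /det; field.
by split; [rewrite -ep; exact: lim_right0_lin | rewrite -eq; exact: lim_right0_lin].
Qed.

Lemma csol_unique_limits (T l : R) (P Q u v u' v' : R -> C) (p q : C) :
  0 < T -> 0 <= l -> coef_bound T l P Q -> csol T P Q u v -> csol T P Q u' v' ->
  lim_right0 u p -> lim_right0 v q -> lim_right0 u' p -> lim_right0 v' q ->
  forall t, 0 < t <= T -> u t = u' t /\ v t = v' t.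
Proof.
move=> T0 l0 bd S S' hu hv hu' hv' t tT.
have S2 := csol_lin T P Q u v u' v' (RtoC 1) (RtoC (-1)) S S'.
have lu := lim_right0_lin (RtoC 1) (RtoC (-1)) _ _ _ _ hu hu'.
have lv := lim_right0_lin (RtoC 1) (RtoC (-1)) _ _ _ _ hv hv'.
have zz (z : C) : (1 * z + (-1) * z)%C = RtoC 0 by ring.
rewrite zz in lu; rewrite zz in lv.
have [] := csol_limits_zero T l P Q _ _ T0 l0 bd S2 lu lv t tT.
have cancel (x y : C) : (1 * x + (-1) * y)%C = RtoC 0 -> x = y.
  move=> xy; have e : x = ((1 * x + (-1) * y) + y)%C by ring.
  by rewrite e xy Cplus_0_l.
by move=> /cancel -> /cancel ->.
Qed.

(** * The corrected energy at high frequency *)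

Definition dot (z w : C) : R := fst z * fst w + snd z * snd w.

(** The imaginary part of [z * conj w]. *)
Definition cross (z w : C) : R := snd z * fst w - fst z * snd w.

Lemma Rabs_dot (z w : C) : Rabs (dot z w) <= Cmod z * Cmod w.
Proof. exact: Rabs_dot_Cmod. Qed.

Lemma Rabs_cross (z w : C) : Rabs (cross z w) <= Cmod z * Cmod w.
Proof.
have := Rabs_dot_Cmod (Ci * w)%C z; rewrite Cmod_mult Cmod_Ci Rmult_1_l Rmult_comm.
by congr (Rabs _ <= _); rewrite /cross /=; ring.
Qed.

Definition modN (X Y : C) : R := Cmod X ^ 2 + Cmod Y ^ 2.
Definition modD (X Y : C) : R := Cmod X ^ 2 - Cmod Y ^ 2.

Lemma modN_ge0 (X Y : C) : 0 <= modN X Y.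
Proof. by rewrite /modN; have := pow2_ge_0 (Cmod X); have := pow2_ge_0 (Cmod Y); lra. Qed.

Lemma Rabs_modD (X Y : C) : Rabs (modD X Y) <= modN X Y.
Proof.
rewrite /modD /modN; have := pow2_ge_0 (Cmod X); have := pow2_ge_0 (Cmod Y) => h1 h2.
by apply: Rabs_le; lra.
Qed.

Lemma Rabs_dot_modN (X Y : C) : Rabs (2 * dot X Y) <= modN X Y.
Proof.
rewrite Rabs_mult (Rabs_right 2); last lra.
by have := Rabs_dot X Y; have := pow2_ge_0 (Cmod X - Cmod Y); rewrite /modN; nra.
Qed.

Lemma Rabs_cross_modN (X Y : C) : Rabs (2 * cross X Y) <= modN X Y.
Proof.
rewrite Rabs_mult (Rabs_right 2); last lra.
by have := Rabs_cross X Y; have := pow2_ge_0 (Cmod X - Cmod Y); rewrite /modN; nra.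
Qed.

(** [modD] and [cross] oscillate: along [X' = i s Y], [Y' = i s X] they satisfy
    [modD' = 4 s cross] and [cross' = - s modD]. The correction, of relative size [kap],
    integrates by parts the oscillating terms of the derivative of [modN]. *)
Definition corrected (kap d2 l : R) (X Y : C) : R :=
  modN X Y - kap * (d2 / 2 * modD X Y + l * cross X Y).

Lemma corrected_modN (kap d2 l m : R) (X Y : C) :
  0 <= kap -> Rabs d2 <= m -> 0 <= l <= m ->
  Rabs (corrected kap d2 l X Y - modN X Y) <= m * kap * modN X Y.
Proof.
move=> k0 hd hl.
have hD := Rabs_modD X Y; have hJ := Rabs_cross_modN X Y; have hN := modN_ge0 X Y.
have -> : corrected kap d2 l X Y - modN X Y =
  - (kap * (d2 * (modD X Y) + l * (2 * cross X Y)) / 2) by rewrite /corrected; field.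
rewrite Rabs_Ropp /Rdiv Rabs_mult (Rabs_right (/ 2)); last lra.
rewrite Rabs_mult (Rabs_right kap); last lra.
have h1 : Rabs (d2 * modD X Y) <= m * modN X Y.
  by rewrite Rabs_mult; apply: Rmult_le_compat => //; exact: Rabs_pos.
have h2 : Rabs (l * (2 * cross X Y)) <= m * modN X Y.
  rewrite Rabs_mult (Rabs_right l); last lra.
  by apply: Rmult_le_compat => //; [lra | exact: Rabs_pos | lra].
have h3 := Rabs_triang (d2 * modD X Y) (l * (2 * cross X Y)).
have h4 : kap * Rabs (d2 * modD X Y + l * (2 * cross X Y)) <= kap * (2 * (m * modN X Y)).
  by apply: Rmult_le_compat_l => //; lra.
lra.
Qed.

Definition corrected_deriv (kap d2 l t : R) (X Y X' Y' : C) : R :=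
  2 * dot X X' + 2 * dot Y Y'
  - kap * (d2 * (dot X X' - dot Y Y') + l * (cross X' Y + cross X Y'))
  + (l + 1) * kap / t * (d2 / 2 * modD X Y + l * cross X Y).

Lemma modN_bounds (X Y : C) :
  Cmod X <= sqrt (modN X Y) /\ Cmod Y <= sqrt (modN X Y) /\ sqrt (modN X Y) ^ 2 = modN X Y.
Proof.
have p1 := Cmod_ge_0 X; have p2 := Cmod_ge_0 Y.
split; first by rewrite -{1}(sqrt_pow2 (Cmod X)) //; apply: sqrt_le_1_alt; rewrite /modN; nra.
split; first by rewrite -{1}(sqrt_pow2 (Cmod Y)) //; apply: sqrt_le_1_alt; rewrite /modN; nra.
by rewrite pow2_sqrt //; exact: modN_ge0.
Qed.

(** The rotation by [rb] preserves all quadratic quantities involved. The oscillating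
    terms [2 d2 cross - l modD] of the derivative of [modN], which carry the factor [1 / t],
    meet the same terms with the factor [kap s] from the correction: they cancel when
    [kap s = 1 / t]. Of the lower order coupling only [d1] survives at order [1 / t]. *)
Lemma corrected_rate (kap d1 d2 l m t s rb eta : R) (X Y R1 R2 : C) :
  0 < t -> 0 <= kap -> m * kap <= / 2 -> 0 <= l <= m -> Rabs d1 <= m -> Rabs d2 <= m ->
  0 <= eta -> Cmod R1 <= eta * sqrt (modN X Y) -> Cmod R2 <= eta * sqrt (modN X Y) ->
  let X' := (- (Ci * RtoC rb) * X + Ci * RtoC s * Y + ((d1, d2) * RtoC (/ t) * Y + R1))%C in
  let Y' := (- (Ci * RtoC rb) * Y + Ci * RtoC s * X + (RtoC (l / t) * Y + R2))%C in
  Rabs (corrected_deriv kap d2 l t X Y X' Y' - l / t * corrected kap d2 l X Y) <=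
  (Rabs d1 / t + (4 * m * Rabs (/ t - kap * s) + 12 * eta + 22 * m * (m + 1) * (kap / t)))
    * corrected kap d2 l X Y.
Proof.
move=> t0 k0 mk hl hd1 hd2 e0 hR1 hR2 X' Y'.
set W1 := ((d1, d2) * RtoC (/ t) * Y + R1)%C in X' *.
set W2 := (RtoC (l / t) * Y + R2)%C in Y' *.
have [n1 [n2 n3]] := modN_bounds X Y.
have hN := modN_ge0 X Y.
move: n1 n2 n3 hR1 hR2; set n := sqrt (modN X Y) => n1 n2 n3 hR1 hR2.
have n0 : 0 <= n by exact: sqrt_pos.
have it : 0 < / t by exact: Rinv_0_lt_compat.
have m0 : 0 <= m by lra.
have W1n : Cmod W1 <= (2 * m * / t + eta) * n.
  apply: Rle_trans (Cmod_triangle _ _) _; rewrite !Cmod_mult Cmod_R (Rabs_right (/ t)); last lra.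
  have hd : Cmod (d1, d2) <= 2 * m.
    have -> : (d1, d2) = (RtoC d1 + Ci * RtoC d2)%C by rewrite /Cplus /Cmult /=; congr pair; ring.
    apply: Rle_trans (Cmod_triangle _ _) _; rewrite Cmod_mult Cmod_Ci !Cmod_R; lra.
  have h1 : Cmod (d1, d2) * / t * Cmod Y <= 2 * m * / t * n.
    apply: Rmult_le_compat => //; try exact: Cmod_ge_0.
      by apply: Rmult_le_pos; [exact: Cmod_ge_0 | lra].
    by apply: Rmult_le_compat_r => //; lra.
  lra.
have W2n : Cmod W2 <= (2 * m * / t + eta) * n.
  apply: Rle_trans (Cmod_triangle _ _) _; rewrite !Cmod_mult Cmod_R Rabs_right; last first.
    by apply: Rle_ge; apply: Rdiv_le_0_compat; lra.
  have h1 : l / t * Cmod Y <= 2 * m * / t * n.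
    apply: Rmult_le_compat => //; try exact: Cmod_ge_0; first by apply: Rdiv_le_0_compat; lra.
    by apply: Rmult_le_compat_r => //; lra.
  lra.
pose T1 := d1 / t * (2 * dot X Y).
pose T2 := (d2 * (2 * cross X Y) - l * modD X Y) * (/ t - kap * s).
pose T3 := 2 * dot X R1 + 2 * dot Y R2.
pose T4 := kap * (d2 * (dot X W1 - dot Y W2) + l * (cross W1 Y + cross X W2)).
pose T5 := (l + 1) * kap / t * (d2 / 2 * modD X Y + l * cross X Y).
have id : corrected_deriv kap d2 l t X Y X' Y' = l / t * modN X Y + T1 + T2 + T3 - T4 + T5.
  rewrite /corrected_deriv /T1 /T2 /T3 /T4 /T5 /X' /Y' /W1 /W2 /modD /modN !Cmod_sqr /dot /cross.
  case: X Y R1 R2 {n n0 n1 n2 n3 hR1 hR2 hN X' Y' W1 W2 W1n W2n T1 T2 T3 T4 T5} =>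
    [x1 x2] [y1 y2] [r1 r2] [s1 s2] /=; field; lra.
set N := modN X Y in hN n3 id *.
have nn (x y A B : R) : 0 <= x <= A * n -> 0 <= y <= B * n -> x * y <= A * B * N.
  move=> hx hy; rewrite -n3.
  have := Rmult_le_compat x (A * n) y (B * n) ltac:(lra) ltac:(lra) ltac:(lra) ltac:(lra).
  nra.
have bX : 0 <= Cmod X <= 1 * n by split; [exact: Cmod_ge_0 | lra].
have bY : 0 <= Cmod Y <= 1 * n by split; [exact: Cmod_ge_0 | lra].
have bW1 : 0 <= Cmod W1 <= (2 * m * / t + eta) * n by split; [exact: Cmod_ge_0 | lra].
have bW2 : 0 <= Cmod W2 <= (2 * m * / t + eta) * n by split; [exact: Cmod_ge_0 | lra].
have bR1 : 0 <= Cmod R1 <= eta * n by split; [exact: Cmod_ge_0 | lra].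
have bR2 : 0 <= Cmod R2 <= eta * n by split; [exact: Cmod_ge_0 | lra].
have B1 : Rabs T1 <= Rabs d1 / t * N.
  rewrite /T1 Rabs_mult /Rdiv Rabs_mult (Rabs_right (/ t)); last lra.
  apply: Rmult_le_compat_l; last exact: Rabs_dot_modN.
  by apply: Rmult_le_pos; [exact: Rabs_pos | lra].
have B2 : Rabs T2 <= 2 * m * Rabs (/ t - kap * s) * N.
  rewrite /T2 Rabs_mult.
  have h1 : Rabs (d2 * (2 * cross X Y)) <= m * N.
    rewrite Rabs_mult; apply: Rmult_le_compat => //; try exact: Rabs_pos.
    exact: Rabs_cross_modN.
  have h2 : Rabs (l * modD X Y) <= m * N.
    rewrite Rabs_mult (Rabs_right l); last lra.
    by apply: Rmult_le_compat; try exact: Rabs_pos; try lra; exact: Rabs_modD.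
  have h3 : Rabs (d2 * (2 * cross X Y) - l * modD X Y) <= 2 * m * N.
    by apply: Rle_trans (Rabs_triang _ _) _; rewrite Rabs_Ropp; lra.
  have := Rmult_le_compat_r _ _ _ (Rabs_pos (/ t - kap * s)) h3; lra.
have B3 : Rabs T3 <= 4 * eta * N.
  have h1 := Rle_trans _ _ _ (Rabs_dot X R1) (nn _ _ _ _ bX bR1).
  have h2 := Rle_trans _ _ _ (Rabs_dot Y R2) (nn _ _ _ _ bY bR2).
  rewrite /T3; move/Rabs_le_between: h1 => h1; move/Rabs_le_between: h2 => h2.
  by apply: Rabs_le; lra.
have B4 : Rabs T4 <= kap * (4 * m * (2 * m * / t + eta) * N).
  rewrite /T4 Rabs_mult (Rabs_right kap); last lra.
  apply: Rmult_le_compat_l => //.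
  have h1 := Rle_trans _ _ _ (Rabs_dot X W1) (nn _ _ _ _ bX bW1).
  have h2 := Rle_trans _ _ _ (Rabs_dot Y W2) (nn _ _ _ _ bY bW2).
  have h3 := Rle_trans _ _ _ (Rabs_cross W1 Y) (nn _ _ _ _ bW1 bY).
  have h4 := Rle_trans _ _ _ (Rabs_cross X W2) (nn _ _ _ _ bX bW2).
  have h5 : Rabs (dot X W1 - dot Y W2) <= 2 * (2 * m * / t + eta) * N.
    by apply: Rle_trans (Rabs_triang _ _) _; rewrite Rabs_Ropp; lra.
  have h6 : Rabs (cross W1 Y + cross X W2) <= 2 * (2 * m * / t + eta) * N.
    by apply: Rle_trans (Rabs_triang _ _) _; lra.
  apply: Rle_trans (Rabs_triang _ _) _; rewrite !Rabs_mult (Rabs_right l); last lra.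
  have h7 := Rmult_le_compat _ _ _ _ (Rabs_pos _) (Rabs_pos _) hd2 h5.
  have h8 := Rmult_le_compat _ _ _ _ (proj1 hl) (Rabs_pos _) (proj2 hl) h6.
  lra.
have B5 : Rabs T5 <= (m + 1) * (kap / t) * (m * N).
  have -> : T5 = (l + 1) * (kap / t) * (d2 / 2 * modD X Y + l * cross X Y) by rewrite /T5; field; lra.
  have kt : 0 <= kap / t by apply: Rdiv_le_0_compat.
  rewrite Rabs_mult (Rabs_right ((l + 1) * _)); last by apply: Rle_ge; apply: Rmult_le_pos; lra.
  apply: Rmult_le_compat; try exact: Rabs_pos; first by apply: Rmult_le_pos; lra.
    by apply: Rmult_le_compat_r; lra.
  have h1 : Rabs (d2 * modD X Y) <= m * N.
    by rewrite Rabs_mult; apply: Rmult_le_compat => //; try exact: Rabs_pos; exact: Rabs_modD.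
  have h2 : Rabs (l * (2 * cross X Y)) <= m * N.
    rewrite Rabs_mult (Rabs_right l); last lra.
    by apply: Rmult_le_compat; try exact: Rabs_pos; try lra; exact: Rabs_cross_modN.
  move/Rabs_le_between: h1 => h1; move/Rabs_le_between: h2 => h2.
  by apply: Rabs_le; lra.
have := corrected_modN kap d2 l m X Y k0 hd2 hl; rewrite -/N.
set E := corrected kap d2 l X Y => hE.
have mk0 : 0 <= m * kap by apply: Rmult_le_pos.
have NE : N <= 2 * E.
  move/Rabs_le_between: hE => hE; have := Rmult_le_compat_r _ _ _ hN mk; lra.
have E0 : 0 <= E by lra.
have kt0 : 0 <= kap / t by apply: Rdiv_le_0_compat.
rewrite id.
have -> : l / t * N + T1 + T2 + T3 - T4 + T5 - l / t * E =
  - (l / t * (E - N)) + T1 + T2 + T3 - T4 + T5 by ring.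
have B0 : Rabs (l / t * (E - N)) <= m * m * (kap / t) * N.
  rewrite Rabs_mult (Rabs_right (l / t)); last by apply: Rle_ge; apply: Rdiv_le_0_compat; lra.
  have -> : m * m * (kap / t) * N = m / t * (m * kap * N) by rewrite /Rdiv; ring.
  apply: Rmult_le_compat => //; [by apply: Rdiv_le_0_compat; lra | exact: Rabs_pos |].
  by apply: Rmult_le_compat_r; lra.
(* in the leading term the passage from N to E has to cost only O(kap / t) *)
have B1' : Rabs d1 / t * N <= Rabs d1 / t * E + m * m * (kap / t) * N.
  have : Rabs d1 / t * (N - E) <= m / t * (m * kap * N).
    have q : 0 <= Rabs d1 / t by apply: Rdiv_le_0_compat => //; exact: Rabs_pos.
    have q1 : N - E <= m * kap * N by move/Rabs_le_between: hE; lra.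
    have q2 : Rabs d1 / t * (N - E) <= Rabs d1 / t * (m * kap * N) by apply: Rmult_le_compat_l.
    apply: Rle_trans q2 _; apply: Rmult_le_compat_r; first by apply: Rmult_le_pos.
    by apply: Rmult_le_compat_r => //; lra.
  by rewrite /Rdiv; lra.
have B4' : kap * (4 * m * (2 * m * / t + eta) * N) <= 8 * m * m * (kap / t) * N + 2 * eta * N.
  have q : m * kap * (eta * N) <= / 2 * (eta * N) by apply: Rmult_le_compat_r => //; nra.
  by rewrite /Rdiv; lra.
have tot : Rabs (- (l / t * (E - N)) + T1 + T2 + T3 - T4 + T5) <=
   Rabs d1 / t * E + (2 * m * Rabs (/ t - kap * s) + 6 * eta + 11 * m * (m + 1) * (kap / t)) * N.
  have mm : m * (kap / t) * N >= 0 by apply: Rle_ge; apply: Rmult_le_pos => //; apply: Rmult_le_pos.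
  move/Rabs_le_between: B0 => B0; move/Rabs_le_between: B1 => B1; move/Rabs_le_between: B2 => B2.
  move/Rabs_le_between: B3 => B3; move/Rabs_le_between: B4 => B4; move/Rabs_le_between: B5 => B5.
  by apply: Rabs_le; lra.
apply: Rle_trans tot _.
set A := 2 * m * _ + _ + _.
have A0 : 0 <= A.
  rewrite /A; have := Rmult_le_pos _ _ m0 (Rabs_pos (/ t - kap * s)).
  have := Rmult_le_pos _ _ (Rmult_le_pos _ _ m0 (Rle_trans _ _ _ m0 (ltac:(lra) : m <= m + 1))) kt0.
  lra.
have := Rmult_le_compat_l _ _ _ A0 NE.
by rewrite /A; lra.
Qed.

(** [hf_X] and [hf_Y] symmetrise the principal part: up to lower order terms
    [X' = - i rho b X + i rho al Y] and [Y' = - i rho b Y + i rho al X], where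
    [al ^ 2 = a + b ^ 2]. *)
Definition hf_X (rho b : R) (U V : C) : C := (V + Ci * RtoC (rho * b) * U)%C.
Definition hf_Y (rho al : R) (U : C) : C := (Ci * RtoC (rho * al) * U)%C.

Lemma hf_remainders (rho l t b db al dal eps tau m : R) (c g h U V delta : C) :
  0 < t -> 0 < rho -> 0 < al -> Rabs b <= al ->
  Cmod (RtoC (/ al) * (RtoC (l * b) - c) - delta)%C <= eps ->
  Rabs (db / al) <= tau -> Rabs (dal / al) <= tau ->
  Cmod g <= m -> Cmod h <= m ->
  let X := hf_X rho b U V in
  let Y := hf_Y rho al U in
  let V' := (- ((g + 2 * Ci * RtoC (rho * b)) * V
     + (RtoC (rho ^ 2 * (al ^ 2 - b ^ 2)) + Ci * RtoC (rho / t) * c + h) * U))%C in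
  exists R1 R2 : C,
  (V' + (Ci * RtoC (l / t * rho * b + rho * db) * U + Ci * RtoC (rho * b) * V) =
    - (Ci * RtoC (rho * b)) * X + Ci * RtoC (rho * al) * Y + (delta * RtoC (/ t) * Y + R1))%C /\
  (Ci * RtoC (l / t * rho * al + rho * dal) * U + Ci * RtoC (rho * al) * V =
    - (Ci * RtoC (rho * b)) * Y + Ci * RtoC (rho * al) * X + (RtoC (l / t) * Y + R2))%C /\
  Cmod R1 <= (eps / t + tau + 2 * m + m / (rho * al)) * sqrt (modN X Y) /\
  Cmod R2 <= tau * sqrt (modN X Y).
Proof.
move=> t0 rho0 al0 bal heps hdb hdal hg hh X Y V'.
exists ((RtoC (/ al) * (RtoC (l * b) - c) - delta) * RtoC (/ t) * Y + RtoC (db / al) * Y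
   - g * (X - RtoC (b / al) * Y) + Ci * h * RtoC (/ (rho * al)) * Y)%C.
exists (RtoC (dal / al) * Y)%C.
have sg0 : 0 < rho * al by exact: Rmult_lt_0_compat.
split.
  rewrite /V' /X /Y /hf_X /hf_Y; case: c g h U V delta {V' X Y heps hg hh} =>
    [c1 c2] [g1 g2] [h1 h2] [u1 u2] [v1 v2] [d1 d2].
  rewrite /Cminus /Cplus /Cmult /Copp /RtoC /Ci /=; congr pair; field; lra.
split.
  rewrite /V' /X /Y /hf_X /hf_Y; case: c g h U V delta {V' X Y heps hg hh} =>
    [c1 c2] [g1 g2] [h1 h2] [u1 u2] [v1 v2] [d1 d2].
  rewrite /Cminus /Cplus /Cmult /Copp /RtoC /Ci /=; congr pair; field; lra.
clearbody X Y; clear V'.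
have [n1 [n2 _]] := modN_bounds X Y.
set n := sqrt (modN X Y) in n1 n2 *.
have n0 : 0 <= n by exact: sqrt_pos.
have it : 0 < / t by exact: Rinv_0_lt_compat.
have isg : 0 < / (rho * al) by exact: Rinv_0_lt_compat.
have pY := Cmod_ge_0 Y; have pX := Cmod_ge_0 X.
have m0 : 0 <= m by apply: Rle_trans hg; exact: Cmod_ge_0.
split; last first.
  rewrite Cmod_mult Cmod_R.
  by apply: Rmult_le_compat => //; exact: Rabs_pos.
set Z := (RtoC (/ al) * _ - delta)%C in heps *; clearbody Z.
have h1 : Cmod (Z * RtoC (/ t) * Y) <= eps / t * n.
  rewrite !Cmod_mult Cmod_R (Rabs_right (/ t)); last lra.
  apply: Rmult_le_compat => //; first by apply: Rmult_le_pos; [exact: Cmod_ge_0 | lra].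
  by rewrite /Rdiv; apply: Rmult_le_compat_r => //; lra.
have h2 : Cmod (RtoC (db / al) * Y) <= tau * n.
  by rewrite Cmod_mult Cmod_R; apply: Rmult_le_compat => //; exact: Rabs_pos.
have h3 : Cmod (g * (X - RtoC (b / al) * Y)) <= m * (2 * n).
  rewrite Cmod_mult; apply: Rmult_le_compat => //; try exact: Cmod_ge_0.
  apply: Rle_trans (Cmod_triangle _ _) _; rewrite Cmod_opp Cmod_mult Cmod_R.
  have q : Rabs (b / al) <= 1.
    rewrite /Rdiv Rabs_mult (Rabs_right (/ al)); last first.
      by apply: Rle_ge; apply: Rlt_le; exact: Rinv_0_lt_compat.
    by apply: (Rmult_le_reg_r al) => //; rewrite Rmult_assoc Rinv_l; lra.
  have := Rmult_le_compat _ _ _ _ (Rabs_pos (b / al)) pY q n2; lra.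
have h4 : Cmod (Ci * h * RtoC (/ (rho * al)) * Y) <= m / (rho * al) * n.
  rewrite !Cmod_mult Cmod_Ci Rmult_1_l Cmod_R (Rabs_right (/ (rho * al))); last lra.
  apply: Rmult_le_compat => //; first by apply: Rmult_le_pos; [exact: Cmod_ge_0 | lra].
  by rewrite /Rdiv; apply: Rmult_le_compat_r => //; lra.
apply: Rle_trans (Cmod_triangle _ _) _.
apply: (Rle_trans _ (Cmod (Z * RtoC (/ t) * Y) + Cmod (RtoC (db / al) * Y)
  + Cmod (g * (X - RtoC (b / al) * Y)) + m / (rho * al) * n)).
  apply: Rplus_le_compat => //.
  apply: Rle_trans (Cmod_triangle _ _) _; rewrite Cmod_opp.
  by apply: Rplus_le_compat_r; exact: Cmod_triangle.
lra.
Qed.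

Lemma is_derive_Ci_scal (f : R -> R) (u : R -> C) (t df : R) (du : C) :
  is_derive f t df -> is_derive_C u t du ->
  is_derive_C (fun s => (Ci * RtoC (f s) * u s)%C) t
    (Ci * RtoC df * u t + Ci * RtoC (f t) * du)%C.
Proof.
move=> Df Du.
have d1 := is_derive_fst _ _ _ Du; have d2 := is_derive_snd _ _ _ Du.
apply: (is_derive_ext (fun s => (- (f s * snd (u s)), f s * fst (u s)) : C)).
  by move=> s; rewrite /Cmult /Ci /RtoC /=; congr pair; ring.
have -> : (Ci * RtoC df * u t + Ci * RtoC (f t) * du)%C =
   (- (df * snd (u t) + f t * snd du), df * fst (u t) + f t * fst du).
  by case: (u t) du {Du d1 d2} => [x y] [z w]; rewrite /Cmult /Cplus /Ci /RtoC /=; congr pair; ring.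
move: d1 d2; set u1 := fun s => fst (u s); set u2 := fun s => snd (u s) => d1 d2.
rewrite -/(u1 t) -/(u2 t).
have mul (w : R -> R) (dw : R) : is_derive w t dw -> is_derive (fun s => f s * w s) t (df * w t + f t * dw).
  move=> Dw; auto_derive; first by split; [exists df | split; [exists dw | ]].
  by rewrite (is_derive_unique _ _ _ Df) (is_derive_unique _ _ _ Dw); ring.
apply: is_derive_pair; last exact: mul.
by apply: (is_derive_opp (fun s => f s * u2 s)); exact: mul.
Qed.

Lemma is_derive_corrected (kap : R -> R) (d2 l t : R) (X Y : R -> C) (X' Y' : C) :
  0 < t -> is_derive kap t (- ((l + 1) * kap t / t)) -> is_derive_C X t X' -> is_derive_C Y t Y' ->
  is_derive (fun s => corrected (kap s) d2 l (X s) (Y s)) t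
    (corrected_deriv (kap t) d2 l t (X t) (Y t) X' Y').
Proof.
move=> t0 Dk DX DY.
have a1 := is_derive_fst _ _ _ DX; have a2 := is_derive_snd _ _ _ DX.
have a3 := is_derive_fst _ _ _ DY; have a4 := is_derive_snd _ _ _ DY.
rewrite /corrected_deriv /modD !Cmod_sqr /dot /cross.
move: a1 a2 a3 a4; set x1 := fun s => fst (X s); set x2 := fun s => snd (X s).
set y1 := fun s => fst (Y s); set y2 := fun s => snd (Y s) => a1 a2 a3 a4.
apply: (is_derive_ext (fun s => x1 s ^ 2 + x2 s ^ 2 + (y1 s ^ 2 + y2 s ^ 2)
  - kap s * (d2 / 2 * (x1 s ^ 2 + x2 s ^ 2 - (y1 s ^ 2 + y2 s ^ 2)) + l * (x2 s * y1 s - x1 s * y2 s)))).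
  by move=> s; rewrite /corrected /modN /modD !Cmod_sqr.
rewrite -/(x1 t) -/(x2 t) -/(y1 t) -/(y2 t); clearbody x1 x2 y1 y2.
auto_derive; first by do ![split]; eexists; eauto.
rewrite (is_derive_unique _ _ _ a1) (is_derive_unique _ _ _ a2) (is_derive_unique _ _ _ a3)
  (is_derive_unique _ _ _ a4) (is_derive_unique _ _ _ Dk) /=; field; lra.
Qed.

Lemma continuous_corrected (kap : R -> R) (d2 l t : R) (X Y : R -> C) :
  continuous kap t -> continuous_C X t -> continuous_C Y t ->
  continuous (fun s => corrected (kap s) d2 l (X s) (Y s)) t.
Proof.
move=> ck cX cY.
have a1 := continuous_fst_C _ _ cX; have a2 := continuous_snd_C _ _ cX.
have a3 := continuous_fst_C _ _ cY; have a4 := continuous_snd_C _ _ cY.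
move: a1 a2 a3 a4; set x1 := fun s => fst (X s); set x2 := fun s => snd (X s).
set y1 := fun s => fst (Y s); set y2 := fun s => snd (Y s) => a1 a2 a3 a4.
have mul (f g : R -> R) : continuous f t -> continuous g t -> continuous (fun s => f s * g s) t.
  exact: continuous_mult.
have add (f g : R -> R) : continuous f t -> continuous g t -> continuous (fun s => f s + g s) t.
  exact: (continuous_plus (V := R_NormedModule)).
have sub (f g : R -> R) : continuous f t -> continuous g t -> continuous (fun s => f s - g s) t.
  exact: (continuous_minus (V := R_NormedModule)).
have cst (z : R) : continuous (fun=> z) t by exact: continuous_const.
apply: (continuous_ext (fun s => x1 s * x1 s + x2 s * x2 s + (y1 s * y1 s + y2 s * y2 s)
  - kap s * (d2 / 2 * (x1 s * x1 s + x2 s * x2 s - (y1 s * y1 s + y2 s * y2 s)) + l * (x2 s * y1 s - x1 s * y2 s)))).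
  by move=> s; rewrite /corrected /modN /modD !Cmod_sqr /cross /x1 /x2 /y1 /y2 /=; ring.
apply: (sub); first by apply: (add); apply: (add); apply: (mul).
apply: (mul) => //; apply: (add); apply: (mul) => //.
  by apply: (sub); apply: (add); apply: (mul).
by apply: (sub); apply: (mul).
Qed.

Lemma continuous_Ci_scal (f : R -> R) (u : R -> C) (t : R) :
  continuous f t -> continuous_C u t -> continuous_C (fun s => (Ci * RtoC (f s) * u s)%C) t.
Proof.
move=> cf cu; apply: (continuous_ext (fun s => (- (f s * snd (u s)), f s * fst (u s)) : C)).
  by move=> s; rewrite /Cmult /Ci /RtoC /=; congr pair; ring.
apply: continuous_C_pair => /=.
  apply: (continuous_opp (fun s => f s * snd (u s))).
  by apply: (continuous_mult f); [|exact: continuous_snd_C].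
by apply: (continuous_mult f); [|exact: continuous_fst_C].
Qed.

(** * Uniform estimates in the high-frequency zone *)

Definition rho (ell : nat) (r t : R) : R := t ^ ell * r.

Definition wave_P (ell : nat) (r : R) (b : R -> R) (g : R -> C) (t : R) : C :=
  (g t + 2 * Ci * RtoC (rho ell r t * b t))%C.

Definition wave_Q (ell : nat) (r : R) (a : R -> R) (c h : R -> C) (t : R) : C :=
  (RtoC (rho ell r t ^ 2 * a t) + Ci * RtoC (rho ell r t / t) * c t + h t)%C.

(** The coefficients of one frequency direction, [g] and [h] standing for the regular
    quotients of the equation; only the listed constants enter the estimates, which makes
    them uniform in the direction. *)
Record symbols (T beta lam M nu : R) (ell : nat) (a b da db : R -> R) (c g h : R -> C)
    (a0 b0 : R) (c0 : C) : Prop := {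
  sym_da : forall t, 0 < t < T -> is_derive a t (da t);
  sym_db : forall t, 0 < t < T -> is_derive b t (db t);
  sym_ca : forall t, 0 < t -> continuous a t;
  sym_cb : forall t, 0 < t -> continuous b t;
  sym_a0 : forall t, 0 < t <= T -> Rabs (a t - a0) <= M * Rpower t beta;
  sym_b0 : forall t, 0 < t <= T -> Rabs (b t - b0) <= M * Rpower t beta;
  sym_c0 : forall t, 0 < t <= T -> Cmod (c t - c0)%C <= M * Rpower t beta;
  sym_bda : forall t, 0 < t < T -> Rabs (da t) <= M * Rpower t (beta - 1);
  sym_bdb : forall t, 0 < t < T -> Rabs (db t) <= M * Rpower t (beta - 1);
  sym_ba : forall t, 0 < t <= T -> Rabs (a t) <= M;
  sym_low : forall t, 0 < t <= T -> lam <= a t;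
  sym_low0 : lam <= a0;
  sym_bb : forall t, 0 < t <= T -> Rabs (b t) <= M;
  sym_bb0 : Rabs b0 <= M;
  sym_bc0 : Cmod c0 <= M;
  sym_bg : forall t, 0 < t <= T -> Cmod (g t) <= M;
  sym_bh : forall t, 0 < t <= T -> Cmod (h t) <= M;
  sym_nu : Rabs (fst (c0 - RtoC (INR ell * b0))%C) <= 2 * nu * sqrt (a0 + b0 ^ 2) }.

Lemma Rpower_div (t beta : R) : 0 < t -> Rpower t beta / t = Rpower t (beta - 1).
Proof.
move=> t0; rewrite /Rminus Rpower_plus Rpower_Ropp Rpower_1 //.
Qed.

Lemma Rpower_gt0 (t beta : R) : 0 < Rpower t beta.
Proof. exact: exp_pos. Qed.

Lemma sqrt_symbol (q a b : R) : 0 < q -> q ^ 2 <= a ->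
  q <= sqrt (a + b ^ 2) /\ Rabs b <= sqrt (a + b ^ 2) /\ sqrt (a + b ^ 2) ^ 2 = a + b ^ 2.
Proof.
move=> q0 qa; have b2 := pow2_ge_0 b; have q2 := pow2_ge_0 q; split.
  by rewrite -{1}(sqrt_pow2 q); [apply: sqrt_le_1_alt; lra | lra].
split; last by rewrite pow2_sqrt //; lra.
by rewrite -sqrt_Rsqr_abs; apply: sqrt_le_1_alt; rewrite /Rsqr; lra.
Qed.

Lemma sqrt_symbol_lip (q M w a b a0 b0 : R) : 0 < q -> q ^ 2 <= a -> q ^ 2 <= a0 ->
  Rabs b <= M -> Rabs b0 <= M -> Rabs (a - a0) <= M * w -> Rabs (b - b0) <= M * w -> 0 <= w ->
  Rabs (sqrt (a + b ^ 2) - sqrt (a0 + b0 ^ 2)) <= M * (1 + 2 * M) / q * w.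
Proof.
move=> q0 qa qa0 bM b0M ha hb w0.
have [h1 [_ h2]] := sqrt_symbol q a b q0 qa.
have [h3 [_ h4]] := sqrt_symbol q a0 b0 q0 qa0.
set x := sqrt (a + b ^ 2) in h1 h2 *; set y := sqrt (a0 + b0 ^ 2) in h3 h4 *.
have id : (x - y) * (x + y) = (a - a0) + (b - b0) * (b + b0).
  have -> : (x - y) * (x + y) = x ^ 2 - y ^ 2 by ring.
  by rewrite h2 h4; ring.
have h5 : Rabs ((x - y) * (x + y)) <= M * (1 + 2 * M) * w.
  rewrite id; apply: Rle_trans (Rabs_triang _ _) _; rewrite Rabs_mult.
  have h6 : Rabs (b + b0) <= 2 * M by apply: Rle_trans (Rabs_triang _ _) _; lra.
  have := Rmult_le_compat _ _ _ _ (Rabs_pos _) (Rabs_pos _) hb h6; lra.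
rewrite Rabs_mult (Rabs_right (x + y)) in h5; last lra.
apply: (Rmult_le_reg_r q) => //.
have -> : M * (1 + 2 * M) / q * w * q = M * (1 + 2 * M) * w by field; lra.
apply: Rle_trans h5; apply: Rmult_le_compat_l; [exact: Rabs_pos | lra].
Qed.

Definition hf_alpha (a b : R -> R) (t : R) : R := sqrt (a t + b t ^ 2).

Definition hf_dalpha (a b da db : R -> R) (t : R) : R :=
  (da t + 2 * b t * db t) / (2 * hf_alpha a b t).

(** The coupling of [X] to [Y] at order [1 / t], frozen at [t = 0]. Its real part makes the
    energy grow or decay like a power of [t]; its imaginary part is oscillatory. *)
Definition hf_delta (ell : nat) (a0 b0 : R) (c0 : C) : C :=
  (RtoC (/ sqrt (a0 + b0 ^ 2)) * (RtoC (INR ell * b0) - c0))%C.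

(** The weight of the correction, chosen so that [hf_kap * rho * alpha] is [1 / t] when
    [alpha] is replaced by its value at 0; freezing [alpha] keeps it a pure power of [t]. *)
Definition hf_kap (ell : nat) (r a0 b0 t : R) : R :=
  / (r * sqrt (a0 + b0 ^ 2) * t ^ S ell).

Lemma is_derive_hf_alpha (a b da db : R -> R) (t : R) :
  is_derive a t (da t) -> is_derive b t (db t) -> 0 < a t ->
  is_derive (hf_alpha a b) t (hf_dalpha a b da db t).
Proof.
move=> Da Db a0; have p : 0 < a t + b t ^ 2 by have := pow2_ge_0 (b t); lra.
have s0 := sqrt_lt_R0 _ p.
rewrite /hf_alpha /hf_dalpha /hf_alpha; auto_derive.
  split; first by exists (da t).
  split; first by exists (db t).
  by rewrite /= Rmult_1_r in p *.
by rewrite (is_derive_unique _ _ _ Da) (is_derive_unique _ _ _ Db) /= !Rmult_1_r; field;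
  rewrite /= Rmult_1_r in s0; lra.
Qed.

Lemma is_derive_rho (ell : nat) (r t : R) : 0 < t ->
  is_derive (rho ell r) t (INR ell / t * rho ell r t).
Proof.
move=> t0; rewrite /rho; auto_derive => //.
case: ell => [|e]; first by rewrite /=; field; lra.
by move: (INR e.+1) => x /=; field; lra.
Qed.

Lemma is_derive_hf_kap (ell : nat) (r a0 b0 t : R) : 0 < t -> 0 < r -> 0 < a0 ->
  is_derive (hf_kap ell r a0 b0) t (- ((INR ell + 1) * hf_kap ell r a0 b0 t / t)).
Proof.
move=> t0 r0 a00; have p : 0 < a0 + b0 ^ 2 by have := pow2_ge_0 b0; lra.
have s0 := sqrt_lt_R0 _ p; have e0 := pow_lt t ell t0.
rewrite /hf_kap; set s := sqrt _ in s0 *.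
have nz : r * s * t ^ S ell <> 0 by rewrite /=; do !apply: Rmult_integral_contrapositive_currified; lra.
auto_derive => //.
by rewrite -/(INR (S ell)) S_INR /=; field; lra.
Qed.

Lemma continuous_hf_alpha (a b : R -> R) (t : R) :
  continuous a t -> continuous b t -> 0 < a t -> continuous (hf_alpha a b) t.
Proof.
move=> ca cb a0; have p : 0 < a t + b t ^ 2 by have := pow2_ge_0 (b t); lra.
apply: (continuous_comp (fun s => a s + b s ^ 2) sqrt).
  apply: (continuous_plus a) => //.
  apply: (continuous_ext (fun s => b s * b s)); first by move=> s /=; ring.
  exact: (continuous_mult b b).
exact: continuous_sqrt.
Qed.

(** Freezing the coefficients at 0 costs [O(t ^ beta)], hence [O(t ^ (beta - 1))] after
    division by [t] or differentiation, which is integrable at 0. Ellipticity enters through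
    [alpha >= sqrt lam], which bounds all the denominators. *)
Lemma symbols_pointwise (T beta lam M : R) (ell : nat) : 0 < lam -> 0 <= M ->
  exists K, 0 < K /\ forall nu a b da db c g h a0 b0 c0,
  symbols T beta lam M nu ell a b da db c g h a0 b0 c0 ->
  Cmod (hf_delta ell a0 b0 c0) <= K /\
  forall t, 0 < t < T ->
    Cmod (RtoC (/ hf_alpha a b t) * (RtoC (INR ell * b t) - c t) - hf_delta ell a0 b0 c0)%C
      <= K * Rpower t beta /\
    Rabs (db t / hf_alpha a b t) <= K * Rpower t (beta - 1) /\
    Rabs (hf_dalpha a b da db t / hf_alpha a b t) <= K * Rpower t (beta - 1) /\
    Rabs (hf_alpha a b t / sqrt (a0 + b0 ^ 2) - 1) <= K * Rpower t beta.
Proof.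
move=> lam0 M0.
pose q := sqrt lam; have q0 : 0 < q by exact: sqrt_lt_R0.
have q2 : q ^ 2 = lam by rewrite pow2_sqrt //; lra.
pose l := INR ell; have l0 : 0 <= l by exact: pos_INR.
have iq : 0 < / q by exact: Rinv_0_lt_compat.
pose A1 := M * (1 + 2 * M) / q.
have A10 : 0 <= A1 by apply: Rmult_le_pos; [nra | lra].
pose A2 := (l + 1) * M / q; have A20 : 0 <= A2 by apply: Rmult_le_pos; [nra | lra].
pose A3 := A1 / q; have A30 : 0 <= A3 by apply: Rmult_le_pos; lra.
pose A4 := M / q; have A40 : 0 <= A4 by apply: Rmult_le_pos; lra.
have A23 : 0 <= A2 * A3 by apply: Rmult_le_pos.
exists (1 + A1 + A2 + A3 + A4 + A2 * A3); split; first lra.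
move=> nu a b da db c g h a0 b0 c0 S.
have [s1 [s2 s3]] := sqrt_symbol q a0 b0 q0 ltac:(rewrite q2; exact: sym_low0 S).
set al0 := sqrt (a0 + b0 ^ 2) in s1 s2 s3 *.
have inv_le x : q <= x -> 0 < / x <= / q.
  by move=> qx; split; [apply: Rinv_0_lt_compat; lra | apply: Rinv_le_contravar].
have lbc (x : R) (z : C) (w : R) : Rabs x <= w -> Cmod z <= w ->
    Cmod (RtoC (l * x) - z)%C <= (l + 1) * w.
  move=> hx hz; apply: Rle_trans (Cmod_triangle _ _) _.
  rewrite Cmod_opp Cmod_R Rabs_mult (Rabs_right l); last lra.
  by have := Rmult_le_compat_l _ _ _ l0 hx; lra.
have dl : Cmod (RtoC (/ al0) * (RtoC (l * b0) - c0))%C <= A2.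
  rewrite Cmod_mult Cmod_R Rabs_right; last by have := inv_le _ s1; lra.
  have -> : A2 = / q * ((l + 1) * M) by rewrite /A2 /Rdiv; ring.
  apply: Rmult_le_compat; [have := inv_le _ s1; lra | exact: Cmod_ge_0 | have := inv_le _ s1; lra |].
  by apply: lbc; [exact: sym_bb0 S | exact: sym_bc0 S].
split; first by rewrite /hf_delta -/l -/al0; lra.
move=> t tT; have tT' : 0 < t <= T by lra.
have [r1 [r2 r3]] := sqrt_symbol q (a t) (b t) q0 ltac:(rewrite q2; exact: sym_low S t tT').
have w0 := Rpower_gt0 t beta; have tau0 := Rpower_gt0 t (beta - 1).
have lip : Rabs (hf_alpha a b t - al0) <= A1 * Rpower t beta.
  apply: sqrt_symbol_lip => //; first by rewrite q2; exact: sym_low S t tT'.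
  - by rewrite q2; exact: sym_low0 S.
  - exact: sym_bb S t tT'.
  - exact: sym_bb0 S.
  - exact: sym_a0 S t tT'.
  - exact: sym_b0 S t tT'.
  - lra.
rewrite -/(hf_alpha a b t) in r1 r2 r3.
set al := hf_alpha a b t in r1 r2 r3 lip *.
set w := Rpower t beta in w0 lip *; set tau := Rpower t (beta - 1) in tau0 *.
have ial := inv_le _ r1; have ial0 := inv_le _ s1.
have enl x y z : 0 < z -> x <= y * z -> y <= 1 + A1 + A2 + A3 + A4 + A2 * A3 ->
    x <= (1 + A1 + A2 + A3 + A4 + A2 * A3) * z.
  by move=> z0 h1 h2; apply: Rle_trans h1 _; apply: Rmult_le_compat_r; lra.
have ratio : Rabs (al / al0 - 1) <= A3 * w.
  have -> : al / al0 - 1 = (al - al0) * / al0 by field; lra.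
  rewrite Rabs_mult (Rabs_right (/ al0)); last lra.
  have -> : A3 * w = A1 * w * / q by rewrite /A3 /Rdiv; ring.
  by apply: Rmult_le_compat; try exact: Rabs_pos; lra.
have bdb := sym_bdb _ _ _ _ _ _ _ _ _ _ _ _ _ _ _ _ S t tT.
have bda := sym_bda _ _ _ _ _ _ _ _ _ _ _ _ _ _ _ _ S t tT.
have bbt := sym_bb _ _ _ _ _ _ _ _ _ _ _ _ _ _ _ _ S t tT'.
rewrite -/tau in bdb bda.
split.
  apply: (enl _ (A2 + A2 * A3)) => //; last lra.
  rewrite /hf_delta -/l -/al0.
  have -> : (RtoC (/ al) * (RtoC (l * b t) - c t) - RtoC (/ al0) * (RtoC (l * b0) - c0))%C =
    (RtoC (/ al) * (RtoC (l * (b t - b0)) - (c t - c0))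
     + RtoC (/ al * (1 - al / al0)) * (RtoC (l * b0) - c0))%C.
    have -> : / al * (1 - al / al0) = / al - / al0 by field; lra.
    have -> : RtoC (l * (b t - b0)) = (RtoC (l * b t) - RtoC (l * b0))%C.
      by rewrite -RtoC_minus; congr RtoC; ring.
    by rewrite RtoC_minus; ring.
  apply: Rle_trans (Cmod_triangle _ _) _; rewrite !Cmod_mult !Cmod_R.
  have h1 : Rabs (/ al) * Cmod (RtoC (l * (b t - b0)) - (c t - c0))%C <= A2 * w.
    rewrite Rabs_right; last lra.
    have -> : A2 * w = / q * ((l + 1) * (M * w)) by rewrite /A2 /Rdiv; ring.
    apply: Rmult_le_compat; [lra | exact: Cmod_ge_0 | lra |].
    by apply: lbc; [exact: sym_b0 S t tT' | exact: sym_c0 S t tT'].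
  have h2 : Rabs (/ al * (1 - al / al0)) * Cmod (RtoC (l * b0) - c0)%C <= A2 * A3 * w.
    rewrite Rabs_mult (Rabs_right (/ al)); last lra.
    rewrite -(Rabs_Ropp (1 - _)) Ropp_minus_distr.
    have -> : A2 * A3 * w = / q * (A3 * w) * ((l + 1) * M) by rewrite /A2 /Rdiv; ring.
    have a3w : 0 <= A3 * w by apply: Rmult_le_pos; lra.
    apply: Rmult_le_compat.
    - by apply: Rmult_le_pos; [lra | exact: Rabs_pos].
    - exact: Cmod_ge_0.
    - by apply: Rmult_le_compat => //; [lra | exact: Rabs_pos | lra].
    - by apply: lbc; [exact: sym_bb0 S | exact: sym_bc0 S].
  lra.
split.
  apply: (enl _ A4) => //; last lra.
  rewrite /Rdiv Rabs_mult (Rabs_right (/ al)); last lra.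
  have -> : A4 * tau = M * tau * / q by rewrite /A4 /Rdiv; ring.
  by apply: Rmult_le_compat; try exact: Rabs_pos; lra.
split; last by apply: (enl _ A3) => //; lra.
apply: (enl _ A3) => //; last lra.
rewrite /hf_dalpha -/al.
have -> : (da t + 2 * b t * db t) / (2 * al) / al = (da t + 2 * (b t * db t)) * (/ 2 * / al) * / al.
  by field; lra.
have hal : Rabs (/ 2 * / al) = / 2 * / al by apply: Rabs_right; lra.
rewrite (Rabs_mult _ (/ al)) (Rabs_mult _ (/ 2 * / al)) hal (Rabs_right (/ al)); last lra.
have h1 : Rabs (da t + 2 * (b t * db t)) <= M * (1 + 2 * M) * tau.
  apply: Rle_trans (Rabs_triang _ _) _; rewrite (Rabs_mult 2) (Rabs_right 2); last lra.
  have := Rmult_le_compat _ _ _ _ (Rabs_pos _) (Rabs_pos _) bbt bdb; rewrite -Rabs_mult.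
  lra.
have -> : A3 * tau = M * (1 + 2 * M) * tau * / q * / q by rewrite /A3 /A1 /Rdiv; ring.
apply: Rmult_le_compat; [|lra| |lra].
  by apply: Rmult_le_pos; [exact: Rabs_pos | apply: Rmult_le_pos; lra].
by apply: Rmult_le_compat => //; [exact: Rabs_pos | apply: Rmult_le_pos; lra | lra].
Qed.

Lemma hf_kap_bound (ell : nat) (q r a0 b0 t Z : R) :
  0 < q -> q ^ 2 <= a0 -> 0 < r -> 0 < t -> 0 < Z -> Z <= r * t ^ S ell ->
  0 < hf_kap ell r a0 b0 t /\ hf_kap ell r a0 b0 t <= / q * / Z /\
  hf_kap ell r a0 b0 t <= / q * / (r * t ^ S ell).
Proof.
move=> q0 qa r0 t0 Z0 hZ; have [h1 _] := sqrt_symbol q a0 b0 q0 qa.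
have e0 := pow_lt t (S ell) t0.
have re : 0 < r * t ^ S ell by exact: Rmult_lt_0_compat.
have -> : hf_kap ell r a0 b0 t = / sqrt (a0 + b0 ^ 2) * / (r * t ^ S ell).
  by rewrite /hf_kap; field; lra.
have i1 : 0 < / sqrt (a0 + b0 ^ 2) by apply: Rinv_0_lt_compat; lra.
have i2 : / sqrt (a0 + b0 ^ 2) <= / q by apply: Rinv_le_contravar.
have i3 : 0 < / (r * t ^ S ell) by exact: Rinv_0_lt_compat.
have i4 : / (r * t ^ S ell) <= / Z by apply: Rinv_le_contravar.
split; first exact: Rmult_lt_0_compat.
by split; apply: Rmult_le_compat; lra.
Qed.

(** The change of unknowns is bounded with bounded inverse because [|b| <= alpha] and
    [alpha] lies between two positive constants. *)
Lemma hf_modN_energy (M q r rh a b : R) (U V : C) :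
  0 < q -> q ^ 2 <= a -> a <= M -> Rabs b <= M -> 0 < rh ->
  let al := sqrt (a + b ^ 2) in
  modN (hf_X rh b U V) (hf_Y rh al U) <= (2 + 3 * (M + M ^ 2)) * energy rh U V /\
  energy rh U V <= (2 + / q ^ 2) * modN (hf_X rh b U V) (hf_Y rh al U).
Proof.
move=> q0 qa aM bM rh0 al.
have [h1 [h2 h3]] := sqrt_symbol q a b q0 qa; rewrite -/al in h1 h2 h3.
have M0 : 0 <= M by apply: Rle_trans bM; exact: Rabs_pos.
have b2 : b ^ 2 <= M ^ 2 by rewrite -(pow2_abs b); apply: pow_incr; split => //; exact: Rabs_pos.
have cY : Cmod (hf_Y rh al U) = rh * al * Cmod U.
  rewrite /hf_Y !Cmod_mult Cmod_Ci Cmod_R Rmult_1_l Rabs_right //.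
  by apply: Rle_ge; apply: Rmult_le_pos; lra.
have cB : Cmod (Ci * RtoC (rh * b) * U)%C <= Cmod (hf_Y rh al U).
  rewrite cY !Cmod_mult Cmod_Ci Cmod_R Rmult_1_l Rabs_mult (Rabs_right rh); last lra.
  apply: Rmult_le_compat_r; first exact: Cmod_ge_0.
  by apply: Rmult_le_compat_l; lra.
have cX : Cmod (hf_X rh b U V) <= Cmod V + Cmod (hf_Y rh al U).
  by apply: Rle_trans (Cmod_triangle _ _) _; lra.
have cV : Cmod V <= Cmod (hf_X rh b U V) + Cmod (hf_Y rh al U).
  have {1}-> : V = (hf_X rh b U V + - (Ci * RtoC (rh * b) * U))%C by rewrite /hf_X; ring.
  by apply: Rle_trans (Cmod_triangle _ _) _; rewrite Cmod_opp; lra.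
have pX := Cmod_ge_0 (hf_X rh b U V); have pY := Cmod_ge_0 (hf_Y rh al U).
have pV := Cmod_ge_0 V; have pU := Cmod_ge_0 U.
have Y2 : Cmod (hf_Y rh al U) ^ 2 = al ^ 2 * (rh ^ 2 * Cmod U ^ 2) by rewrite cY; ring.
have W0 : 0 <= rh ^ 2 * Cmod U ^ 2 by apply: Rmult_le_pos; exact: pow2_ge_0.
have q2 : 0 < q ^ 2 by apply: pow_lt.
have alM : al ^ 2 <= M + M ^ 2 by lra.
have alq : q ^ 2 <= al ^ 2 by have := pow2_ge_0 b; lra.
move: cX cV pX pY Y2; set x := Cmod (hf_X _ _ _ _); set y := Cmod (hf_Y _ _ _) => cX cV pX pY Y2.
set W := rh ^ 2 * Cmod U ^ 2 in W0 Y2.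
rewrite /modN /energy -/x -/y -/W; split.
  have x2 : x ^ 2 <= 2 * Cmod V ^ 2 + 2 * y ^ 2.
    have := pow2_ge_0 (Cmod V - y); have := pow_incr x _ 2 (conj pX cX); lra.
  have y2 : y ^ 2 <= (M + M ^ 2) * W by rewrite Y2; apply: Rmult_le_compat_r.
  have := pow2_ge_0 (Cmod V); have := pow2_ge_0 M; nra.
have v2 : Cmod V ^ 2 <= 2 * x ^ 2 + 2 * y ^ 2.
  have := pow2_ge_0 (x - y); have := pow_incr _ _ 2 (conj pV cV); lra.
have w2 : W <= / q ^ 2 * y ^ 2.
  apply: (Rmult_le_reg_l (q ^ 2)) => //.
  rewrite -Rmult_assoc Rinv_r ?Rmult_1_l; last lra.
  by rewrite Y2; apply: Rmult_le_compat_r.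
have := Rmult_le_pos (/ q ^ 2) (x ^ 2) (Rlt_le _ _ (Rinv_0_lt_compat _ q2)) (pow2_ge_0 x).
lra.
Qed.

(** The corrected energy grows like [t ^ ell] up to the factor [t ^ (2 nu)] and an error
    rate integrable on the zone where [r t ^ (ell + 1)] is large: this is the point where
    [nu], hence the loss of [mu] derivatives, enters. *)
Lemma high_energy (T beta lam M : R) (ell : nat) :
  0 < T -> 0 < lam -> 0 <= M ->
  exists K Z, 0 < K /\ 1 <= Z /\ forall nu a b da db c g h a0 b0 c0,
  symbols T beta lam M nu ell a b da db c g h a0 b0 c0 ->
  forall r u v, 0 < r -> csol T (wave_P ell r b g) (wave_Q ell r a c h) u v ->
  exists E : R -> R,
    (forall t, 0 < t <= T -> continuous E t) /\
    (forall t, 0 < t < T -> Z <= r * t ^ S ell ->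
       exists dE, is_derive E t dE /\
       Rabs (dE - INR ell / t * E t) <=
       (2 * nu / t + K * (Rpower t (beta - 1) + 1 + / (r * t ^ S ell) / t)) * E t) /\
    (forall t, 0 < t <= T -> Z <= r * t ^ S ell ->
       0 <= E t /\ E t <= K * energy (rho ell r t) (u t) (v t) /\
       energy (rho ell r t) (u t) (v t) <= K * E t).
Proof.
move=> T0 lam0 M0.
have [K [K0 HK]] := symbols_pointwise T beta lam M ell lam0 M0.
pose q := sqrt lam; have q0 : 0 < q by exact: sqrt_lt_R0.
have q2 : q ^ 2 = lam by rewrite pow2_sqrt //; lra.
have iq : 0 < / q by exact: Rinv_0_lt_compat.
have iq2 : 0 < / q ^ 2 by apply: Rinv_0_lt_compat; lra.
pose l := INR ell; have l0 : 0 <= l by exact: pos_INR.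
pose m := l + K; have m0 : 0 < m by rewrite /m; lra.
pose Z := Rmax 1 (2 * m * / q).
pose C1 := 4 * m * K + 24 * K.
pose C2 := 24 * M + 12 * M * T * / q.
pose C3 := 22 * m * (m + 1) * / q.
pose C4 := 3 / 2 * (2 + 3 * (M + M ^ 2)).
pose C5 := 2 * (2 + / q ^ 2).
have C10 : 0 < C1 by rewrite /C1; nra.
have C20 : 0 <= C2.
  have := Rmult_le_pos (M * T) (/ q) ltac:(nra) (Rlt_le _ _ iq); rewrite /C2; lra.
have C30 : 0 <= C3.
  have := Rmult_le_pos (m * (m + 1)) (/ q) ltac:(nra) (Rlt_le _ _ iq); rewrite /C3; lra.
have C40 : 0 <= C4 by rewrite /C4; have := pow2_ge_0 M; nra.
have C50 : 0 <= C5 by rewrite /C5; lra.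
have Z1 : 1 <= Z by exact: Rmax_l.
have Z2 : 2 * m * / q <= Z by exact: Rmax_r.
exists (C1 + C2 + C3 + C4 + C5), Z; split; first lra; split=> //.
move=> nu a b da db c g h a0 b0 c0 Sy r u v r0 [Cs Ds].
have [hdl hpt] := HK _ _ _ _ _ _ _ _ _ _ _ Sy.
set dl := hf_delta ell a0 b0 c0 in hdl hpt.
set al0 := sqrt (a0 + b0 ^ 2) in hpt.
have qa0 : q ^ 2 <= a0 by rewrite q2; exact: sym_low0 Sy.
have [s1 [s2 s3]] := sqrt_symbol q a0 b0 q0 qa0; rewrite -/al0 in s1 s2 s3.
pose X t := hf_X (rho ell r t) (b t) (u t) (v t).
pose Y t := hf_Y (rho ell r t) (hf_alpha a b t) (u t).
pose kap := hf_kap ell r a0 b0.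
pose E t := corrected (kap t) (snd dl) l (X t) (Y t).
have qa t : 0 < t <= T -> q ^ 2 <= a t by move=> tT; rewrite q2; exact: sym_low Sy t tT.
have a_gt0 t : 0 < t <= T -> 0 < a t by move=> /qa; lra.
have hk t : 0 < t -> Z <= r * t ^ S ell -> 0 <= kap t /\ m * kap t <= / 2 /\ kap t / t <= / q * (/ (r * t ^ S ell) / t).
  move=> t0 hZ; have [k1 [k2 k3]] := hf_kap_bound ell q r a0 b0 t Z q0 qa0 r0 t0 ltac:(lra) hZ.
  split; first by rewrite /kap; lra.
  split.
    have k4 := Rmult_le_compat_l _ _ _ (Rlt_le _ _ m0) k2.
    apply: Rle_trans k4 _; apply: (Rmult_le_reg_r Z); first lra.
    have -> : m * (/ q * / Z) * Z = m * / q by field; lra.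
    lra.
  have it : 0 < / t by exact: Rinv_0_lt_compat.
  by have := Rmult_le_compat_r _ _ _ (Rlt_le _ _ it) k3; rewrite /kap /Rdiv; lra.
have hd1 : Rabs (fst dl) <= K by apply: Rle_trans hdl; exact: Rabs_fst_Cmod.
have hd2 : Rabs (snd dl) <= K by apply: Rle_trans hdl; exact: Rabs_snd_Cmod.
have hd1nu : Rabs (fst dl) <= 2 * nu.
  have -> : fst dl = - (/ al0 * fst (c0 - RtoC (INR ell * b0))%C).
    by rewrite /dl /hf_delta -/al0; case: (c0) => x y /=; ring.
  rewrite Rabs_Ropp Rabs_mult Rabs_right; last by apply: Rle_ge; apply: Rlt_le; apply: Rinv_0_lt_compat; lra.
  have := sym_nu _ _ _ _ _ _ _ _ _ _ _ _ _ _ _ _ Sy; rewrite -/al0 => hnu.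
  apply: (Rmult_le_reg_l al0); first lra.
  rewrite -Rmult_assoc Rinv_r ?Rmult_1_l; lra.
have lm : 0 <= l <= m by rewrite /m; lra.
have d1m : Rabs (fst dl) <= m by rewrite /m; lra.
have d2m : Rabs (snd dl) <= m by rewrite /m; lra.
have crho t : 0 < t -> continuous (rho ell r) t.
  by move=> t0; apply: ex_derive_continuous; eexists; exact: is_derive_rho.
have Epos t : 0 < t <= T -> Z <= r * t ^ S ell -> 0 <= E t /\ modN (X t) (Y t) <= 2 * E t /\
    E t <= 3 / 2 * modN (X t) (Y t).
  move=> tT hZ; have [k1 [k2 _]] := hk t (proj1 tT) hZ.
  have := corrected_modN (kap t) (snd dl) l m (X t) (Y t) k1 d2m lm.
  rewrite -/(E t) => /Rabs_le_between hE.
  have hN := modN_ge0 (X t) (Y t).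
  by have := Rmult_le_compat_r _ _ _ hN k2; lra.
exists E; split; [|split].
- move=> t tT; have [cu cv] := Cs t tT.
  have ca := sym_ca _ _ _ _ _ _ _ _ _ _ _ _ _ _ _ _ Sy t (proj1 tT).
  have cb := sym_cb _ _ _ _ _ _ _ _ _ _ _ _ _ _ _ _ Sy t (proj1 tT).
  have cr := crho t (proj1 tT).
  apply: continuous_corrected.
  + by apply: ex_derive_continuous; eexists; apply: is_derive_hf_kap => //; [lra | have := sym_low0 _ _ _ _ _ _ _ _ _ _ _ _ _ _ _ _ Sy; lra].
  + apply: (continuous_plus (V := C_R_NormedModule) v) => //.
    apply: (continuous_Ci_scal (fun s => rho ell r s * b s) u) => //.
    exact: (continuous_mult (rho ell r) b).
  + apply: (continuous_Ci_scal (fun s => rho ell r s * hf_alpha a b s) u) => //.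
    apply: (continuous_mult (rho ell r) (hf_alpha a b)) => //.
    by apply: continuous_hf_alpha => //; exact: a_gt0.
- move=> t tT hZ; have t0 := proj1 tT; have tT' : 0 < t <= T by lra.
  have [k1 [k2 k3]] := hk t t0 hZ.
  have [p1 [p2 [p3 p4]]] := hpt t tT.
  have [Du Dv] := Ds t tT.
  have Dr := is_derive_rho ell r t t0.
  have Da := sym_da _ _ _ _ _ _ _ _ _ _ _ _ _ _ _ _ Sy t tT.
  have Db := sym_db _ _ _ _ _ _ _ _ _ _ _ _ _ _ _ _ Sy t tT.
  have Dal := is_derive_hf_alpha a b da db t Da Db (a_gt0 t tT').
  have [r1 [r2 r3]] := sqrt_symbol q (a t) (b t) q0 (qa t tT').
  rewrite -/(hf_alpha a b t) in r1 r2 r3.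
  have e0 := pow_lt t ell t0.
  have rh0 : 0 < rho ell r t by apply: Rmult_lt_0_compat.
  have it : 0 < / t by exact: Rinv_0_lt_compat.
  have rht : / t <= rho ell r t.
    apply: (Rmult_le_reg_r t) => //; rewrite Rinv_l; last lra.
    have -> : rho ell r t * t = r * t ^ S ell by rewrite /rho /=; ring.
    lra.
  set al := hf_alpha a b t in r1 r2 r3 p1 p2 p3 p4 Dal.
  set w := Rpower t beta in p1 p4; set tau := Rpower t (beta - 1) in p2 p3 *.
  have wt : w / t = tau by exact: Rpower_div.
  have w0 : 0 < w by exact: Rpower_gt0.
  have tau0 : 0 < tau by exact: Rpower_gt0.
  have al_gt0 : 0 < al by lra.
  have [R1 [R2 [i1 [i2 [bR1 bR2]]]]] := hf_remainders (rho ell r t) l t (b t) (db t) al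
    (hf_dalpha a b da db t) (K * w) (K * tau) M (c t) (g t) (h t) (u t) (v t) dl
    t0 rh0 al_gt0 r2 p1 p2 p3 (sym_bg _ _ _ _ _ _ _ _ _ _ _ _ _ _ _ _ Sy t tT')
    (sym_bh _ _ _ _ _ _ _ _ _ _ _ _ _ _ _ _ Sy t tT').
  rewrite -/(X t) -/(Y t) in i1 i2 bR1 bR2.
  set eta := K * w / t + _ + _ + _ in bR1.
  have eta_le : eta <= 2 * K * tau + 2 * M + M * T * / q.
    have -> : eta = 2 * K * tau + 2 * M + M * / (rho ell r t * al).
      by rewrite /eta -wt /Rdiv; ring.
    have h1 : / (rho ell r t * al) <= T * / q.
      rewrite Rinv_mult; have j1 : / rho ell r t <= / / t by apply: Rinv_le_contravar.
      rewrite Rinv_inv in j1.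
      have j2 : / al <= / q by apply: Rinv_le_contravar.
      apply: Rmult_le_compat => //; try lra.
        by apply: Rlt_le; exact: Rinv_0_lt_compat.
      by apply: Rlt_le; apply: Rinv_0_lt_compat; lra.
    by have := Rmult_le_compat_l _ _ _ M0 h1; lra.
  have kt0 : 0 <= K * tau by apply: Rmult_le_pos; lra.
  have eta_ge : K * tau <= eta.
    have j1 : 0 <= K * w / t by apply: Rdiv_le_0_compat => //; apply: Rmult_le_pos; lra.
    have j2 : 0 <= M / (rho ell r t * al).
      by apply: Rdiv_le_0_compat => //; apply: Rmult_lt_0_compat; lra.
    by rewrite /eta; lra.
  have bR2' : Cmod R2 <= eta * sqrt (modN (X t) (Y t)).
    by apply: Rle_trans bR2 _; apply: Rmult_le_compat_r => //; exact: sqrt_pos.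
  have Dprod (f : R -> R) (df : R) : is_derive f t df ->
      is_derive (fun s => rho ell r s * f s) t (l / t * rho ell r t * f t + rho ell r t * df).
    move=> Df; auto_derive; first by split; [eexists; exact: Dr | split; [exists df | ]].
    by rewrite (is_derive_unique _ _ _ Df) (is_derive_unique _ _ _ Dr); rewrite /l; ring.
  have DX := is_derive_plus v _ t _ _ Dv (is_derive_Ci_scal _ u t _ _ (Dprod b _ Db) Du).
  have DY := is_derive_Ci_scal _ u t _ _ (Dprod (hf_alpha a b) _ Dal) Du.
  have ev : (- (wave_P ell r b g t * v t + wave_Q ell r a c h t * u t))%C =
    (- ((g t + 2 * Ci * RtoC (rho ell r t * b t)) * v t
     + (RtoC (rho ell r t ^ 2 * (al ^ 2 - b t ^ 2)) + Ci * RtoC (rho ell r t / t) * c t + h t) * u t))%C.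
    by rewrite /wave_P /wave_Q r3; have -> : a t + b t ^ 2 - b t ^ 2 = a t by ring.
  have Dk := is_derive_hf_kap ell r a0 b0 t t0 r0 ltac:(lra).
  rewrite -/al in i2; rewrite -ev in i1.
  have DX' := eq_ind _ (fun z => is_derive_C X t z) DX _ i1.
  have DY' := eq_ind _ (fun z => is_derive_C Y t z) DY _ i2.
  have DE := is_derive_corrected kap (snd dl) l t X Y _ _ t0 Dk DX' DY'.
  eexists; split; first exact: DE.
  have dle : dl = (fst dl, snd dl) by case: (dl).
  have eta0 : 0 <= eta by lra.
  have rate := corrected_rate (kap t) (fst dl) (snd dl) l m t (rho ell r t * al)
    (rho ell r t * b t) eta (X t) (Y t) R1 R2 t0 k1 k2 lm d1m d2m eta0 bR1 bR2'.
  rewrite -dle in rate; rewrite -/l.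
  apply: Rle_trans rate _; apply: Rmult_le_compat_r; first exact: (proj1 (Epos t tT' hZ)).
  set y := / (r * t ^ S ell) / t.
  have y0 : 0 <= y.
    by rewrite /y; apply: Rdiv_le_0_compat => //; apply: Rlt_le; apply: Rinv_0_lt_compat; lra.
  have b1 : Rabs (fst dl) / t <= 2 * nu / t.
    by rewrite /Rdiv; apply: Rmult_le_compat_r; lra.
  have b2 : 4 * m * Rabs (/ t - kap t * (rho ell r t * al)) <= 4 * m * K * tau.
    have -> : / t - kap t * (rho ell r t * al) = - ((al / al0 - 1) * / t).
      by rewrite /kap /hf_kap -/al0 /rho /=; field; lra.
    rewrite Rabs_Ropp Rabs_mult (Rabs_right (/ t)); last lra.
    have := Rmult_le_compat_r _ _ _ (Rlt_le _ _ it) p4.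
    have -> : K * w * / t = K * tau by rewrite -wt /Rdiv; ring.
    by move=> j; have := Rmult_le_compat_l _ _ _ (Rlt_le _ _ m0) j; lra.
  have b3 : 22 * m * (m + 1) * (kap t / t) <= C3 * y.
    have mm : 0 <= 22 * m * (m + 1) by nra.
    by have := Rmult_le_compat_l _ _ _ mm k3; rewrite /C3 /y; lra.
  have b4 : 12 * eta <= 24 * K * tau + C2 by rewrite /C2; lra.
  have b5 : (C1 + C2 + C3 + C4 + C5) * (tau + 1 + y) >= C1 * tau + C2 + C3 * y.
    have := Rmult_le_pos _ _ (Rlt_le _ _ C10) y0; have := Rmult_le_pos _ _ C20 y0.
    have := Rmult_le_pos _ _ C20 (Rlt_le _ _ tau0).
    have := Rmult_le_pos _ _ C30 (Rlt_le _ _ tau0).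
    have := Rmult_le_pos (C4 + C5) (tau + 1 + y) ltac:(lra) ltac:(lra).
    lra.
  have b6 : C1 * tau = 4 * m * K * tau + 24 * K * tau by rewrite /C1; ring.
  lra.
- move=> t tT hZ.
  have rh0 : 0 < rho ell r t by apply: Rmult_lt_0_compat => //; apply: pow_lt; lra.
  have [n1 n2] := hf_modN_energy M q r (rho ell r t) (a t) (b t) (u t) (v t) q0 (qa t tT)
    (Rle_trans _ _ _ (Rle_abs _) (sym_ba _ _ _ _ _ _ _ _ _ _ _ _ _ _ _ _ Sy t tT))
    (sym_bb _ _ _ _ _ _ _ _ _ _ _ _ _ _ _ _ Sy t tT) rh0.
  rewrite -/(hf_alpha a b t) -/(X t) -/(Y t) in n1 n2.
  have [j0 [j3 j4]] := Epos t tT hZ.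
  have e0 := energy_ge0 (rho ell r t) (u t) (v t).
  have j1 : E t <= C4 * energy (rho ell r t) (u t) (v t) by rewrite /C4; lra.
  have j2 : energy (rho ell r t) (u t) (v t) <= C5 * E t.
    have := Rmult_le_compat_l (2 + / q ^ 2) _ _ ltac:(lra) j3; rewrite /C5; lra.
  split=> //; split.
    apply: Rle_trans j1 _; apply: Rmult_le_compat_r => //; lra.
  apply: Rle_trans j2 _; apply: Rmult_le_compat_r => //; lra.
Qed.

(** * Two-sided bounds between a fixed time and time zero *)

Lemma energy_le (x y z : R) (u v : C) :
  1 <= y -> x ^ 2 <= y * z ^ 2 -> energy x u v <= y * energy z u v.
Proof.
move=> y1 h; rewrite /energy.
have pu := pow2_ge_0 (Cmod u); have pv := pow2_ge_0 (Cmod v).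
have h1 := Rmult_le_compat_r _ _ _ pu h.
have h2 := Rmult_le_compat_r _ _ _ pv y1.
lra.
Qed.

(** In [t <= N / k] the coefficients are of the sizes [k] and [k ^ 2] that
    [energy_gronwall] accepts, since [r <= k ^ (ell + 1)]. *)
Lemma low_zone_coefs (M N : R) (ell : nat) : 0 <= M -> 1 <= N -> (0 < ell)%N ->
  exists L, 0 <= L /\ forall r k t (a b : R -> R) (c g h : R -> C),
  0 <= r -> r <= k ^ S ell -> 1 <= k -> 0 < t -> k * t <= N ->
  Rabs (a t) <= M -> Rabs (b t) <= M -> Cmod (c t) <= M -> Cmod (g t) <= M -> Cmod (h t) <= M ->
  Cmod (wave_P ell r b g t) <= L * k /\ Cmod (wave_Q ell r a c h t) <= L * k ^ 2.
Proof.
case: ell => [//|e] M0 N1 _.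
have Ne : 1 <= N ^ e by exact: pow_R1_Rle.
pose n := N * N ^ e.
have n1 : N ^ e <= n by rewrite /n; nra.
exists (M * (1 + 2 * n + n ^ 2)); split; first by apply: Rmult_le_pos => //; nra.
move=> r k t a b c g h r0 rk k1 t0 kt ha hb hc hg hh.
have kte : 0 <= (k * t) ^ e <= N ^ e.
  by split; [apply: pow_le; nra | apply: pow_incr; nra].
have rt : rho e.+1 r t / t <= N ^ e * k ^ 2.
  have -> : rho e.+1 r t / t = t ^ e * r by rewrite /rho /=; field; lra.
  have te : 0 <= t ^ e by apply: pow_le; lra.
  have h1 := Rmult_le_compat_l _ _ _ te rk.
  have e1 : t ^ e * k ^ e.+2 = (k * t) ^ e * k ^ 2 by rewrite Rpow_mult_distr /=; ring.
  rewrite e1 in h1; apply: Rle_trans h1 _.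
  by apply: Rmult_le_compat_r; [exact: pow2_ge_0 | lra].
have rt0 : 0 <= rho e.+1 r t / t.
  have -> : rho e.+1 r t / t = t ^ e * r by rewrite /rho /=; field; lra.
  by apply: Rmult_le_pos => //; apply: pow_le; lra.
have rh0 : 0 <= rho e.+1 r t by apply: Rmult_le_pos => //; apply: pow_le; lra.
have rh : rho e.+1 r t <= n * k.
  have -> : rho e.+1 r t = rho e.+1 r t / t * t by field; lra.
  have h1 := Rmult_le_compat_r _ _ _ (Rlt_le _ _ t0) rt.
  have h2 : N ^ e * k * (k * t) <= N ^ e * k * N by apply: Rmult_le_compat_l => //; nra.
  by rewrite /n; lra.
have n0 : 1 <= n by lra.
have kk : k <= k ^ 2 by nra.
split.
  rewrite /wave_P; apply: Rle_trans (Cmod_triangle _ _) _.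
  rewrite !Cmod_mult Cmod_Ci !Cmod_R (Rabs_right 2); last lra.
  rewrite Rabs_mult (Rabs_right (rho _ _ _)); last lra.
  have h1 := Rmult_le_compat _ _ _ _ rh0 (Rabs_pos _) rh hb.
  have h2 : 0 <= M * n ^ 2 * k by apply: Rmult_le_pos; [apply: Rmult_le_pos => //; exact: pow2_ge_0 | lra].
  have h3 : M * 1 <= M * k by apply: Rmult_le_compat_l.
  lra.
rewrite /wave_Q; apply: Rle_trans (Cmod_triangle _ _) _.
have h0 := Cmod_triangle (RtoC (rho e.+1 r t ^ 2 * a t)) (Ci * RtoC (rho e.+1 r t / t) * c t).
have h1 : Cmod (RtoC (rho e.+1 r t ^ 2 * a t)) <= (n * k) ^ 2 * M.
  rewrite Cmod_R Rabs_mult (Rabs_right (_ ^ 2)); last by apply: Rle_ge; exact: pow2_ge_0.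
  apply: Rmult_le_compat => //; [exact: pow2_ge_0 | exact: Rabs_pos |].
  by apply: pow_incr.
have h2 : Cmod (Ci * RtoC (rho e.+1 r t / t) * c t)%C <= N ^ e * k ^ 2 * M.
  rewrite !Cmod_mult Cmod_Ci Rmult_1_l Cmod_R Rabs_right; last lra.
  by apply: Rmult_le_compat => //; exact: Cmod_ge_0.
have h3 : M * 1 <= M * k ^ 2 by apply: Rmult_le_compat_l => //; lra.
have h4 : N ^ e * (k ^ 2 * M) <= n * (k ^ 2 * M).
  by apply: Rmult_le_compat_r => //; apply: Rmult_le_pos => //; exact: pow2_ge_0.
have h5 : 0 <= n * (k ^ 2 * M) by apply: Rmult_le_pos; [lra | apply: Rmult_le_pos => //; exact: pow2_ge_0].
lra.
Qed.

Lemma Rpower_lower (k A x : R) : 1 <= k <= A -> 1 <= exp (Rabs x * ln A) * Rpower k x.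
Proof.
move=> [k1 kA]; rewrite /Rpower -exp_plus -{1}exp_0; apply: exp_le_exp.
have lk : 0 <= ln k by rewrite -ln_1; apply: ln_le; lra.
have lA : ln k <= ln A by apply: ln_le; lra.
have := Rabs_pos x; have := Rle_abs (- x); rewrite Rabs_Ropp; nra.
Qed.

(** A primitive of the error rate of [high_energy], bounded on the zone
    [r t ^ (ell + 1) >= 1] because [beta > 0]. *)
Definition high_weight (beta K : R) (ell : nat) (r t : R) : R :=
  K * (Rpower t beta / beta + t - / (r * t ^ S ell) / INR (S ell)).

Lemma is_derive_Rpower_l (t beta : R) : 0 < t ->
  is_derive (fun s => Rpower s beta) t (beta * Rpower t (beta - 1)).
Proof. by move=> t0; apply/is_derive_Reals; exact: derivable_pt_lim_power. Qed.

Lemma is_derive_high_weight (beta K : R) (ell : nat) (r t x : R) :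
  0 < beta -> 0 < r -> 0 < t ->
  is_derive (fun s => x * ln s + high_weight beta K ell r s) t
    (x / t + K * (Rpower t (beta - 1) + 1 + / (r * t ^ S ell) / t)).
Proof.
move=> b0 r0 t0; have D := is_derive_Rpower_l t beta t0.
have e0 := pow_lt t ell t0.
have I0 : INR (S ell) <> 0 by have := lt_0_INR (S ell) (PeanoNat.Nat.lt_0_succ ell); lra.
rewrite /high_weight; set f := fun s => Rpower s beta in D.
apply: (is_derive_ext (fun s => x * ln s + K * (f s / beta + s - / (r * s ^ S ell) / INR (S ell)))) => //.
have nz : r * t ^ S ell <> 0 by rewrite /=; do !apply: Rmult_integral_contrapositive_currified; lra.
clearbody f; auto_derive.
  by split=> //; split; [eexists; exact: D | ].
rewrite (is_derive_unique _ _ _ D).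
move: I0; rewrite -/(INR (S ell)); move: (INR (S ell)) => i I0 /=; field; lra.
Qed.

(** The rates [(ell +- 2 nu) / t] integrate to powers of [T / t0], and the error rate to at
    most [W] because [r t0 ^ (ell + 1) >= 1]. *)
Lemma high_zone_gronwall (T beta K nu : R) (ell : nat) (r t0 : R) (E dE : R -> R) :
  0 < beta -> 0 < K -> 0 < r -> 0 < t0 <= T -> 1 <= r * t0 ^ S ell ->
  (forall t, t0 <= t <= T -> continuous E t) ->
  (forall t, t0 < t < T -> is_derive E t (dE t)) ->
  (forall t, t0 < t < T -> Rabs (dE t - INR ell / t * E t) <=
     (2 * nu / t + K * (Rpower t (beta - 1) + 1 + / (r * t ^ S ell) / t)) * E t) ->
  0 <= E t0 -> 0 <= E T ->
  let W := K * (Rpower T beta / beta + T + 1) in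
  E T <= E t0 * exp ((2 * nu + INR ell) * ln (T / t0) + W) /\
  E t0 <= E T * exp ((2 * nu - INR ell) * ln (T / t0) + W).
Proof.
move=> b0 K0 r0 tT hr cE DE rate E0 ET W.
have pos t : t0 <= t -> 0 < t by lra.
have dPhi x t : 0 < t -> is_derive (fun s => x * ln s + high_weight beta K ell r s) t
    (x / t + K * (Rpower t (beta - 1) + 1 + / (r * t ^ S ell) / t)).
  by move=> tp; exact: is_derive_high_weight.
have dPhi' x t : 0 < t -> is_derive (fun s => - (x * ln s + high_weight beta K ell r s)) t
    (- (x / t + K * (Rpower t (beta - 1) + 1 + / (r * t ^ S ell) / t))).
  move=> tp.
  by apply: (is_derive_opp (fun s => x * ln s + high_weight beta K ell r s)); exact: dPhi.
have lnd : ln (T / t0) = ln T - ln t0 by rewrite /Rdiv ln_mult ?ln_Rinv //; try lra; apply: Rinv_0_lt_compat; lra.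
have wW : high_weight beta K ell r T - high_weight beta K ell r t0 <= W.
  rewrite /high_weight /W -Rmult_minus_distr_l; apply: Rmult_le_compat_l; first lra.
  have i1 : 1 <= INR (S ell) by rewrite S_INR; have := pos_INR ell; lra.
  have h1 : 0 <= Rpower t0 beta / beta.
    by apply: Rlt_le; apply: Rdiv_lt_0_compat => //; exact: exp_pos.
  have h2 : 0 <= / (r * T ^ S ell) / INR (S ell).
    apply: Rdiv_le_0_compat; last lra.
    by apply: Rlt_le; apply: Rinv_0_lt_compat; apply: Rmult_lt_0_compat => //; apply: pow_lt; lra.
  have h3 : / (r * t0 ^ S ell) / INR (S ell) <= 1.
    have j1 : / (r * t0 ^ S ell) <= / 1 by apply: Rinv_le_contravar; lra.
    have j2 : / INR (S ell) <= / 1 by apply: Rinv_le_contravar; lra.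
    rewrite Rinv_1 in j1 j2.
    have j3 : 0 < / (r * t0 ^ S ell) by apply: Rinv_0_lt_compat; lra.
    have j4 : 0 < / INR (S ell) by apply: Rinv_0_lt_compat; lra.
    by rewrite /Rdiv; nra.
  lra.
split.
- have h := gronwall_le E (fun s => (2 * nu + INR ell) * ln s + high_weight beta K ell r s) dE _ t0 T
    (proj2 tT) DE (fun x xt => dPhi _ x ltac:(lra)) cE.
  apply: Rle_trans (h _ _) _.
  + by move=> x xt; apply: ex_derive_continuous; eexists; apply: dPhi; lra.
  + move=> x xt; have := rate x xt => /Rabs_le_between; rewrite /Rdiv; lra.
  apply: Rmult_le_compat_l => //; apply: exp_le_exp; rewrite lnd; lra.
- have h := gronwall_ge E (fun s => - ((2 * nu - INR ell) * ln s + high_weight beta K ell r s)) dE _ t0 T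
    (proj2 tT) DE (fun x xt => dPhi' _ x ltac:(lra)) cE.
  set G := (X in E T * exp X).
  have h' : E t0 * exp (- G) <= E T.
    apply: Rle_trans (h _ _).
    + by apply: Rmult_le_compat_l => //; apply: exp_le_exp; rewrite /G lnd; lra.
    + by move=> x xt; apply: ex_derive_continuous; eexists; apply: dPhi'; lra.
    + move=> x xt; have := rate x xt => /Rabs_le_between; rewrite /Rdiv; lra.
  have e1 : exp (- G) * exp G = 1 by rewrite -exp_plus Rplus_opp_l exp_0.
  have -> : E t0 = E t0 * exp (- G) * exp G by rewrite Rmult_assoc e1 Rmult_1_r.
  by apply: Rmult_le_compat_r => //; apply: Rlt_le; exact: exp_pos.
Qed.

(** Constants: [N] separates the zones [k t <= N] and [k t >= N]. At [t = N / k] both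
    energies are comparable, because there [rho] is comparable to [k]; the high zone
    contributes the factors [(T k / N) ^ (2 nu +- ell)]. *)
Lemma frequency_bounds (T beta lam M nu : R) (ell : nat) :
  0 < T -> 0 < beta -> 0 < lam -> 0 <= M -> (0 < ell)%N ->
  exists K, 0 < K /\ forall r k (a b : R -> R) (c g h : R -> C),
  0 <= r -> 1 <= k -> k ^ S ell = sqrt (1 + r ^ 2) ->
  (forall t, 0 < t <= T -> Rabs (a t) <= M /\ Rabs (b t) <= M /\ Cmod (c t) <= M /\
     Cmod (g t) <= M /\ Cmod (h t) <= M) ->
  (0 < r -> exists da db a0 b0 c0, symbols T beta lam M nu ell a b da db c g h a0 b0 c0) ->
  forall u v, csol T (wave_P ell r b g) (wave_Q ell r a c h) u v ->
  exists s0, 0 < s0 <= T /\ forall s, 0 < s <= s0 ->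
    energy k (u s) (v s) <=
      K * Rpower k (2 * nu - INR ell) * energy (k ^ S ell) (u T) (v T) /\
    energy (k ^ S ell) (u T) (v T) <=
      K * Rpower k (2 * nu + INR ell) * energy k (u s) (v s).
Proof.
move=> T0 beta0 lam0 M0 l0.
have [K1 [Z [K10 [Z1 HE]]]] := high_energy T beta lam M ell T0 lam0 M0.
pose N := Rmax (Rmax 1 (2 * T)) (2 * Z).
have N1 : 1 <= N by apply: Rle_trans (Rmax_l _ _); exact: Rmax_l.
have N2 : 2 * T <= N by apply: Rle_trans (Rmax_l _ _); exact: Rmax_r.
have N3 : 2 * Z <= N by exact: Rmax_r.
have [L [L0 HL]] := low_zone_coefs M N ell M0 N1 l0.
pose G := exp ((1 + 3 * L) * N).
have G0 : 0 < G by exact: exp_pos.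
have NT : 2 <= N / T.
  by apply: (Rmult_le_reg_r T) => //; have -> : N / T * T = N by field; lra.
have pw (x : R) (n : nat) : 0 < x -> 0 < x ^ n by exact: pow_lt.
pose W := K1 * (Rpower T beta / beta + T + 1).
pose D x := exp (Rabs x * ln (N / T)).
have D0 x : 0 < D x by exact: exp_pos.
pose A1 := 4 * K1 * (K1 * (1 + (T ^ ell) ^ 2)) * (D (2 * nu - INR ell) * exp W) * G.
pose A2 := (1 + 4 * (/ T ^ ell) ^ 2) * K1 * (K1 * (N ^ ell) ^ 2) * (D (2 * nu + INR ell) * exp W) * G.
pose B1 := D (2 * nu - INR ell) * G.
pose B2 := D (2 * nu + INR ell) * (((N / T) ^ ell) ^ 2) * G.
have Tl := pw T ell T0; have Nl := pw N ell ltac:(lra).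
have eW : 0 < exp W by exact: exp_pos.
have iT2 := pow2_ge_0 (/ T ^ ell); have T2 := pow2_ge_0 (T ^ ell).
have A10 : 0 < A1.
  by rewrite /A1; repeat apply: Rmult_lt_0_compat => //; lra.
have A20 : 0 < A2.
  have Nl2 := pw _ 2%N Nl.
  by rewrite /A2; repeat apply: Rmult_lt_0_compat => //; lra.
have B10 : 0 < B1 by do !apply: Rmult_lt_0_compat => //.
have B20 : 0 < B2.
  have NTl := pw (N / T) ell ltac:(lra).
  have NTl2 := pw _ 2%N NTl.
  by rewrite /B2; apply: Rmult_lt_0_compat => //; apply: Rmult_lt_0_compat.
have D1 x : D x >= 0 by apply: Rle_ge; exact: Rlt_le.
exists (A1 + A2 + B1 + B2); split; first lra.
move=> r k a b c g h r0 k1 hk bd sym u v So.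
have r2 := pow2_ge_0 r.
have rk : r <= k ^ S ell.
  by rewrite hk -{1}(sqrt_pow2 r) //; apply: sqrt_le_1_alt; lra.
have kp x : 0 < Rpower k x by exact: exp_pos.
have enl (y z x e : R) : 0 < y -> y <= z -> 0 < x -> 0 <= e -> y * x * e <= z * x * e.
  by move=> y0 yz x0 e0; apply: Rmult_le_compat_r => //; apply: Rmult_le_compat_r; lra.
have kle : k <= k ^ S ell.
  by have := pow_R1_Rle k ell k1; rewrite /=; nra.
have low t1 s : 0 < t1 <= T -> k * t1 <= N -> 0 < s <= t1 ->
    energy k (u t1) (v t1) <= energy k (u s) (v s) * G /\
    energy k (u s) (v s) <= energy k (u t1) (v t1) * G.
  move=> t1T kt1 st1.
  have [|h1 h2] := energy_gronwall T k L _ _ u v s t1 ltac:(lra) L0 So ltac:(lra) ltac:(lra) ltac:(lra).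
    move=> x xst; have [ba [bb [bc [bg bh]]]] := bd x ltac:(lra).
    by apply: HL => //; nra.
  have le : exp ((1 + 3 * L) * k * (t1 - s)) <= G.
    apply: exp_le_exp; rewrite Rmult_assoc; apply: Rmult_le_compat_l; nra.
  split.
    by apply: Rle_trans h1 _; apply: Rmult_le_compat_l => //; exact: energy_ge0.
  by apply: Rle_trans h2 _; apply: Rmult_le_compat_l => //; exact: energy_ge0.
have [kT|kT] := Rle_dec (k * T) N.
  (* here 1 <= k <= N / T: the low zone is all of (0,T] and powers of k are harmless *)
  exists T; split; first lra.
  move=> s sT; have [h1 h2] := low T s ltac:(lra) kT sT.
  have kNT : 1 <= k <= N / T.
    split=> //; apply: (Rmult_le_reg_r T) => //.
    by have -> : N / T * T = N by [field; lra].
  split.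
  + apply: (Rle_trans _ (B1 * Rpower k (2 * nu - INR ell) * energy (k ^ S ell) (u T) (v T))); last first.
      by apply: enl => //; [lra | exact: energy_ge0].
    have p1 := Rpower_lower k (N / T) (2 * nu - INR ell) kNT; rewrite -/(D _) in p1.
    have e1 : energy k (u T) (v T) <= 1 * energy (k ^ S ell) (u T) (v T).
      by apply: energy_le; rewrite ?Rmult_1_l; [lra | apply: pow_incr; lra].
    have e0 := energy_ge0 (k ^ S ell) (u T) (v T).
    apply: Rle_trans h2 _.
    have q1 := Rmult_le_compat_r _ _ _ (Rmult_le_pos _ _ (Rlt_le _ _ G0) e0) p1.
    have q2 := Rmult_le_compat_r _ _ _ (Rlt_le _ _ G0) e1.
    by rewrite /B1; lra.
  + apply: (Rle_trans _ (B2 * Rpower k (2 * nu + INR ell) * energy k (u s) (v s))); last first.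
      by apply: enl => //; [lra | exact: energy_ge0].
    have p1 := Rpower_lower k (N / T) (2 * nu + INR ell) kNT; rewrite -/(D _) in p1.
    have f1 : 1 <= (N / T) ^ ell by apply: pow_R1_Rle; lra.
    have f2 : 1 <= ((N / T) ^ ell) ^ 2 by apply: pow_R1_Rle.
    have e1 : energy (k ^ S ell) (u T) (v T) <= ((N / T) ^ ell) ^ 2 * energy k (u T) (v T).
      apply: energy_le => //.
      have -> : (k ^ S ell) ^ 2 = (k ^ ell) ^ 2 * k ^ 2 by rewrite /=; ring.
      apply: Rmult_le_compat_r; first exact: pow2_ge_0.
      by apply: pow_incr; split; [apply: pow_le; lra | apply: pow_incr; lra].
    have e0 := energy_ge0 k (u s) (v s).
    apply: Rle_trans e1 _.
    have q0 : 0 <= ((N / T) ^ ell) ^ 2 by lra.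
    have q1 := Rmult_le_compat_l _ _ _ q0 h1.
    have q2 := Rmult_le_compat_r _ _ _ (Rmult_le_pos _ _ q0 (Rmult_le_pos _ _ (Rlt_le _ _ G0) e0)) p1.
    by rewrite /B2; lra.
have {}kT : N < k * T by lra.
pose t0 := N / k.
have kt0 : k * t0 = N by rewrite /t0; field; lra.
have t00 : 0 < t0 by apply: Rdiv_lt_0_compat; lra.
have t0T : t0 <= T by apply: (Rmult_le_reg_l k); lra.
have k2 : 2 <= k by apply: (Rmult_le_reg_r T); lra.
have B2' : 2 <= k ^ S ell by lra.
have hk2 : (k ^ S ell) ^ 2 = 1 + r ^ 2 by rewrite hk pow2_sqrt //; lra.
have rB : k ^ S ell / 2 <= r by nra.
have rp : 0 < r by lra.
have [da [db [a0 [b0 [c0 Sy]]]]] := sym rp.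
have [E [cE [rE bE]]] := HE _ _ _ _ _ _ _ _ _ _ _ Sy r u v rp So.
have rt t : t0 <= t -> Z <= r * t ^ S ell.
  move=> tt.
  have h1 : t0 ^ S ell <= t ^ S ell by apply: pow_incr; lra.
  have h2 : k ^ S ell * t0 ^ S ell = N ^ S ell by rewrite -Rpow_mult_distr kt0.
  have h3 : N <= N ^ S ell by have := pow_R1_Rle N ell N1; rewrite /=; nra.
  have h4 := Rmult_le_compat_r _ _ _ (Rlt_le _ _ (pw t0 (S ell) t00)) rB.
  have h5 := Rmult_le_compat_l _ _ _ r0 h1.
  lra.
have dE t : t0 < t < T -> is_derive E t (Derive E t) /\
   Rabs (Derive E t - INR ell / t * E t) <=
   (2 * nu / t + K1 * (Rpower t (beta - 1) + 1 + / (r * t ^ S ell) / t)) * E t.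
  move=> tt; have [d [Dd Hd]] := rE t ltac:(lra) (rt t ltac:(lra)).
  by rewrite (is_derive_unique _ _ _ Dd).
have [E0 [E1 E2]] := bE t0 ltac:(lra) (rt t0 (Rle_refl _)).
have [F0 [F1 F2]] := bE T ltac:(lra) (rt T t0T).
have [g1 g2] := high_zone_gronwall T beta K1 nu ell r t0 E (Derive E) beta0 K10 rp
  (conj t00 t0T) (Rle_trans _ _ _ Z1 (rt t0 (Rle_refl _)))
  (fun t tt => cE t ltac:(lra)) (fun t tt => proj1 (dE t tt)) (fun t tt => proj2 (dE t tt)) E0 F0.
rewrite -/W in g1 g2.
have ex x : exp (x * ln (T / t0) + W) <= D x * exp W * Rpower k x.
  rewrite exp_plus /D /Rpower.
  have -> : T / t0 = k * / (N / T) by rewrite /t0; field; lra.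
  have iNT : 0 < / (N / T) by apply: Rinv_0_lt_compat; lra.
  rewrite ln_mult //; last lra.
  rewrite ln_Rinv; last lra.
  have -> : x * (ln k + - ln (N / T)) = - x * ln (N / T) + x * ln k by ring.
  rewrite exp_plus.
  have lNT : 0 <= ln (N / T) by rewrite -ln_1; apply: ln_le; lra.
  have h1 : exp (- x * ln (N / T)) <= exp (Rabs x * ln (N / T)).
    apply: exp_le_exp; apply: Rmult_le_compat_r => //.
    by rewrite -Rabs_Ropp; exact: Rle_abs.
  have := Rmult_le_compat_r _ _ _ (Rlt_le _ _ (Rmult_lt_0_compat _ _ eW (exp_pos (x * ln k)))) h1.
  lra.
(* rho is comparable to k at t0, since r is comparable to k ^ (ell + 1) and k t0 = N *)
have rho0_le : rho ell r t0 <= N ^ ell * k.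
  have h1 := Rmult_le_compat_l _ _ _ (Rlt_le _ _ (pw t0 ell t00)) rk.
  have h2 : t0 ^ ell * k ^ S ell = N ^ ell * k by rewrite -kt0 Rpow_mult_distr /=; ring.
  by rewrite /rho; lra.
have rho0_ge : k <= 2 * rho ell r t0.
  have h1 := Rmult_le_compat_l _ _ _ (Rlt_le _ _ (pw t0 ell t00)) rB.
  have h2 : t0 ^ ell * k ^ S ell = N ^ ell * k by rewrite -kt0 Rpow_mult_distr /=; ring.
  have h3 : 1 <= N ^ ell by exact: pow_R1_Rle.
  by rewrite /rho; nra.
have rho0_0 : 0 < rho ell r t0 by lra.
have rhoT_0 : 0 < rho ell r T by apply: Rmult_lt_0_compat.
have N21 : 1 <= (N ^ ell) ^ 2 by apply: pow_R1_Rle; exact: pow_R1_Rle.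
have c1 : energy (rho ell r t0) (u t0) (v t0) <= (N ^ ell) ^ 2 * energy k (u t0) (v t0).
  apply: energy_le => //; rewrite -Rpow_mult_distr; apply: pow_incr; lra.
have c2 : energy k (u t0) (v t0) <= 4 * energy (rho ell r t0) (u t0) (v t0).
  apply: energy_le; first lra.
  have -> : 4 * rho ell r t0 ^ 2 = (2 * rho ell r t0) ^ 2 by ring.
  by apply: pow_incr; lra.
have c3 : energy (rho ell r T) (u T) (v T) <= (1 + (T ^ ell) ^ 2) * energy (k ^ S ell) (u T) (v T).
  apply: energy_le; first lra.
  have h1 : rho ell r T <= T ^ ell * k ^ S ell by rewrite /rho; apply: Rmult_le_compat_l; lra.
  have h2 := pow_incr _ _ 2 (conj (Rlt_le _ _ rhoT_0) h1).
  rewrite Rpow_mult_distr in h2; have := pow2_ge_0 (k ^ S ell); lra.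
have c4 : energy (k ^ S ell) (u T) (v T) <= (1 + 4 * (/ T ^ ell) ^ 2) * energy (rho ell r T) (u T) (v T).
  apply: energy_le; first lra.
  have h1 : k ^ S ell <= 2 * / T ^ ell * rho ell r T.
    have -> : 2 * / T ^ ell * rho ell r T = 2 * r by rewrite /rho; field; lra.
    lra.
  have h2 := pow_incr _ _ 2 (conj (ltac:(lra) : 0 <= k ^ S ell) h1).
  rewrite 2!Rpow_mult_distr in h2; have := pow2_ge_0 (rho ell r T); lra.
exists t0; split; first lra.
move=> s st; have [h1 h2] := low t0 s ltac:(lra) ltac:(lra) st.
have eT := energy_ge0 (k ^ S ell) (u T) (v T); have es := energy_ge0 k (u s) (v s).
split.
- apply: (Rle_trans _ (A1 * Rpower k (2 * nu - INR ell) * energy (k ^ S ell) (u T) (v T))); last first.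
    by apply: enl => //; lra.
  set x := 2 * nu - INR ell in g2 *.
  set eB := energy (k ^ S ell) (u T) (v T) in c3 eT *.
  have Q1 : E T <= K1 * ((1 + (T ^ ell) ^ 2) * eB).
    by apply: Rle_trans F1 _; apply: Rmult_le_compat_l => //; lra.
  have Q2 : E t0 <= K1 * ((1 + (T ^ ell) ^ 2) * eB) * (D x * exp W * Rpower k x).
    apply: Rle_trans g2 _; apply: Rmult_le_compat => //.
    by apply: Rlt_le; exact: exp_pos.
  have Q3 : energy k (u t0) (v t0) <= 4 * (K1 * (K1 * ((1 + (T ^ ell) ^ 2) * eB) * (D x * exp W * Rpower k x))).
    apply: Rle_trans c2 _; apply: Rmult_le_compat_l; first lra.
    by apply: Rle_trans E2 _; apply: Rmult_le_compat_l => //; lra.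
  apply: Rle_trans h2 _; apply: Rle_trans (Rmult_le_compat_r _ _ _ (Rlt_le _ _ G0) Q3) _.
  by apply: Req_le; rewrite /A1 -/x; ring.
- apply: (Rle_trans _ (A2 * Rpower k (2 * nu + INR ell) * energy k (u s) (v s))); last first.
    by apply: enl => //; lra.
  set x := 2 * nu + INR ell in g1 *.
  set ek := energy k (u s) (v s) in h1 es *.
  have Q1 : E t0 <= K1 * ((N ^ ell) ^ 2 * (ek * G)).
    apply: Rle_trans E1 _; apply: Rmult_le_compat_l; first lra.
    by apply: Rle_trans c1 _; apply: Rmult_le_compat_l => //; lra.
  have Q2 : E T <= K1 * ((N ^ ell) ^ 2 * (ek * G)) * (D x * exp W * Rpower k x).
    apply: Rle_trans g1 _; apply: Rmult_le_compat => //.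
    by apply: Rlt_le; exact: exp_pos.
  apply: Rle_trans c4 _.
  have Q3 := Rle_trans _ _ _ F2 (Rmult_le_compat_l _ _ _ (Rlt_le _ _ K10) Q2).
  apply: Rle_trans (Rmult_le_compat_l _ _ _ (ltac:(lra) : 0 <= 1 + 4 * (/ T ^ ell) ^ 2) Q3) _.
  by apply: Req_le; rewrite /A2 -/x; ring.
Qed.

Lemma energy_limit_le (x A : R) (u v : R -> C) (p q : C) (s0 : R) :
  0 < s0 -> lim_right0 u p -> lim_right0 v q ->
  (forall s, 0 < s <= s0 -> energy x (u s) (v s) <= A) -> energy x p q <= A.
Proof.
move=> s00 hu hv H.
have near : at_right 0 (fun s => energy x (u s) (v s) <= A).
  by apply: (filter_imp _ _ _ (at_right0_interval s0 s00)) => s st; apply: H; lra.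
have limC := filterlim_const (F := at_right 0) A.
exact: (filterlim_le (F := at_right 0) _ _ (Finite (energy x p q)) (Finite A) near
  (lim_right0_energy x u v p q hu hv) (limC _)).
Qed.

Lemma energy_limit_ge (x A K : R) (u v : R -> C) (p q : C) (s0 : R) :
  0 < s0 -> lim_right0 u p -> lim_right0 v q ->
  (forall s, 0 < s <= s0 -> A <= K * energy x (u s) (v s)) -> A <= K * energy x p q.
Proof.
move=> s00 hu hv H.
have near : at_right 0 (fun s => A <= K * energy x (u s) (v s)).
  by apply: (filter_imp _ _ _ (at_right0_interval s0 s00)) => s st; apply: H; lra.
have limC := filterlim_const (F := at_right 0) A.
have limK := filterlim_const (F := at_right 0) K.
have lim := filterlim_comp_2 _ _ _ (limK _) (lim_right0_energy x u v p q hu hv)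
  (filterlim_mult (K := R_AbsRing) K (energy x p q)).
exact: (filterlim_le (F := at_right 0) _ _ (Finite A) (Finite (K * energy x p q)) near (limC _) (lim _ _)).
Qed.

Lemma energy_sum (x : R) (u v : C) : 0 <= x ->
  energy x u v <= (x * Cmod u + Cmod v) ^ 2 <= 2 * energy x u v.
Proof.
move=> x0; have pu := Cmod_ge_0 u; have pv := Cmod_ge_0 v; rewrite /energy.
have h := Rmult_le_pos _ _ (Rmult_le_pos _ _ x0 pu) pv.
have := pow2_ge_0 (x * Cmod u - Cmod v); split; nra.
Qed.

Lemma sqr_le_le (x y K : R) : 0 <= K -> 0 <= y -> x ^ 2 <= 2 * K * y ^ 2 -> x <= (2 * K + 1) * y.
Proof.
move=> K0 y0 h; have [//|lt] := Rle_lt_dec x ((2 * K + 1) * y).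
have z0 : 0 <= (2 * K + 1) * y by nra.
have : ((2 * K + 1) * y) ^ 2 < x ^ 2 by nra.
have := pow2_ge_0 y; have -> : ((2 * K + 1) * y) ^ 2 = (2 * K + 1) ^ 2 * y ^ 2 by ring.
nra.
Qed.

Lemma bracket_ge1 (d : nat) (xi : Rd d) : 1 <= bracket xi.
Proof.
rewrite -{1}sqrt_1; apply: sqrt_le_1_alt.
have := pow2_ge_0 (norm xi); lra.
Qed.

(** The inverse of the time at which a frequency passes from the non-oscillating to the
    oscillating zone, up to constants. *)
Definition bracket_root (d ell : nat) (xi : Rd d) : R := Rpower (bracket xi) (/ (INR ell + 1)).

Lemma bracket_root_pow (d ell : nat) (xi : Rd d) : bracket_root d ell xi ^ S ell = bracket xi.
Proof.
have b1 := bracket_ge1 d xi; have := pos_INR ell => l0.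
rewrite -Rpower_pow; last exact: exp_pos.
rewrite /bracket_root Rpower_mult S_INR Rinv_l ?Rpower_1; lra.
Qed.

Lemma bracket_root_ge1 (d ell : nat) (xi : Rd d) : 1 <= bracket_root d ell xi.
Proof.
have b1 := bracket_ge1 d xi; have := pos_INR ell => l0.
rewrite -exp_0; apply: exp_le_exp; apply: Rmult_le_pos.
  by apply: Rlt_le; apply: Rinv_0_lt_compat; lra.
by rewrite -ln_1; apply: ln_le; lra.
Qed.

(** Bookkeeping of exponents: [k ^ ell] is the bracket to the power [ell / (ell + 1)], twice
    the weight exponent in [sizeT], and [k ^ (2 nu)] is the bracket to the power [2 mu]. *)
Lemma sizes_of_energies (d ell : nat) (xi : Rd d) (K mu : R) (p q u v : C) :
  0 <= K ->
  let k := bracket_root d ell xi in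
  let nu := (INR ell + 1) * mu in
  (energy k p q <= K * Rpower k (2 * nu - INR ell) * energy (k ^ S ell) u v ->
   size0 ell xi p q <= (2 * K + 1) * (Rpower (bracket xi) mu * sizeT ell xi u v)) /\
  (energy (k ^ S ell) u v <= K * Rpower k (2 * nu + INR ell) * energy k p q ->
   sizeT ell xi u v <= (2 * K + 1) * (Rpower (bracket xi) mu * size0 ell xi p q)).
Proof.
move=> K0 k nu; rewrite bracket_root_pow.
have b1 := bracket_ge1 d xi; have l0 := pos_INR ell; have k1 := bracket_root_ge1 d ell xi.
rewrite -/k in k1.
set B := bracket xi in b1 *.
pose s := INR ell / (2 * (INR ell + 1)).
have s0E : size0 ell xi p q = k * Cmod p + Cmod q by [].
have sTE : sizeT ell xi u v = Rpower B (- s) * (B * Cmod u + Cmod v).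
  rewrite /sizeT -/s -/B; have -> : 1 - s = - s + 1 by ring.
  by rewrite Rpower_plus Rpower_1; [ring | lra].
have kR x : Rpower k x = Rpower B (/ (INR ell + 1) * x) by rewrite /k /bracket_root Rpower_mult.
have sq x : Rpower B x ^ 2 = Rpower B (2 * x).
  have -> : 2 * x = x + x by ring.
  by rewrite Rpower_plus /=; ring.
have em : Rpower k (2 * nu - INR ell) = Rpower B mu ^ 2 * Rpower B (- s) ^ 2.
  rewrite !sq -Rpower_plus kR; congr Rpower; rewrite /nu /s; field; lra.
have ep : Rpower k (2 * nu + INR ell) * Rpower B (- s) ^ 2 = Rpower B mu ^ 2.
  rewrite !sq kR -Rpower_plus; congr Rpower; rewrite /nu /s; field; lra.
have Bm : 0 < Rpower B mu by exact: exp_pos.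
have Bs : 0 < Rpower B (- s) by exact: exp_pos.
have [e1 e2] := energy_sum k p q ltac:(lra).
have [f1 f2] := energy_sum B u v ltac:(lra).
have pp := Cmod_ge_0 p; have pq := Cmod_ge_0 q; have pu := Cmod_ge_0 u; have pv := Cmod_ge_0 v.
have x0 : 0 <= k * Cmod p + Cmod q by nra.
have y0 : 0 <= B * Cmod u + Cmod v by nra.
rewrite s0E sTE; split=> h.
- apply: sqr_le_le => //; first by apply: Rmult_le_pos; [lra | apply: Rmult_le_pos; lra].
  rewrite em in h.
  have c0 : 0 <= K * (Rpower B mu ^ 2 * Rpower B (- s) ^ 2).
    by apply: Rmult_le_pos => //; apply: Rmult_le_pos; exact: pow2_ge_0.
  have := Rmult_le_compat_l _ _ _ c0 f1.
  have -> : 2 * K * (Rpower B mu * (Rpower B (- s) * (B * Cmod u + Cmod v))) ^ 2 =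
    2 * (K * (Rpower B mu ^ 2 * Rpower B (- s) ^ 2) * (B * Cmod u + Cmod v) ^ 2) by ring.
  lra.
- apply: sqr_le_le => //; first by apply: Rmult_le_pos; lra.
  rewrite 2!Rpow_mult_distr -ep.
  set R1 := Rpower k _ in h *; set S2 := Rpower B (- s) ^ 2.
  have S20 : 0 <= S2 by exact: pow2_ge_0.
  have R10 : 0 <= R1 by apply: Rlt_le; exact: exp_pos.
  have h1 := Rmult_le_compat_l _ _ _ (Rmult_le_pos _ _ K0 R10) e1.
  have h2 : (B * Cmod u + Cmod v) ^ 2 <= 2 * (K * R1 * (k * Cmod p + Cmod q) ^ 2) by lra.
  have := Rmult_le_compat_l _ _ _ S20 h2; lra.
Qed.

(** * Coefficients of the class T along one direction *)

Lemma euler_derive (X : NormedModule R_AbsRing) (D : R -> Prop) (f : R -> X)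
    (F : nat -> R -> X) (t : R) :
  0 < t -> D t -> euler_iterates D f F ->
  is_derive_within D (F 0%N) t (scal (/ t) (F 1%N t)).
Proof.
move=> t0 Dt [_ H]; have [l [Dl ->]] := H 0%N t Dt.
have -> : scal (/ t) (scal t l) = l; last exact: Dl.
by rewrite scal_assoc /mult /= Rinv_l ?scal_one //; lra.
Qed.

(** The symbols in a fixed direction are linear in the coefficients; since [M] comes before
    the linear map [g], the resulting bounds are uniform in the direction. *)
Lemma class_T_linear (X : NormedModule R_AbsRing) (beta T : R) (f : R -> X) :
  0 < T -> class_T beta T f ->
  exists M, 0 < M /\ forall (Y : NormedModule R_AbsRing) (g : X -> Y) (B : R),
    is_linear g -> (forall x, norm (g x) <= B * norm x) -> 0 <= B ->
    norm (g (f 0)) <= B * M /\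
    exists df : R -> Y, forall t, Ioc T t ->
      is_derive_within (Ioc T) (fun s => g (f s)) t (df t) /\
      norm (minus (g (f t)) (g (f 0))) <= B * M * Rpower t beta /\
      norm (df t) <= B * M * Rpower t (beta - 1).
Proof.
move=> T0 [f0 [fs [ef [fs0 [_ [F [EF bF]]]]]]].
have [M0 [M00 hM0]] := bF 0%N; have [M1 [M10 hM1]] := bF 1%N.
have n0 := norm_ge_0 f0.
have [F0 _] := EF.
have f00 : f 0 = f0.
  by rewrite ef; [rewrite fs0 plus_zero_r | rewrite /Icc; lra].
exists (M0 + M1 + norm f0); split; first lra.
move=> Y g B lin hB B0; split.
  rewrite f00; apply: Rle_trans (hB _) _; apply: Rmult_le_compat_l => //; lra.
exists (fun t => g (scal (/ t) (F 1%N t))) => t tI; have [t0 tT] := tI.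
have fE s : Ioc T s -> f s = plus f0 (F 0%N s).
  by move=> sI; rewrite F0 // ef //; move: sI; rewrite /Ioc /Icc; lra.
have PF := within_Ioc_proper T t tI.
have W0 := Rpower_gt0 t beta; have W1 := Rpower_gt0 t (beta - 1).
split; [|split].
- apply: is_derive_within_linear => //.
  have D := euler_derive X (Ioc T) fs F t t0 tI EF.
  have Dp := filterdiff_plus_fct _ _ _ _ (filterdiff_const f0) D.
  have ext : filterdiff f (within (Ioc T) (locally t))
     (fun y => plus zero (scal y (scal (/ t) (F 1%N t)))).
    refine (filterdiff_ext_loc _ _ _ _ _ (Dp _ _)).
      by rewrite /within; apply: filter_forall => y yI; rewrite (fE y yI).
    move=> x Hx; have -> : x = t.
      exact: (is_filter_lim_unique (F := within (Ioc T) (locally t)) x t Hx (within_Ioc_lim T t tI)).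
    by rewrite fE.
  by refine (filterdiff_ext_lin _ _ _ ext _) => y; rewrite plus_zero_l.
- have -> : minus (g (f t)) (g (f 0)) = g (F 0%N t).
    rewrite fE // f00 (linear_plus g lin) /minus (plus_comm (g f0)) -plus_assoc.
    by rewrite plus_opp_r plus_zero_r.
  apply: Rle_trans (hB _) _; rewrite Rmult_assoc; apply: Rmult_le_compat_l => //.
  by apply: Rle_trans (hM0 t tI) _; apply: Rmult_le_compat_r; lra.
- apply: Rle_trans (hB _) _; rewrite Rmult_assoc; apply: Rmult_le_compat_l => //.
  have it : 0 < / t by exact: Rinv_0_lt_compat.
  apply: Rle_trans (norm_scal _ _) _.
  have -> : abs (/ t) = / t by rewrite /abs /= Rabs_right //; lra.
  apply: Rle_trans (Rmult_le_compat_l _ _ _ (Rlt_le _ _ it) (hM1 t tI)) _.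
  rewrite -Rpower_div // /Rdiv.
  have := Rmult_lt_0_compat _ _ W0 it => w.
  have := Rmult_le_compat_r _ M1 (M0 + M1 + norm f0) (Rlt_le _ _ w) ltac:(lra); lra.
Qed.

Lemma Rpower_le_T (t T beta : R) : 0 < beta -> 0 < t <= T -> Rpower t beta <= Rpower T beta.
Proof. by move=> b0 tT; apply: Rle_Rpower_l; lra. Qed.

(** The bound near 0 and the boundedness of [f] combine to a bound of [f / t ^ n]. *)
Lemma quotient_bound (beta T : R) (f : R -> C) (n : nat) :
  0 < T -> 0 < beta -> class_T (X := C_R_NormedModule) beta T f ->
  (exists M : R, at_right 0 (fun t => Cmod (f t) <= M * t ^ n)) ->
  exists M, 0 < M /\ forall t, 0 < t <= T -> Cmod (RtoC (/ t ^ n) * f t)%C <= M.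
Proof.
move=> T0 b0 cf [m [eps near]].
have [M [M0 H]] := class_T_linear _ _ _ _ T0 cf.
have lid : is_linear (fun x : C_R_NormedModule => x).
  by split=> //; exists 1; split; [lra | move=> x; rewrite Rmult_1_l; exact: Rle_refl].
have [h0 [df hf]] := H _ _ 1 lid (fun x => Req_le _ _ (esym (Rmult_1_l _))) Rle_0_1.
have ep := cond_pos eps.
pose A := M + M * Rpower T beta.
have RT := Rpower_gt0 T beta.
have A0 : 0 < A by rewrite /A; have := Rmult_lt_0_compat _ _ M0 RT; lra.
have fA t : 0 < t <= T -> Cmod (f t) <= A.
  move=> tT; have [_ [h1 _]] := hf t tT.
  have -> : f t = (f 0 + (f t - f 0))%C by ring.
  apply: Rle_trans (Cmod_triangle _ _) _.
  rewrite -!norm_Cmod /A; rewrite Rmult_1_l in h0 h1.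
  have := Rmult_le_compat_l _ _ _ (Rlt_le _ _ M0) (Rpower_le_T t T beta b0 tT).
  have h2 : norm ((f t - f 0)%C : C_R_NormedModule) <= M * Rpower t beta := h1.
  lra.
have en : 0 < / eps ^ n by apply: Rinv_0_lt_compat; apply: pow_lt.
exists (Rabs m + A * / eps ^ n + 1); split.
  have := Rabs_pos m; have := Rmult_lt_0_compat _ _ A0 en; lra.
move=> t tT; have tn := pow_lt t n (proj1 tT).
have itn : 0 < / t ^ n by exact: Rinv_0_lt_compat.
rewrite Cmod_mult Cmod_R Rabs_right; last lra.
have p := Rabs_pos m; have q := Rmult_lt_0_compat _ _ A0 en.
have [te|te] := Rlt_le_dec t eps.
  have h : Cmod (f t) <= m * t ^ n.
    apply: near; last exact: (proj1 tT).
    rewrite /ball /= /AbsRing_ball /abs /minus /plus /opp /= Rabs_right; lra.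
  have := Rmult_le_compat_l _ _ _ (Rlt_le _ _ itn) h.
  have -> : / t ^ n * (m * t ^ n) = m by field; lra.
  by have := Rle_abs m; lra.
have h1 : / t ^ n <= / eps ^ n.
  by apply: Rinv_le_contravar; [exact: pow_lt | apply: pow_incr; lra].
have := Rmult_le_compat _ _ _ _ (Rlt_le _ _ itn) (Cmod_ge_0 (f t)) h1 (fA t tT); lra.
Qed.

Lemma is_linear_symb_a (d : nat) (w : Rd d) :
  is_linear (fun x : Rdd d => rsum d (fun i => rsum d (fun j => x i j * w i * w j)) : R_NormedModule)
  /\ ((forall i, Rabs (w i) <= 1) -> forall x : Rdd d,
      Rabs (rsum d (fun i => rsum d (fun j => x i j * w i * w j))) <= INR d ^ 2 * norm x).
Proof.
have d0 := pos_INR d.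
have bd m (x : Rdd d) : 0 <= m -> (forall i, Rabs (w i) <= m) ->
    Rabs (rsum d (fun i => rsum d (fun j => x i j * w i * w j))) <= INR d * (INR d * (m * m * norm x)).
  move=> m0 hw; apply: Rabs_rsum_le => i; apply: Rabs_rsum_le => j.
  rewrite !Rabs_mult; have := hw i; have := hw j; have p1 := Rabs_pos (w i); have p2 := Rabs_pos (w j).
  have := vec_norm_ge_coord (X := Rd d) x i; have := vec_norm_ge_coord (X := R_NormedModule) (x i) j.
  rewrite -[vec_norm (x i)]/(norm (x i)) -[vec_norm x]/(norm x).
  rewrite -[norm (x i j)]/(Rabs (x i j)); have p3 := Rabs_pos (x i j) => h1 h2 h3 h4.
  have -> : m * m * norm x = norm x * m * m by ring.
  apply: Rmult_le_compat => //; first by apply: Rmult_le_pos.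
  by apply: Rmult_le_compat => //; apply: Rle_trans h1 h2.
split; last first.
  by move=> hw x; apply: Rle_trans (bd 1 x Rle_0_1 hw) _; apply: Req_le; ring.
split.
- move=> x y; rewrite -[RHS]rsum_plus; apply: rsum_ext => i.
  rewrite -rsum_plus; apply: rsum_ext => j.
  by rewrite /plus /= /vec_plus /plus /= /vec_plus /plus /=; ring.
- move=> k x; rewrite -[RHS]rsum_scal; apply: rsum_ext => i.
  rewrite -rsum_scal; apply: rsum_ext => j.
  by rewrite /scal /= /vec_scal /scal /= /vec_scal /scal /= /mult /=; ring.
- pose m := rsum d (fun i => Rabs (w i)).
  have m0 : 0 <= m by apply: rsum_ge0 => i; exact: Rabs_pos.
  have mw i : Rabs (w i) <= m by apply: (rsum_ge_term (F := fun i => Rabs (w i))) => j; exact: Rabs_pos.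
  exists (INR d * (INR d * (m * m)) + 1); split.
    by apply: Rle_lt_0_plus_1; do !apply: Rmult_le_pos => //.
  move=> x; apply: Rle_trans (bd m x m0 mw) _.
  by have := norm_ge_0 x; lra.
Qed.

Lemma is_linear_symb_b (d : nat) (w : Rd d) :
  is_linear (fun x : Rd d => rsum d (fun i => x i * w i) : R_NormedModule)
  /\ ((forall i, Rabs (w i) <= 1) -> forall x : Rd d,
      Rabs (rsum d (fun i => x i * w i)) <= INR d * norm x).
Proof.
have d0 := pos_INR d.
have bd m (x : Rd d) : 0 <= m -> (forall i, Rabs (w i) <= m) ->
    Rabs (rsum d (fun i => x i * w i)) <= INR d * (norm x * m).
  move=> m0 hw; apply: Rabs_rsum_le => i.
  rewrite Rabs_mult; apply: Rmult_le_compat => //; try exact: Rabs_pos.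
  exact: (vec_norm_ge_coord (X := R_NormedModule) x i).
split; last first.
  by move=> hw x; apply: Rle_trans (bd 1 x Rle_0_1 hw) _; apply: Req_le; ring.
split.
- move=> x y; rewrite -[RHS]rsum_plus; apply: rsum_ext => i.
  by rewrite /plus /= /vec_plus /plus /=; ring.
- move=> k x; rewrite -[RHS]rsum_scal; apply: rsum_ext => i.
  by rewrite /scal /= /vec_scal /scal /= /mult /=; ring.
- pose m := rsum d (fun i => Rabs (w i)).
  have m0 : 0 <= m by apply: rsum_ge0 => i; exact: Rabs_pos.
  have mw i : Rabs (w i) <= m by apply: (rsum_ge_term (F := fun i => Rabs (w i))) => j; exact: Rabs_pos.
  exists (INR d * m + 1); split; first by apply: Rle_lt_0_plus_1; apply: Rmult_le_pos.
  move=> x; apply: Rle_trans (bd m x m0 mw) _.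
  by have := norm_ge_0 x; lra.
Qed.

Lemma fst_csum (d : nat) (F : 'I_d -> C) :
  fst (\big[Cplus/RtoC 0]_(i < d) F i) = rsum d (fun i => fst (F i)).
Proof. exact: (big_morph (fun z : C => fst z)). Qed.

Lemma snd_csum (d : nat) (F : 'I_d -> C) :
  snd (\big[Cplus/RtoC 0]_(i < d) F i) = rsum d (fun i => snd (F i)).
Proof. exact: (big_morph (fun z : C => snd z)). Qed.

Lemma Cmod_csum_le (d : nat) (F : 'I_d -> C) (m : R) :
  (forall i, Cmod (F i) <= m) -> Cmod (\big[Cplus/RtoC 0]_(i < d) F i) <= INR d * m.
Proof.
elim: d F => [|d IH] F h; first by rewrite big_ord0 Cmod_0 /=; lra.
rewrite big_ord_recl S_INR; apply: Rle_trans (Cmod_triangle _ _) _.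
by have := h ord0; have := IH (fun i => F (lift ord0 i)) (fun i => h _); lra.
Qed.

Lemma is_linear_symb_c (d : nat) (w : Rd d) :
  is_linear (fun x : Cd d => \big[Cplus/RtoC 0]_(i < d) Cmult (x i) (RtoC (w i)) : C_R_NormedModule)
  /\ ((forall i, Rabs (w i) <= 1) -> forall x : Cd d,
      Cmod (\big[Cplus/RtoC 0]_(i < d) Cmult (x i) (RtoC (w i))) <= INR d * norm x).
Proof.
have d0 := pos_INR d.
have bd m (x : Cd d) : 0 <= m -> (forall i, Rabs (w i) <= m) ->
    Cmod (\big[Cplus/RtoC 0]_(i < d) Cmult (x i) (RtoC (w i))) <= INR d * (norm x * m).
  move=> m0 hw; apply: Cmod_csum_le => i.
  rewrite Cmod_mult Cmod_R; apply: Rmult_le_compat => //; try exact: Rabs_pos; try exact: Cmod_ge_0.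
  by rewrite -norm_Cmod; exact: (vec_norm_ge_coord (X := C_R_NormedModule) x i).
have ext (z z' : C) : fst z = fst z' -> snd z = snd z' -> z = z'.
  by case: z z' => [x y] [x' y'] /= -> ->.
split; last first.
  by move=> hw x; apply: Rle_trans (bd 1 x Rle_0_1 hw) _; apply: Req_le; ring.
split.
- move=> x y; apply: ext.
  + rewrite fst_csum [RHS]/= !fst_csum -[RHS]rsum_plus; apply: rsum_ext => i.
    by rewrite /plus /= /vec_plus /plus /= /prod_plus /plus /=; ring.
  + rewrite snd_csum [RHS]/= !snd_csum -[RHS]rsum_plus; apply: rsum_ext => i.
    by rewrite /plus /= /vec_plus /plus /= /prod_plus /plus /=; ring.
- move=> k x; apply: ext.
  + rewrite fst_csum [RHS]/= !fst_csum -[RHS]rsum_scal; apply: rsum_ext => i.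
    by rewrite /scal /= /vec_scal /scal /= /prod_scal /scal /= /mult /=; ring.
  + rewrite snd_csum [RHS]/= !snd_csum -[RHS]rsum_scal; apply: rsum_ext => i.
    by rewrite /scal /= /vec_scal /scal /= /prod_scal /scal /= /mult /=; ring.
- pose m := rsum d (fun i => Rabs (w i)).
  have m0 : 0 <= m by apply: rsum_ge0 => i; exact: Rabs_pos.
  have mw i : Rabs (w i) <= m by apply: (rsum_ge_term (F := fun i => Rabs (w i))) => j; exact: Rabs_pos.
  exists (INR d * m + 1); split; first by apply: Rle_lt_0_plus_1; apply: Rmult_le_pos.
  move=> x; rewrite norm_Cmod; apply: Rle_trans (bd m x m0 mw) _.
  by have := norm_ge_0 x; lra.
Qed.

(** [Lub_Rbar] of a set that is nonempty and bounded is a finite number, so that [real] does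
    not return its default value. *)
Lemma real_Lub_ge (S : R -> Prop) (y m : R) :
  S y -> (forall z, S z -> z <= m) -> y <= real (Lub_Rbar S).
Proof.
move=> Sy bd; have [ub lub] := Lub_Rbar_correct S.
have h1 := ub _ Sy; have h2 : Rbar_le (Lub_Rbar S) (Finite m) by apply: lub => z /bd.
by case: (Lub_Rbar S) h1 h2.
Qed.

Lemma norm_scal_inv (d : nat) (xi : Rd d) : 0 < norm xi ->
  norm (scal (/ norm xi) xi : Rd d) = 1.
Proof.
move=> n0; have i0 := Rinv_0_lt_compat _ n0.
apply: Rle_antisym.
  apply: Rle_trans (norm_scal _ _) _.
  by rewrite /abs /= Rabs_right; [rewrite Rinv_l; lra | lra].
have e : xi = scal (norm xi) (scal (/ norm xi) xi : Rd d).
  by rewrite scal_assoc /mult /= Rinv_r ?scal_one //; lra.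
have := norm_scal (norm xi) (scal (/ norm xi) xi : Rd d); rewrite -e /abs /= Rabs_right; last lra.
move=> h; apply: (Rmult_le_reg_l (norm xi)) => //; lra.
Qed.

Definition dir_a (T : R) (d : nat) (a : R -> Rdd d) (w : Rd d) : R -> R :=
  clamp T (fun t => symb_a a t w).
Definition dir_b (T : R) (d : nat) (b : R -> Rd d) (w : Rd d) : R -> R :=
  clamp T (fun t => symb_b b t w).
Definition dir_c (T : R) (d : nat) (c : R -> Cd d) (w : Rd d) : R -> C :=
  clamp T (fun t => symb_c c t w).
Definition quot (T : R) (n : nat) (g : R -> C) : R -> C :=
  clamp T (fun t => (RtoC (/ t ^ n) * g t)%C).

Lemma continuous_quot (beta T : R) (n : nat) (g : R -> C) (t : R) :
  0 < T -> class_T (X := C_R_NormedModule) beta T g -> 0 < t -> continuous_C (quot T n g) t.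
Proof.
move=> T0 cg t0.
have [M [M0 H]] := class_T_linear _ _ _ _ T0 cg.
have lid : is_linear (fun x : C_R_NormedModule => x).
  by split=> //; exists 1; split; [lra | move=> x; rewrite Rmult_1_l; exact: Rle_refl].
have [_ [df hf]] := H _ _ 1 lid (fun x => Req_le _ _ (esym (Rmult_1_l _))) Rle_0_1.
have cgc : continuous_C (clamp T g) t.
  apply: continuous_clamp => // s sI; have [D _] := hf s sI.
  exact: (is_derive_within_continuous C_R_NormedModule T g s (df s) sI D).
have cinv : continuous (fun s => / Rmin s T ^ n) t.
  apply: (continuous_clamp R_UniformSpace T (fun s => / s ^ n) t T0 t0) => s [s0 _].
  apply: (filterlim_filter_le_1 (F := locally s)).
    by move=> P HP; apply: filter_imp HP.
  apply: (ex_derive_continuous (fun s => / s ^ n) s); auto_derive.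
  by have := pow_lt s n s0; lra.
apply: continuous_C_pair.
  apply: (continuous_ext (fun s => / Rmin s T ^ n * fst (clamp T g s))).
    by move=> s; rewrite /quot /clamp /=; ring.
  by apply: (continuous_mult (fun s => / Rmin s T ^ n)) => //; exact: continuous_fst_C.
apply: (continuous_ext (fun s => / Rmin s T ^ n * snd (clamp T g s))).
  by move=> s; rewrite /quot /clamp /=; ring.
by apply: (continuous_mult (fun s => / Rmin s T ^ n)) => //; exact: continuous_snd_C.
Qed.


(** For [|w| = 1] the lower bound on [alpha] also makes the supremum that defines [mu]
    finite, so that it dominates the quotient in the direction [w]. The weaker bounds for
    [|w_i| <= 1] serve the frequency 0, whose direction is the zero vector. *)
Lemma direction_symbols (T beta : R) (d ell : nat)
    (a : R -> Rdd d) (b : R -> Rd d) (c : R -> Cd d) (g h : R -> C) (lambda0 : R) :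
  0 < T -> 0 < beta ->
  class_T beta T a -> class_T beta T b -> class_T beta T c ->
  class_T (X := C_R_NormedModule) beta T g ->
  class_T (X := C_R_NormedModule) beta T h ->
  0 < lambda0 ->
  (forall (t : R) (xi : Rd d), 0 <= t <= T ->
     lambda0 * norm xi ^ 2 <= symb_a a t xi) ->
  (exists M : R, at_right 0 (fun t => Cmod (g t) <= M * t)) ->
  (exists M : R, at_right 0 (fun t => Cmod (h t) <= M * t ^ 2)) ->
  exists M, 0 <= M /\ forall w : Rd d, (forall i, Rabs (w i) <= 1) ->
    (forall t, 0 < t <= T -> Rabs (dir_a T d a w t) <= M /\ Rabs (dir_b T d b w t) <= M /\
       Cmod (dir_c T d c w t) <= M /\ Cmod (quot T 1 g t) <= M /\ Cmod (quot T 2 h t) <= M) /\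
    (forall t, 0 < t -> continuous (dir_a T d a w) t /\ continuous (dir_b T d b w) t /\
       continuous_C (dir_c T d c w) t) /\
    (norm w = 1 -> exists da db a0 b0 c0,
       symbols T beta lambda0 M ((INR ell + 1) * mu ell a b c) ell
         (dir_a T d a w) (dir_b T d b w) da db (dir_c T d c w) (quot T 1 g) (quot T 2 h)
         a0 b0 c0).
Proof.
move=> T0 beta0 ca cb cc cg ch lam0 low [mg hg] bh.
have bg : exists M : R, at_right 0 (fun t => Cmod (g t) <= M * t ^ 1).
  by exists mg; apply: (filter_imp _ _ _ hg) => t; rewrite pow_1.
have [Mg [Mg0 Hg]] := quotient_bound beta T g 1 T0 beta0 cg bg.
have [Mh [Mh0 Hh]] := quotient_bound beta T h 2 T0 beta0 ch bh.
have [Ma [Ma0 Ha]] := class_T_linear _ _ _ _ T0 ca.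
have [Mb [Mb0 Hb]] := class_T_linear _ _ _ _ T0 cb.
have [Mc [Mc0 Hc]] := class_T_linear _ _ _ _ T0 cc.
have d0 := pos_INR d; have dd0 := pow2_ge_0 (INR d).
have RT := Rpower_gt0 T beta.
pose m := INR d ^ 2 * Ma + INR d * Mb + INR d * Mc.
have ma0 : 0 <= INR d ^ 2 * Ma by apply: Rmult_le_pos; lra.
have mb0 : 0 <= INR d * Mb by apply: Rmult_le_pos; lra.
have mc0 : 0 <= INR d * Mc by apply: Rmult_le_pos; lra.
have m0 : 0 <= m by rewrite /m; lra.
have mRT : 0 <= m * Rpower T beta by apply: Rmult_le_pos; lra.
pose M := m + m * Rpower T beta + Mg + Mh.
have mM : m <= M by rewrite /M; lra.
exists M; split; first lra.
move=> w hw.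
have [la1 la2] := is_linear_symb_a d w; have [lb1 lb2] := is_linear_symb_b d w.
have [lc1 lc2] := is_linear_symb_c d w.
have [A0 [da HA]] := Ha _ _ _ la1 (la2 hw) dd0.
have [B0 [db HB]] := Hb _ _ _ lb1 (lb2 hw) d0.
have [C0 [dc HC]] := Hc _ _ _ lc1 (fun x => Rle_trans _ _ _ (Req_le _ _ (norm_Cmod _)) (lc2 hw x)) d0.
have enl x y t : 0 < t -> x <= y * Rpower t beta -> y <= m -> x <= M * Rpower t beta.
  move=> t0 h1 h2; apply: Rle_trans h1 _; have := Rpower_gt0 t beta.
  by move=> p; apply: Rmult_le_compat_r; lra.
have enl' x y t : x <= y * Rpower t (beta - 1) -> y <= m -> x <= M * Rpower t (beta - 1).
  move=> h1 h2; apply: Rle_trans h1 _; have := Rpower_gt0 t (beta - 1).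
  by move=> p; apply: Rmult_le_compat_r; lra.
have na t : 0 < t <= T -> Rabs (symb_a a t w - symb_a a 0 w) <= INR d ^ 2 * Ma * Rpower t beta.
  by move=> tT; have [_ [h1 _]] := HA t tT; exact: h1.
have nb t : 0 < t <= T -> Rabs (symb_b b t w - symb_b b 0 w) <= INR d * Mb * Rpower t beta.
  by move=> tT; have [_ [h1 _]] := HB t tT; exact: h1.
have nc t : 0 < t <= T -> Cmod (symb_c c t w - symb_c c 0 w)%C <= INR d * Mc * Rpower t beta.
  by move=> tT; have [_ [h1 _]] := HC t tT; rewrite norm_Cmod in h1; exact: h1.
have A0' : Rabs (symb_a a 0 w) <= INR d ^ 2 * Ma := A0.
have B0' : Rabs (symb_b b 0 w) <= INR d * Mb := B0.
have C0' : Cmod (symb_c c 0 w) <= INR d * Mc by rewrite -norm_Cmod; exact: C0.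
have mTle t y : 0 < t <= T -> 0 <= y -> y * Rpower t beta <= y * Rpower T beta.
  by move=> tT y0; apply: Rmult_le_compat_l => //; exact: Rpower_le_T.
have up y : 0 <= y -> y <= m -> y + y * Rpower T beta <= M.
  move=> y0 ym; have := Rmult_le_compat_r _ _ _ (Rlt_le _ _ RT) ym; rewrite /M; lra.
have ma : INR d ^ 2 * Ma <= m by rewrite /m; lra.
have mb : INR d * Mb <= m by rewrite /m; lra.
have mc : INR d * Mc <= m by rewrite /m; lra.
have bd t : 0 < t <= T -> Rabs (dir_a T d a w t) <= M /\ Rabs (dir_b T d b w t) <= M /\
       Cmod (dir_c T d c w t) <= M /\ Cmod (quot T 1 g t) <= M /\ Cmod (quot T 2 h t) <= M.
  move=> tT; have [t0 tT'] := tT.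
  rewrite /dir_a /dir_b /dir_c /quot !clampE //.
  split; [|split; [|split; [|split]]].
  - have -> : symb_a a t w = symb_a a 0 w + (symb_a a t w - symb_a a 0 w) by ring.
    apply: Rle_trans (Rabs_triang _ _) _.
    have := na t tT; have := mTle t _ tT ma0; have := up _ ma0 ma; lra.
  - have -> : symb_b b t w = symb_b b 0 w + (symb_b b t w - symb_b b 0 w) by ring.
    apply: Rle_trans (Rabs_triang _ _) _.
    have := nb t tT; have := mTle t _ tT mb0; have := up _ mb0 mb; lra.
  - have -> : symb_c c t w = (symb_c c 0 w + (symb_c c t w - symb_c c 0 w))%C by ring.
    apply: Rle_trans (Cmod_triangle _ _) _.
    have := nc t tT; have := mTle t _ tT mc0; have := up _ mc0 mc; lra.
  - by have := Hg t tT; rewrite /M; lra.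
  - by have := Hh t tT; rewrite /M; lra.
split; first exact: bd.
have cta t : 0 < t -> continuous (dir_a T d a w) t.
  move=> t0; apply: (continuous_clamp R_UniformSpace) => // s sI; have [D _] := HA s sI.
  exact: (is_derive_within_continuous _ _ _ _ _ sI D).
have ctb t : 0 < t -> continuous (dir_b T d b w) t.
  move=> t0; apply: (continuous_clamp R_UniformSpace) => // s sI; have [D _] := HB s sI.
  exact: (is_derive_within_continuous _ _ _ _ _ sI D).
have ctc t : 0 < t -> continuous_C (dir_c T d c w) t.
  move=> t0; apply: (continuous_clamp C_R_NormedModule) => // s sI; have [D _] := HC s sI.
  exact: (is_derive_within_continuous _ _ _ _ _ sI D).
split; first by move=> t t0; split; [exact: cta | split; [exact: ctb | exact: ctc]].
move=> w1.
have loww t : 0 <= t <= T -> lambda0 <= symb_a a t w.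
  by move=> tT; have := low t w tT; rewrite w1 pow1 Rmult_1_r.
exists da, db, (symb_a a 0 w), (symb_b b 0 w), (symb_c c 0 w); split.
- by move=> t tT; apply: is_derive_clamp => //; have [] := HA t ltac:(rewrite /Ioc; lra).
- by move=> t tT; apply: is_derive_clamp => //; have [] := HB t ltac:(rewrite /Ioc; lra).
- exact: cta.
- exact: ctb.
- by move=> t tT; rewrite /dir_a clampE; [apply: enl (na t tT) ma; lra | lra].
- by move=> t tT; rewrite /dir_b clampE; [apply: enl (nb t tT) mb; lra | lra].
- by move=> t tT; rewrite /dir_c clampE; [apply: enl (nc t tT) mc; lra | lra].
- by move=> t tT; have [_ [_ h1]] := HA t ltac:(rewrite /Ioc; lra); exact: enl' h1 ma.
- by move=> t tT; have [_ [_ h1]] := HB t ltac:(rewrite /Ioc; lra); exact: enl' h1 mb.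
- by move=> t tT; have [] := bd t tT.
- by move=> t tT; rewrite /dir_a clampE; [apply: loww; lra | lra].
- by apply: loww; lra.
- by move=> t tT; have [_ []] := bd t tT.
- lra.
- lra.
- by move=> t tT; have [_ [_ [_ []]]] := bd t tT.
- by move=> t tT; have [_ [_ [_ []]]] := bd t tT.
- have l0 := pos_INR ell.
  have q0 : 0 < sqrt lambda0 by exact: sqrt_lt_R0.
  have q2 : sqrt lambda0 ^ 2 = lambda0 by rewrite pow2_sqrt //; lra.
  have al w' : norm w' = 1 -> sqrt lambda0 <= alpha a b 0 w'.
    move=> w1'; have [|h1 _] := sqrt_symbol (sqrt lambda0) (symb_a a 0 w') (symb_b b 0 w') q0.
      by rewrite q2; have := low 0 w' ltac:(lra); rewrite w1' pow1 Rmult_1_r.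
    exact: h1.
  have alw := al w w1.
  have le : Rabs (Re (symb_c c 0 w - RtoC (INR ell * symb_b b 0 w))%C) / alpha a b 0 w <=
      2 * ((INR ell + 1) * mu ell a b c).
    (* the factor 2 (ell + 1) undoes the normalisation of mu *)
    rewrite /mu; set Lb := Lub_Rbar _.
    have -> : 2 * ((INR ell + 1) * (/ (2 * (INR ell + 1)) * real Lb)) = real Lb by field; lra.
    apply: (real_Lub_ge _ _ ((m + INR ell * m) * / sqrt lambda0)); first by exists w.
    move=> z [w' [w1' ->]].
    have hw' i : Rabs (w' i) <= 1.
      by rewrite -w1'; exact: (vec_norm_ge_coord (X := R_NormedModule) w' i).
    have [lb1' lb2'] := is_linear_symb_b d w'; have [lc1' lc2'] := is_linear_symb_c d w'.
    have [B1 _] := Hb _ _ _ lb1' (lb2' hw') d0.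
    have [C1 _] := Hc _ _ _ lc1' (fun x => Rle_trans _ _ _ (Req_le _ _ (norm_Cmod _)) (lc2' hw' x)) d0.
    have B1' : Rabs (symb_b b 0 w') <= INR d * Mb := B1.
    have C1' : Cmod (symb_c c 0 w') <= INR d * Mc by rewrite -norm_Cmod; exact: C1.
    have al' := al w' w1'.
    have i1 : 0 < / alpha a b 0 w' by apply: Rinv_0_lt_compat; lra.
    have i2 : / alpha a b 0 w' <= / sqrt lambda0 by apply: Rinv_le_contravar.
    apply: Rmult_le_compat; [exact: Rabs_pos | lra | | exact: i2].
    apply: Rle_trans (Rabs_fst_Cmod _) _; apply: Rle_trans (Cmod_triangle _ _) _.
    rewrite Cmod_opp Cmod_R Rabs_mult (Rabs_right (INR ell)); last lra.
    have := Rmult_le_compat_l _ _ _ l0 (Rle_trans _ _ _ B1' mb); lra.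
  have := Rmult_le_compat_r (alpha a b 0 w) _ _ ltac:(lra) le.
  have -> : forall x, x / alpha a b 0 w * alpha a b 0 w = x by move=> x; field; lra.
  by [].
Qed.

(** * The Fourier-side Cauchy and scattering problems *)

Lemma eqn_W_csol (d ell : nat) (T : R) (a : R -> Rdd d) (b : R -> Rd d) (c : R -> Cd d)
    (g h : R -> C) (xi : Rd d) (t : R) (u du ddu : C) :
  (0 < ell)%N -> Ioc T t ->
  let r := norm xi in
  let w : Rd d := scal (/ r) xi in
  let P := wave_P ell r (dir_b T d b w) (quot T 1 g) in
  let Q := wave_Q ell r (dir_a T d a w) (dir_c T d c w) (quot T 2 h) in
  eqn_W ell a b c g h xi t u du ddu <-> ddu = (- (P t * du + Q t * u))%C.
Proof.
move=> l0 [t0 tT] r w P Q.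
have -> : P t = (RtoC (/ t) * g t + 2 * Ci * RtoC (t ^ ell * r * symb_b b t w))%C.
  by rewrite /P /wave_P /rho /dir_b /quot !clampE // pow_1.
have -> : Q t = (RtoC (t ^ (2 * ell) * r ^ 2 * symb_a a t w)
   + Ci * RtoC (t ^ (ell - 1) * r) * symb_c c t w + RtoC (/ t ^ 2) * h t)%C.
  rewrite /Q /wave_Q /rho /dir_a /dir_c /quot !clampE //.
  have -> : (t ^ ell * r) ^ 2 * symb_a a t w = t ^ (2 * ell) * r ^ 2 * symb_a a t w.
    by rewrite mulnC Rpow_mult_distr -pow_mult.
  have -> : t ^ ell * r / t = t ^ (ell - 1) * r.
    by case: ell l0 {P Q} => [//|e] _; rewrite subn1 /=; field; lra.
  by [].
rewrite /eqn_W -/r -/w.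
set A := RtoC (_ * symb_a _ _ _); set B := RtoC (_ * symb_b _ _ _).
set D := (Ci * RtoC (t ^ (ell - 1) * r) * symb_c c t w)%C.
split=> [E|->]; last by ring.
have -> : ddu = (ddu + A * u + 2 * Ci * B * du + D * u + RtoC (/ t) * g t * du
   + RtoC (/ t ^ 2) * h t * u - (A * u + 2 * Ci * B * du + D * u + RtoC (/ t) * g t * du
   + RtoC (/ t ^ 2) * h t * u))%C by ring.
by rewrite E; ring.
Qed.

Definition solves_at (d ell : nat) (T : R) (a : R -> Rdd d) (b : R -> Rd d)
    (c : R -> Cd d) (g h : R -> C) (xi : Rd d) (u du : R -> C) : Prop :=
  forall t, Ioc T t ->
    is_derive_within (V := C_R_NormedModule) (Ioc T) u t (du t) /\
    exists ddu : C,
      is_derive_within (V := C_R_NormedModule) (Ioc T) du t ddu /\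
      eqn_W ell a b c g h xi t (u t) (du t) ddu.

Lemma csol_ext (T : R) (P Q P' Q' u v : R -> C) :
  (forall t, 0 < t < T -> P t = P' t /\ Q t = Q' t) -> csol T P Q u v -> csol T P' Q' u v.
Proof.
move=> e [Cs Ds]; split=> // t tT; have [<- <-] := e t tT; exact: Ds.
Qed.

Lemma lim_right0_clamp (T : R) (u : R -> C) (p : C) : 0 < T ->
  lim_right0 u p -> lim_right0 (clamp T u) p.
Proof.
move=> T0 hu; apply: filterlim_ext_loc hu.
by apply: (filter_imp _ _ _ (at_right0_interval T T0)) => s sT; rewrite clampE //; lra.
Qed.

Lemma lim_right0_unclamp (T : R) (u : R -> C) (p : C) : 0 < T ->
  lim_right0 (clamp T u) p -> lim_right0 u p.
Proof.
move=> T0 hu; apply: filterlim_ext_loc hu.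
by apply: (filter_imp _ _ _ (at_right0_interval T T0)) => s sT; rewrite clampE //; lra.
Qed.

(** The coefficients are made bounded and continuous on all of [(0, oo)] by [clamp], as the
    existence lemmas require. Their bound [l] depends on [xi]; only [K] is uniform. *)
Lemma frequency_problem (T beta : R) (d ell : nat)
    (a : R -> Rdd d) (b : R -> Rd d) (c : R -> Cd d) (g h : R -> C) (lambda0 : R) :
  0 < T -> 0 < beta -> (0 < ell)%N ->
  class_T beta T a -> class_T beta T b -> class_T beta T c ->
  class_T (X := C_R_NormedModule) beta T g ->
  class_T (X := C_R_NormedModule) beta T h ->
  0 < lambda0 ->
  (forall (t : R) (xi : Rd d), 0 <= t <= T ->
     lambda0 * norm xi ^ 2 <= symb_a a t xi) ->
  (exists M : R, at_right 0 (fun t => Cmod (g t) <= M * t)) ->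
  (exists M : R, at_right 0 (fun t => Cmod (h t) <= M * t ^ 2)) ->
  exists K, 0 < K /\ forall xi : Rd d, exists (P Q : R -> C) (l : R),
    0 <= l /\
    (forall t, 0 < t -> continuous_C P t /\ continuous_C Q t) /\
    (forall t, 0 < t -> Cmod (P t) <= l /\ Cmod (Q t) <= l) /\
    (forall t u du ddu, Ioc T t ->
       eqn_W ell a b c g h xi t u du ddu <-> ddu = (- (P t * du + Q t * u))%C) /\
    (forall u v p q, csol T P Q u v -> lim_right0 u p -> lim_right0 v q ->
       size0 ell xi p q <= K * (Rpower (bracket xi) (mu ell a b c) * sizeT ell xi (u T) (v T)) /\
       sizeT ell xi (u T) (v T) <= K * (Rpower (bracket xi) (mu ell a b c) * size0 ell xi p q)).
Proof.
move=> T0 beta0 l0 ca cb cc cg ch lam0 low bg bh.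
have [M [M0 HM]] := direction_symbols T beta d ell a b c g h lambda0 T0 beta0 ca cb cc cg ch lam0 low bg bh.
pose nu := (INR ell + 1) * mu ell a b c.
have [K [K0 HK]] := frequency_bounds T beta lambda0 M nu ell T0 beta0 lam0 M0 l0.
exists (2 * K + 1); split; first lra.
move=> xi; set r := norm xi; pose w : Rd d := scal (/ r) xi.
have r0 : 0 <= r := norm_ge_0 xi.
have n1 : 0 < r -> norm w = 1 by move=> rp; exact: norm_scal_inv.
have hw i : Rabs (w i) <= 1.
  have [rp|rz] : 0 < r \/ r = 0 by lra.
    by rewrite -(n1 rp); exact: (vec_norm_ge_coord (X := R_NormedModule) w i).
  have xi0 : xi = zero by apply: norm_eq_zero.
  have -> : w i = 0 by rewrite /w xi0 scal_zero_r.
  rewrite Rabs_R0; lra.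
have [bd [ct sy]] := HM w hw.
pose P0 := wave_P ell r (dir_b T d b w) (quot T 1 g).
pose Q0 := wave_Q ell r (dir_a T d a w) (dir_c T d c w) (quot T 2 h).
have crho t : 0 < t -> continuous (rho ell r) t.
  by move=> t0; apply: ex_derive_continuous; eexists; exact: is_derive_rho.
have addc (f1 f2 : R -> C) t : continuous_C f1 t -> continuous_C f2 t -> continuous_C (fun s => (f1 s + f2 s)%C) t.
  exact: (continuous_plus (V := C_R_NormedModule)).
have realc (f1 : R -> R) t : continuous f1 t -> continuous_C (fun s => RtoC (f1 s)) t.
  by move=> cf; apply: continuous_C_pair => //=; exact: continuous_const.
have cP0 t : 0 < t -> continuous_C P0 t.
  move=> t0; have [_ [cb' _]] := ct t t0.
  apply: addc; first exact: continuous_quot cg t0.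
  have cf : continuous (fun s => 2 * (rho ell r s * dir_b T d b w s)) t.
    apply: (continuous_mult (fun=> 2)); first exact: continuous_const.
    by apply: (continuous_mult (rho ell r)) => //; exact: crho.
  have e s : (Ci * RtoC (2 * (rho ell r s * dir_b T d b w s)) * RtoC 1)%C =
      (2 * Ci * RtoC (rho ell r s * dir_b T d b w s))%C by rewrite RtoC_mult; ring.
  exact: (continuous_ext _ _ _ e (continuous_Ci_scal _ (fun=> RtoC 1) t cf (continuous_const _ _))).
have cQ0 t : 0 < t -> continuous_C Q0 t.
  move=> t0; have [ca' [_ cc']] := ct t t0; have cr := crho t t0.
  have cA : continuous_C (fun s => RtoC (rho ell r s ^ 2 * dir_a T d a w s)) t.
    apply: (realc (fun s => rho ell r s ^ 2 * dir_a T d a w s)); apply: (continuous_mult (fun s => rho ell r s ^ 2)) => //.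
    apply: (continuous_ext (fun s => rho ell r s * rho ell r s)); first by move=> s /=; ring.
    exact: (continuous_mult (rho ell r)).
  have cB : continuous_C (fun s => (Ci * RtoC (rho ell r s / s) * dir_c T d c w s)%C) t.
    apply: (continuous_Ci_scal (fun s => rho ell r s / s)) => //.
    apply: (continuous_mult (rho ell r) (fun s => / s)) => //.
    apply: (ex_derive_continuous (fun s => / s)); auto_derive; lra.
  exact: (addc _ _ t (addc _ _ t cA cB) (continuous_quot beta T 2 h t T0 ch t0)).
pose P := clamp T P0; pose Q := clamp T Q0.
have cRmin t : 0 < t -> continuous (fun s => Rmin s T) t.
  move=> t0; apply: (continuous_clamp R_UniformSpace T (fun s => s)) => // s _.
  by move=> S HS; apply: filter_imp HS.
have cPQ t : 0 < t -> continuous_C P t /\ continuous_C Q t.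
  move=> t0; have mt : 0 < Rmin t T by exact: Rmin_glb_lt.
  split; apply: (continuous_comp (fun s => Rmin s T) _ t (cRmin t t0)).
    exact: cP0.
  exact: cQ0.
have [L [L0 HL]] := low_zone_coefs M (Rmax 1 ((r + 1) * T)) ell M0 (Rmax_l _ _) l0.
pose k1 := r + 1.
have bPQ t : 0 < t -> Cmod (P t) <= L * k1 ^ 2 /\ Cmod (Q t) <= L * k1 ^ 2.
  move=> t0; have mt : 0 < Rmin t T by exact: Rmin_glb_lt.
  have mT : Rmin t T <= T by exact: Rmin_r.
  have [b1 [b2 [b3 [b4 b5]]]] := bd (Rmin t T) (conj mt mT).
  have k11 : 1 <= k1 by rewrite /k1; lra.
  have rk : r <= k1 ^ S ell.
    have := pow_R1_Rle k1 ell k11; rewrite /= /k1; nra.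
  have kt : k1 * Rmin t T <= Rmax 1 ((r + 1) * T).
    by apply: Rle_trans (Rmax_r _ _); rewrite /k1; apply: Rmult_le_compat_l; lra.
  have [h1 h2] := HL r k1 (Rmin t T) (dir_a T d a w) (dir_b T d b w) (dir_c T d c w)
    (quot T 1 g) (quot T 2 h) r0 rk k11 mt kt b1 b2 b3 b4 b5.
  split; last exact: h2.
  by apply: Rle_trans h1 _; apply: Rmult_le_compat_l => //; rewrite /=; nra.
exists P, Q, (L * k1 ^ 2); split; first by apply: Rmult_le_pos => //; exact: pow2_ge_0.
split; first exact: cPQ.
split; first exact: bPQ.
split.
  move=> t u du ddu tI; rewrite /P /Q !clampE; try exact: (proj2 tI).
  exact: eqn_W_csol.
move=> u v p q S hu hv.
have S0 : csol T P0 Q0 u v.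
  by apply: csol_ext S => t tT; rewrite /P /Q !clampE //; lra.
have kk := bracket_root_pow d ell xi.
have [|s0 [s0T Hs]] := HK r (bracket_root d ell xi) _ _ _ _ _ r0 (bracket_root_ge1 d ell xi) kk bd _ u v S0.
  by move=> rp; exact: sy (n1 rp).
have [r1 r2] := sizes_of_energies d ell xi K (mu ell a b c) p q (u T) (v T) (Rlt_le _ _ K0).
split.
  apply: r1. apply: (energy_limit_le _ _ u v p q s0 (proj1 s0T) hu hv) => s sI.
  by have [] := Hs s sI.
apply: r2; apply: (energy_limit_ge _ _ _ u v p q s0 (proj1 s0T) hu hv) => s sI.
by have [] := Hs s sI.
Qed.

Lemma csol_full_solves_at (d ell : nat) (T : R) (a : R -> Rdd d) (b : R -> Rd d) (c : R -> Cd d)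
    (g h : R -> C) (xi : Rd d) (P Q u v : R -> C) :
  (forall t u du ddu, Ioc T t ->
     eqn_W ell a b c g h xi t u du ddu <-> ddu = (- (P t * du + Q t * u))%C) ->
  csol_full T P Q u v -> solves_at d ell T a b c g h xi u v.
Proof.
move=> E S t tI; have [D1 D2] := S t tI.
split; first exact: is_derive_is_derive_within.
exists (- (P t * v t + Q t * u t))%C; split; first exact: is_derive_is_derive_within.
exact/E.
Qed.

Lemma solves_at_csol (d ell : nat) (T : R) (a : R -> Rdd d) (b : R -> Rd d) (c : R -> Cd d)
    (g h : R -> C) (xi : Rd d) (P Q u v : R -> C) :
  0 < T ->
  (forall t u du ddu, Ioc T t ->
     eqn_W ell a b c g h xi t u du ddu <-> ddu = (- (P t * du + Q t * u))%C) ->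
  solves_at d ell T a b c g h xi u v -> csol T P Q (clamp T u) (clamp T v).
Proof.
move=> T0 E S; split=> t tT.
  split; apply: (continuous_clamp C_R_NormedModule) => //; try exact: (proj1 tT);
    move=> s sI; have [D1 [dd [D2 _]]] := S s sI.
    exact: is_derive_within_continuous D1.
  exact: is_derive_within_continuous D2.
have tI : Ioc T t by rewrite /Ioc; lra.
have [D1 [dd [D2 /(E _ _ _ _ tI) e]]] := S t tI.
rewrite !clampE; try lra.
by split; [exact: is_derive_clamp | rewrite -e; exact: is_derive_clamp].
Qed.

Theorem corollary3p8 (T beta : R) (d ell : nat)
    (a : R -> Rdd d) (b : R -> Rd d) (c : R -> Cd d) (g h : R -> C) (lambda0 : R) :
  0 < T -> (0 < d)%N -> 0 < beta -> (0 < ell)%N ->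
  class_T beta T a -> class_T beta T b -> class_T beta T c ->
  class_T (X := C_R_NormedModule) beta T g ->
  class_T (X := C_R_NormedModule) beta T h ->
  0 < lambda0 ->
  (forall (t : R) (xi : Rd d), 0 <= t <= T ->
     lambda0 * norm xi ^ 2 <= symb_a a t xi) ->
  g 0 = RtoC 0 ->
  h 0 = RtoC 0 ->
  is_derive_within (V := C_R_NormedModule) (Icc T) h 0 (RtoC 0) ->
  (exists M : R, at_right 0 (fun t => Cmod (g t) <= M * t)) ->
  (exists M : R, at_right 0 (fun t => Cmod (h t) <= M * t ^ 2)) ->
  (* asymptotics *)
  (exists K : R, 0 < K /\
    forall phi0 phi1 : Rd d -> C, exists phi dphi : R -> Rd d -> C,
      (solves_W ell T a b c g h phi dphi /\
       forall xi, phi T xi = phi0 xi /\ dphi T xi = phi1 xi) /\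
      (forall psi dpsi : R -> Rd d -> C,
         solves_W ell T a b c g h psi dpsi ->
         (forall xi, psi T xi = phi0 xi /\ dpsi T xi = phi1 xi) ->
         forall t xi, 0 < t <= T -> psi t xi = phi t xi /\ dpsi t xi = dphi t xi) /\
      forall xi : Rd d, exists p0 p1 : C,
        lim_right0 (fun tau => phi tau xi) p0 /\
        lim_right0 (fun tau => dphi tau xi) p1 /\
        size0 ell xi p0 p1 <=
          K * (Rpower (bracket xi) (mu ell a b c)
               * sizeT ell xi (phi T xi) (dphi T xi)))
  /\
  (* scattering *)
  (exists K : R, 0 < K /\
    forall phi0 phi1 : Rd d -> C, exists phi dphi : R -> Rd d -> C,
      (solves_W ell T a b c g h phi dphi /\
       forall xi, lim_right0 (fun tau => phi tau xi) (phi0 xi) /\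
                  lim_right0 (fun tau => dphi tau xi) (phi1 xi)) /\
      (forall psi dpsi : R -> Rd d -> C,
         solves_W ell T a b c g h psi dpsi ->
         (forall xi, lim_right0 (fun tau => psi tau xi) (phi0 xi) /\
                     lim_right0 (fun tau => dpsi tau xi) (phi1 xi)) ->
         forall t xi, 0 < t <= T -> psi t xi = phi t xi /\ dpsi t xi = dphi t xi) /\
      forall xi : Rd d,
        sizeT ell xi (phi T xi) (dphi T xi) <=
          K * (Rpower (bracket xi) (mu ell a b c)
               * size0 ell xi (phi0 xi) (phi1 xi))).
Proof.
move=> T0 _ beta0 l0 ca cb cc cg ch lam0 low _ _ _ bg bh.
have [K [K0 HK]] := frequency_problem T beta d ell a b c g h lambda0 T0 beta0 l0
  ca cb cc cg ch lam0 low bg bh.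
have clampT (u : R -> C) : clamp T u T = u T by apply: clampE; lra.
split; exists K; split=> //; move=> phi0 phi1.
- pose good xi (s : (R -> C) * (R -> C)) :=
    solves_at d ell T a b c g h xi (fst s) (snd s) /\
    fst s T = phi0 xi /\ snd s T = phi1 xi.
  have [s Hs] : exists s, forall xi, good xi (s xi).
    apply: functional_choice => xi.
    have [P [Q [l [_ [cPQ [bPQ [E _]]]]]]] := HK xi.
    have [u [v [S [eu ev]]]] := csol_exists T l P Q (phi0 xi) (phi1 xi) T0 cPQ bPQ.
    exists (u, v); split; last by [].
    exact: csol_full_solves_at E S.
  exists (fun t xi => fst (s xi) t), (fun t xi => snd (s xi) t); split; [|split].
  + by split=> xi; [exact: (proj1 (Hs xi)) | exact: (proj2 (Hs xi))].
  + move=> psi dpsi Hpsi dat t xi tT.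
    have [P [Q [l [l0' [_ [bPQ [E _]]]]]]] := HK xi.
    have bd : coef_bound T l P Q by move=> x xT; apply: bPQ; lra.
    have [S1 [e1 e2]] := Hs xi; have [f1 f2] := dat xi.
    have C1 := solves_at_csol _ _ _ _ _ _ _ _ _ _ _ _ _ T0 E S1.
    have C2 := solves_at_csol _ _ _ _ _ _ _ _ _ _ _ _ _ T0 E (Hpsi xi).
    have := csol_unique_end T l P Q _ _ _ _ T0 l0' bd C2 C1.
    rewrite !clampT e1 e2 f1 f2 => /(_ erefl erefl t tT).
    by rewrite !clampE; try exact: (proj2 tT).
  + move=> xi.
    have [P [Q [l [l0' [_ [bPQ [E bnd]]]]]]] := HK xi.
    have bd : coef_bound T l P Q by move=> x xT; apply: bPQ; lra.
    have [S1 _] := Hs xi.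
    have C1 := solves_at_csol _ _ _ _ _ _ _ _ _ _ _ _ _ T0 E S1.
    have [p [q [hp hq]]] := csol_limits T l P Q _ _ T0 l0' bd C1.
    have [b1 _] := bnd _ _ p q C1 hp hq.
    exists p, q; split; first exact: lim_right0_unclamp T0 hp.
    split; first exact: lim_right0_unclamp T0 hq.
    by rewrite !clampT in b1.
- pose good xi (s : (R -> C) * (R -> C)) :=
    solves_at d ell T a b c g h xi (fst s) (snd s) /\
    lim_right0 (fst s) (phi0 xi) /\ lim_right0 (snd s) (phi1 xi).
  have [s Hs] : exists s, forall xi, good xi (s xi).
    apply: functional_choice => xi.
    have [P [Q [l [l0' [cPQ [bPQ [E _]]]]]]] := HK xi.
    have [u [v [S [eu ev]]]] := csol_scattering T l P Q (phi0 xi) (phi1 xi) T0 l0' cPQ bPQ.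
    exists (u, v); split; last by [].
    exact: csol_full_solves_at E S.
  exists (fun t xi => fst (s xi) t), (fun t xi => snd (s xi) t); split; [|split].
  + by split=> xi; [exact: (proj1 (Hs xi)) | exact: (proj2 (Hs xi))].
  + move=> psi dpsi Hpsi dat t xi tT.
    have [P [Q [l [l0' [_ [bPQ [E _]]]]]]] := HK xi.
    have bd : coef_bound T l P Q by move=> x xT; apply: bPQ; lra.
    have [S1 [e1 e2]] := Hs xi; have [f1 f2] := dat xi.
    have C1 := solves_at_csol _ _ _ _ _ _ _ _ _ _ _ _ _ T0 E S1.
    have C2 := solves_at_csol _ _ _ _ _ _ _ _ _ _ _ _ _ T0 E (Hpsi xi).
    have := csol_unique_limits T l P Q _ _ _ _ _ _ T0 l0' bd C2 C1
      (lim_right0_clamp _ _ _ T0 f1) (lim_right0_clamp _ _ _ T0 f2)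
      (lim_right0_clamp _ _ _ T0 e1) (lim_right0_clamp _ _ _ T0 e2) t tT.
    by rewrite !clampE; try exact: (proj2 tT).
  + move=> xi.
    have [P [Q [l [_ [_ [_ [E bnd]]]]]]] := HK xi.
    have [S1 [e1 e2]] := Hs xi.
    have C1 := solves_at_csol _ _ _ _ _ _ _ _ _ _ _ _ _ T0 E S1.
    have [_ b2] := bnd _ _ _ _ C1 (lim_right0_clamp _ _ _ T0 e1) (lim_right0_clamp _ _ _ T0 e2).
    by rewrite !clampT in b2.
Qed.
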